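(* Let $\alpha>0$ and $g\in L^2(\Omega)$. Let $u$ be the unique minimizer of $$E_{\rm rof}(v)=|{\rm D}v|(\Omega)+\frac\alpha2\|v-g\|^2$$ in $BV(\Omega)\cap L^2(\Omega)$, let $u_h$ be the unique minimizer of $$E^h_{\rm rof}(v_h)=\int_\Omega|\nabla v_h|\,dx+\frac\alpha2\|v_h-g_h\|^2$$ in $X_h$, and let $p_h$ be a maximizer of $$D^h_{\rm rof}(q_h)=-\frac1{2\alpha}\|\operatorname{div}q_h+\alpha g_h\|^2-I_{K_1(0)}(q_h)+\frac\alpha2\|g_h\|^2$$ in $Y_h$. Then for any $v_h\in X_h$ and any $q_h\in Y_h$ with $|q_h|\le1$ in $\Omega$ we have $$\frac\alpha2\|u-u_h\|^2\le\eta^h_{\rm rof}(v_h,q_h)^2+c\|g-g_h\|,$$ where $\eta^h_{\rm rof}(v_h,q_h)^2=E^h_{\rm rof}(v_h)-D^h_{\rm rof}(q_h)$ and $c>0$ is a mesh-independent constant (independent of $h$) depending on $\|g\|$.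
   Context: $\Omega\subset\mathbb{R}^d$, $d=2,3$, is a bounded polygonal (polyhedral) Lipschitz domain, $\|\cdot\|$ is the $L^2(\Omega)$-norm, $|\cdot|$ the Euclidean norm, and $|{\rm D}v|(\Omega)$ the total variation of $v\in BV(\Omega)$. $H_{\rm N}(\operatorname{div};\Omega)$ is the space of vector fields $p\in L^2(\Omega;\mathbb{R}^d)$ with distributional divergence in $L^2(\Omega)$ and vanishing normal component $p\cdot n=0$ on $\partial\Omega$ (in the distributional sense). $(\mathcal{T}_h)_{h>0}$ is a family of regular triangulations of $\Omega$; $\mathcal{S}^1(\mathcal{T}_h)$ is the space of continuous, elementwise affine functions; $\mathcal{L}^k(\mathcal{T}_h)$ is the space of (possibly discontinuous) functions that are elementwise polynomial of degree at most $k$; a superscript $d$ denotes the corresponding vector fields. $X_h=\mathcal{S}^1(\mathcal{T}_h)$, and $Y_h$ is either of the two spaces $\mathcal{S}^1(\mathcal{T}_h)^d\cap H_{\rm N}(\operatorname{div};\Omega)$ or $\mathcal{L}^1(\mathcal{T}_h)^d\cap H_{\rm N}(\operatorname{div};\Omega)$. $g_h\in\mathcal{L}^0(\mathcal{T}_h)$ is the elementwise $L^2$-projection of $g$ (its elementwise mean). $I_{K_1(0)}(q)=0$ if $|q|\le1$ in $\Omega$ and $+\infty$ otherwise. *)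

(* Defs.v *)
From HB Require Import structures.
From mathcomp Require Import all_boot all_order all_algebra.
From mathcomp Require Import all_classical all_reals all_analysis.

Set Implicit Arguments.
Unset Strict Implicit.
Unset Printing Implicit Defensive.
Import Order.TTheory GRing.Theory Num.Theory.
Import numFieldNormedType.Exports.

Local Open Scope classical_set_scope.
Local Open Scope ring_scope.

(* The sigma-algebra generated by the coordinates is the Borel one, the
   topology of 'rV[R]_n being second countable. *)
Definition rV_display : measure_display. Proof. exact. Qed.

Section measurable_rV.
Variables (R : realType) (n : nat).

Definition coord_rV (i : 'I_n) (x : 'rV[R]_n) : measurableTypeR R := x 0 i.

Let rV_set0 : g_sigma_preimage coord_rV set0.
Proof. exact: sigma_algebra0. Qed.

Let rV_setC A : g_sigma_preimage coord_rV A -> g_sigma_preimage coord_rV (~` A).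
Proof. exact: sigma_algebraC. Qed.

Let rV_bigcup (F : (set 'rV[R]_n)^nat) :
  (forall i, g_sigma_preimage coord_rV (F i)) ->
  g_sigma_preimage coord_rV (\bigcup_i (F i)).
Proof. exact: sigma_algebra_bigcup. Qed.

HB.instance Definition _ := @isMeasurable.Build rV_display
  'rV[R]_n (g_sigma_preimage coord_rV) rV_set0 rV_setC rV_bigcup.

End measurable_rV.

Lemma measurable_coord_rV (R : realType) n (i : 'I_n) :
  measurable_fun [set: 'rV[R]_n] (coord_rV i).
Proof.
move=> _ Y mY; rewrite setTI; apply: sub_sigma_algebra => /=.
rewrite -bigcup_seq/=; exists i => /=; first by rewrite mem_index_enum.
by exists Y => //; rewrite setTI.
Qed.

Lemma measurable_fun_rV (R : realType) n d (T : measurableType d)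
    (f : T -> 'rV[R]_n) :
  (forall i, measurable_fun [set: T] (coord_rV i \o f)) ->
  measurable_fun [set: T] f.
Proof.
move=> mf _ A mA; rewrite setTI.
have : g_sigma_preimage (@coord_rV R n) `<=` [set B | measurable (f @^-1` B)].
  apply: smallest_sub.
    split => /=.
    - by rewrite preimage_set0.
    - move=> B mB; rewrite setTD preimage_setC; exact: measurableC.
    - by move=> F mF; rewrite preimage_bigcup; exact: bigcupT_measurable.
  rewrite -bigcup_seq => B /= [i _] [C mC <-]; rewrite setTI.
  by rewrite -[X in measurable X]setTI; apply: mf.
exact.
Qed.

Section cons_measure.
Variables (R : realType) (n : nat).
Variable m : {sigma_finite_measure set 'rV[R]_n -> \bar R}.

Local Notation prodm := (product_measure1 (@lebesgue_measure R) m).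

Definition cons_rV (p : measurableTypeR R * 'rV[R]_n) : 'rV[R]_n.+1 :=
  row_mx (const_mx p.1 : 'rV[R]_1) p.2.

Lemma measurable_cons_rV : measurable_fun setT cons_rV.
Proof.
apply: measurable_fun_rV => i.
rewrite (_ : _ \o _ = fun p : measurableTypeR R * 'rV[R]_n =>
    match fintype.split (i : 'I_(1 + n)) with
    | inl _ => p.1 | inr j => coord_rV j p.2 end); last first.
  apply/funext => p; rewrite /coord_rV /cons_rV /= mxE.
  by case: (fintype.split _) => j //; rewrite mxE.
case: (fintype.split _) => j; first exact: measurable_fst.
by apply: measurableT_comp; [exact: measurable_coord_rV|exact: measurable_snd].
Qed.

Definition cons_measure : set 'rV[R]_n.+1 -> \bar R := pushforward prodm cons_rV.

Let mpre A : measurable A -> measurable (cons_rV @^-1` A).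
Proof.
by move=> mA; rewrite -[X in measurable X]setTI; exact: measurable_cons_rV.
Qed.

Let cons_measure0 : cons_measure set0 = 0%E.
Proof. by rewrite /cons_measure /pushforward preimage_set0 measure0. Qed.

Let cons_measure_ge0 A : (0 <= cons_measure A)%E.
Proof. by rewrite /cons_measure /pushforward measure_ge0. Qed.

Let cons_measure_sigma_additive : semi_sigma_additive cons_measure.
Proof.
move=> F mF tF mUF; rewrite /cons_measure /pushforward preimage_bigcup.
apply: measure_semi_sigma_additive.
- by move=> k; exact: mpre.
- apply/trivIsetP => /= i j _ _ ij; rewrite -preimage_setI.
  by move/trivIsetP : tF => /(_ _ _ _ _ ij) ->//; rewrite preimage_set0.
- by rewrite -preimage_bigcup; exact: mpre.
Qed.

HB.instance Definition _ := isMeasure.Build _ _ _ cons_measure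
  cons_measure0 cons_measure_ge0 cons_measure_sigma_additive.

Let uncons_rV (x : 'rV[R]_n.+1) : measurableTypeR R * 'rV[R]_n :=
  (x 0 0, rsubmx (x : 'rV[R]_(1 + n))).

Let measurable_uncons_rV : measurable_fun setT uncons_rV.
Proof.
apply/measurable_fun_pairP; split; first exact: (measurable_coord_rV 0).
apply: measurable_fun_rV => i.
rewrite (_ : _ \o _ = coord_rV (rshift 1 i : 'I_n.+1)).
  exact: measurable_coord_rV.
by apply/funext => x; rewrite /coord_rV /= mxE.
Qed.

Let cons_rVK p : uncons_rV (cons_rV p) = p.
Proof.
case: p => a v; congr (_, _); last exact: row_mxKr.
by rewrite /cons_rV mxE; case: fintype.splitP => j //= _; rewrite mxE.
Qed.

Let cons_measure_sigma_finite : sigma_finite setT cons_measure.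
Proof.
have /sigma_finiteP[F [UF ndF Foo]] := sigma_finiteT (@lebesgue_measure R).
have /sigma_finiteP[G [UG ndG Goo]] := sigma_finiteT m.
exists (fun k => uncons_rV @^-1` (F k `*` G k)).
  rewrite -preimage_bigcup -[LHS](preimage_setT uncons_rV); congr (_ @^-1` _).
  rewrite -setXTT UF UG predeqE => -[x y]; split.
    move=> [/= [i _ Fix] [j _ Gjy]]; exists (maxn i j) => //; split.
    - by move: x Fix; exact/subsetPset/ndF/leq_maxl.
    - by move: y Gjy; exact/subsetPset/ndG/leq_maxr.
  by move=> [i _ []/= ? ?]; split; exists i.
move=> k; have [mF Fk] := Foo k; have [mG Gk] := Goo k.
have mFG : measurable (F k `*` G k) by exact: measurableX.
split.
  by rewrite -[X in measurable X]setTI; exact: measurable_uncons_rV.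
rewrite /cons_measure /pushforward -comp_preimage.
rewrite (_ : _ \o _ = id); last by apply/funext => p; exact: cons_rVK.
by rewrite preimage_id product_measure1E// lte_mul_pinfty// ge0_fin_numE.
Qed.

HB.instance Definition _ := Measure_isSigmaFinite.Build _ _ _ cons_measure
  cons_measure_sigma_finite.

End cons_measure.

Fixpoint lebesgue_rV (R : realType) (n : nat) :
    {sigma_finite_measure set 'rV[R]_n -> \bar R} :=
  if n is n'.+1 then cons_measure (lebesgue_rV R n') else \d_(0 : 'rV[R]_0).

Section euclidean.
Variables (R : realType) (d : nat).
Implicit Types (x y : 'rV[R]_d).

Definition dotp x y : R := \sum_i x 0 i * y 0 i.

(* [`|x|] is the sup norm on 'rV[R]_d. *)
Definition enorm x : R := Num.sqrt (dotp x x).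

End euclidean.

Section calculus.
Variables (R : realType) (d : nat).
Implicit Types (f : 'rV[R]_d -> R) (phi : 'rV[R]_d -> 'rV[R]_d).

Definition pderiv (i : 'I_d) f : 'rV[R]_d -> R := 'D_(delta_mx 0 i) f.

Definition grad f (x : 'rV[R]_d) : 'rV[R]_d := \row_i pderiv i f x.

Definition cdiv phi (x : 'rV[R]_d) : R :=
  \sum_i pderiv i (fun y => phi y 0 i) x.

Fixpoint Ck (k : nat) f : Prop :=
  continuous f /\
  if k is k'.+1 then
    forall i, (forall x, derivable f x (delta_mx 0 i)) /\ Ck k' (pderiv i f)
  else True.

Definition smooth f : Prop := forall k, Ck k f.

Definition supp (V : zmodType) (f : 'rV[R]_d -> V) : set 'rV[R]_d :=
  closure [set x | f x <> 0].

Definition compact_supp_in (V : zmodType) (Omega : set 'rV[R]_d)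
    (f : 'rV[R]_d -> V) : Prop :=
  compact (supp f) /\ supp f `<=` Omega.

End calculus.

Section domains.
Variables (R : realType) (d : nat).
Implicit Types (Omega K F : set 'rV[R]_d) (V : 'I_d.+1 -> 'rV[R]_d).

Definition aff_indep V : Prop :=
  forall mu : 'I_d.+1 -> R,
    \sum_i mu i = 0 -> \sum_i mu i *: V i = 0 -> forall i, mu i = 0.

Definition hull V (I : {set 'I_d.+1}) : set 'rV[R]_d :=
  [set x | exists lam : 'I_d.+1 -> R,
    [/\ forall i, 0 <= lam i, \sum_(i in I) lam i = 1
      & x = \sum_(i in I) lam i *: V i]].

Definition simplex K : Prop :=
  exists2 V, aff_indep V & K = hull V [set: 'I_d.+1]%SET.

(* [I] may be empty, so that set0 is a face. *)
Definition face F K : Prop :=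
  exists V (I : {set 'I_d.+1}),
    [/\ aff_indep V, K = hull V [set: 'I_d.+1]%SET & F = hull V I].

Definition polyhedral Omega : Prop :=
  exists Th : set (set 'rV[R]_d),
    [/\ finite_set Th, forall K, Th K -> simplex K
      & \bigcup_(K in Th) K = closure Omega].

(* Near each boundary point, Omega is the strict epigraph, in the direction of
   a unit vector e, of a Lipschitz function of the component orthogonal to e. *)
Definition lipschitz_boundary Omega : Prop :=
  forall x, (closure Omega `\` Omega) x ->
    exists (e : 'rV[R]_d) (gamma : 'rV[R]_d -> R),
      [/\ enorm e = 1, lipschitz gamma
        & \forall y \near x,
            Omega y <-> gamma (y - dotp y e *: e) < dotp y e].

Definition polyhedral_lipschitz_domain Omega : Prop :=
  [/\ Omega !=set0, open Omega, connected Omega & bounded_set Omega] /\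
  polyhedral Omega /\ lipschitz_boundary Omega.

(* Regular in the sense of Ciarlet: no hanging nodes. *)
Definition regular_triangulation Omega (Th : set (set 'rV[R]_d)) : Prop :=
  [/\ finite_set Th, forall K, Th K -> simplex K,
      \bigcup_(K in Th) K = closure Omega
    & forall K L, Th K -> Th L -> K <> L -> face (K `&` L) K /\ face (K `&` L) L].

End domains.

Section function_spaces.
Variables (R : realType) (d : nat) (Omega : set 'rV[R]_d).
Local Notation mu := (lebesgue_rV R d).
Implicit Types (v w f g : 'rV[R]_d -> R) (p q : 'rV[R]_d -> 'rV[R]_d).

Definition L2 f : Prop :=
  measurable_fun Omega f /\ mu.-integrable Omega (fun x => (f x ^+ 2)%:E).

Definition L2norm f : R := Num.sqrt (\int[mu]_(x in Omega) (f x ^+ 2)).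

Definition L2vec q : Prop := forall i, L2 (fun x => q x 0 i).

Definition TV v : \bar R :=
  ereal_sup [set (\int[mu]_(x in Omega) (v x * cdiv phi x))%:E | phi in
    [set phi : 'rV[R]_d -> 'rV[R]_d |
      [/\ forall i, Ck 1 (fun x => phi x 0 i), compact_supp_in Omega phi
        & forall x, enorm (phi x) <= 1]]].

Definition BV v : Prop :=
  mu.-integrable Omega (EFin \o v) /\ (TV v < +oo)%E.

Definition is_weak_div q w : Prop :=
  L2 w /\
  forall phi : 'rV[R]_d -> R, smooth phi -> compact_supp_in Omega phi ->
    \int[mu]_(x in Omega) dotp (q x) (grad phi x) =
    - \int[mu]_(x in Omega) (w x * phi x).

(* Determined almost everywhere in Omega; 0 if there is no weak divergence. *)
Definition wdiv q : 'rV[R]_d -> R := xget (fun=> 0) [set w | is_weak_div q w].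

Definition Hdiv q : Prop := L2vec q /\ exists w, is_weak_div q w.

(* q . n = 0 as a functional: Green's formula has no boundary term, for all
   test functions that are C^1 up to the boundary. *)
Definition normal_trace0 q : Prop :=
  forall phi : 'rV[R]_d -> R, Ck 1 phi ->
    \int[mu]_(x in Omega) (dotp (q x) (grad phi x) + wdiv q x * phi x) = 0.

Definition HN : set ('rV[R]_d -> 'rV[R]_d) :=
  [set q | Hdiv q /\ normal_trace0 q].

Definition unit_ball_ae q : Prop :=
  {ae mu, forall x, Omega x -> enorm (q x) <= 1}.

End function_spaces.

Section finite_elements.
Variables (R : realType) (d : nat) (Omega : set 'rV[R]_d).
Variable Th : set (set 'rV[R]_d).
Local Notation mu := (lebesgue_rV R d).
Implicit Types (v f g : 'rV[R]_d -> R) (q : 'rV[R]_d -> 'rV[R]_d).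

Definition poly_le (k : nat) f : Prop :=
  exists c : {ffun 'I_d -> 'I_k.+1} -> R, forall x,
    f x = \sum_(m : {ffun 'I_d -> 'I_k.+1} | (\sum_i m i <= k)%N)
            c m * \prod_i x 0 i ^+ m i.

(* Elements are closed; a function in [Lk] is unconstrained on their
   boundaries, which are null sets. *)
Definition Lk (k : nat) v : Prop :=
  forall K, Th K -> exists2 f, poly_le k f & forall x, K° x -> v x = f x.

Definition S1 : set ('rV[R]_d -> R) :=
  [set v | {within closure Omega, continuous v} /\
           forall K, Th K -> exists2 f, poly_le 1 f & forall x, K x -> v x = f x].

Definition S1vec_HN : set ('rV[R]_d -> 'rV[R]_d) :=
  [set q : 'rV[R]_d -> 'rV[R]_d | (forall i, S1 (fun x => q x 0 i)) /\ HN Omega q].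

Definition L1vec_HN : set ('rV[R]_d -> 'rV[R]_d) :=
  [set q : 'rV[R]_d -> 'rV[R]_d | (forall i, Lk 1 (fun x => q x 0 i)) /\ HN Omega q].

Definition elt_mean g (x : 'rV[R]_d) : R :=
  \sum_(K \in Th) \1_(K°) x *
    ((fine (mu K°))^-1 * \int[mu]_(y in K°) g y).

End finite_elements.

Section rof.
Variables (R : realType) (d : nat) (Omega : set 'rV[R]_d) (alpha : R).
Local Notation mu := (lebesgue_rV R d).
Implicit Types (u v g gh : 'rV[R]_d -> R) (q : 'rV[R]_d -> 'rV[R]_d).

Definition E_rof g v : \bar R :=
  (TV Omega v + (alpha / 2 * L2norm Omega (v \- g) ^+ 2)%:E)%E.

Definition Eh_rof gh v : R :=
  \int[mu]_(x in Omega) enorm (grad v x)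
  + alpha / 2 * L2norm Omega (v \- gh) ^+ 2.

Definition I_K10 q : \bar R :=
  if `[< unit_ball_ae Omega q >] then 0%E else +oo%E.

Definition Dh_rof gh q : \bar R :=
  ((- (2 * alpha)^-1 *
      L2norm Omega (fun x => wdiv Omega q x + alpha * gh x)%R ^+ 2)%:E
   - I_K10 q + (alpha / 2 * L2norm Omega gh ^+ 2)%:E)%E.

Definition eta_rof_sq gh v q : \bar R := ((Eh_rof gh v)%:E - Dh_rof gh q)%E.

End rof.

Definition is_minimizer (R : realType) (T : Type) (A : set T) (J : T -> \bar R)
    (u : T) : Prop := A u /\ forall v, A v -> (J u <= J v)%E.

Definition is_maximizer (R : realType) (T : Type) (A : set T) (J : T -> \bar R)
    (u : T) : Prop := A u /\ forall v, A v -> (J v <= J u)%E.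

(* Main.v *)
Require Import Defs.
From HB Require Import structures.
From mathcomp Require Import all_boot all_order all_algebra.
From mathcomp Require Import all_classical all_reals all_analysis.
From mathcomp Require Import measurable_realfun ring lra.

Set Implicit Arguments.
Unset Strict Implicit.
Unset Printing Implicit Defensive.
Import Order.TTheory GRing.Theory Num.Theory.
Import numFieldNormedType.Exports.
Local Open Scope classical_set_scope.
Local Open Scope ring_scope.

(* Strong convexity of the energy gives alpha/2 |u - uh|^2 <= E(uh) - E(u). Since
   uh is piecewise affine, |D uh|(Omega) is at most the integral of |grad uh|,
   so E(uh) exceeds Eh(uh) <= Eh(vh) by at most a multiple of |g||g - gh|; here
   |uh - gh| <= |gh| because 0 competes with uh, and |gh| <= |g|. From below,
   |D u|(Omega) >= - int u div qh (weak duality) gives E(u) >= D(qh), and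
   D(qh) >= Dh(qh) - |div qh||g - gh|. If |div qh| <= 2 alpha |gh| this suffices;
   otherwise Dh(qh) <= 0 <= E(u). Weak duality is proved by shifting qh along the
   Lipschitz charts into Omega and mollifying it. *)

(** * Norm, topology and measurability in 'rV[R]_d *)

(** Green's formula in [normal_trace0] admits C^1 test functions on the whole space, whatever their
    support. A mollifying kernel centred anywhere is thus allowed: integrating it against q over
    Omega alone gives a C^{1,1} field whose divergence is, at every point, the mollification of the
    weak divergence, without boundary term. What this field lacks is compact support in Omega. The
    shift provides it, and since the inward direction varies along the boundary, the shifted fields
    are glued by a partition of unity. Convex weights preserve the bound 1, and their derivatives
    cancel in the limit because the weights have a constant sum on Omega.

    For finite element functions the obstacle is that [grad] is a pointwise derivative, uncontrolled
    on the element boundaries; it is replaced off a null set by a measurable field. As Omega may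
    fail to be convex, integration by parts relies on a Lipschitz bound along segments contained in
    Omega.

    The case distinction on |div qh| is what frees the constant from qh: the error |div qh||g - gh|
    alone would make it depend on the chosen dual field. *)

Section rV_norm.
Variables (R : realType) (d : nat).
Implicit Types (x y : 'rV[R]_d) (c : R).

Lemma le_coord_norm x i : `|x 0 i| <= `|x|.
Proof.
rewrite [leRHS]/Num.norm /= mx_normrE.
by apply/bigmax_geP; right => /=; exists (0, i).
Qed.

Lemma rV_norm_le x c : 0 <= c -> (forall i, `|x 0 i| <= c) -> `|x| <= c.
Proof.
move=> c0 xc; rewrite [leLHS]/Num.norm /= mx_normrE.
by apply: bigmax_le => // -[i j] _ /=; rewrite (ord1 i).
Qed.

Lemma rV_norm_lt x c : 0 < c -> (forall i, `|x 0 i| < c) -> `|x| < c.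
Proof.
move=> c0 xc; rewrite [ltLHS]/Num.norm /= mx_normrE.
by apply/bigmax_ltP; split => // -[i j] _ /=; rewrite (ord1 i).
Qed.

Lemma norm_delta_mx (i : 'I_d) : `|delta_mx 0 i : 'rV[R]_d| <= 1.
Proof.
by apply: rV_norm_le => // j; rewrite mxE; case: (_ && _); rewrite ?normr1 ?normr0.
Qed.

Lemma norm_scale_delta (h : R) (i : 'I_d) : `|h *: delta_mx 0 i : 'rV[R]_d| <= `|h|.
Proof.
by rewrite normrZ; have := norm_delta_mx i; have := normr_ge0 h; nra.
Qed.

Lemma openP_norm (U : set 'rV[R]_d) :
  open U <-> forall x, U x -> exists2 r : R, 0 < r & forall y, `|x - y| < r -> U y.
Proof.
rewrite openE; split => [oU x /oU|oU x /oU [r r0 rU]].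
  move=> /nbhs_ballP[r /= r0 rU]; exists r => // y xy; apply: rU.
  by rewrite -ball_normE.
by apply/nbhs_ballP; exists r => // y; rewrite -ball_normE; exact: rU.
Qed.

Lemma continuous_at_rVP (f : 'rV[R]_d -> R) (x : 'rV[R]_d) :
  {for x, continuous f} <->
  forall e : R, 0 < e -> exists2 r : R, 0 < r &
    forall y, `|x - y| < r -> `|f x - f y| <= e.
Proof.
split=> [|fx].
  move=> /(@cvgrPdist_le R R 'rV[R]_d (nbhs x) _) fx e /fx /nbhs_ballP[r /= r0 xr].
  by exists r => // y xy; apply: xr; rewrite -ball_normE.
apply/(@cvgrPdist_le R R 'rV[R]_d (nbhs x) _) => e /fx[r r0 xr].
by apply/nbhs_ballP; exists r => // y; rewrite -ball_normE; exact: xr.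
Qed.

(** The measurable sets are generated by the coordinates, so an open set is exhausted by the
    countably many cubes with rational centre and radius 1/(n+1) that it contains. *)
Lemma open_measurable_rV (U : set 'rV[R]_d) : open U -> measurable U.
Proof.
move=> oU.
pose B (p : 'rV[rat]_d * nat) := [set x : 'rV[R]_d |
  forall i, `|x 0 i - ratr (p.1 0 i)| < p.2.+1%:R^-1].
have mB p : measurable (B p).
  have -> : B p = \bigcap_(i in [set: 'I_d])
      (fun x : 'rV[R]_d => coord_rV i x) @^-1`
        ball (ratr (p.1 0 i) : R) (p.2.+1%:R^-1).
    apply/seteqP; split => x /= xB i; first by move=> _; rewrite -ball_normE /ball_ /= distrC; exact: xB.
    by have := xB i Logic.I; rewrite -ball_normE /ball_ /= distrC.
  apply: fin_bigcap_measurable => // i _.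
  rewrite -[X in measurable X]setTI; apply: measurable_coord_rV => //.
  by apply: open_measurable; exact: ball_open.
have -> : U = \bigcup_(p in [set p | B p `<=` U]) B p.
  apply/seteqP; split => [x Ux|x [p pU /pU//]].
  have [r r0 rU] := (openP_norm U).1 oU _ Ux.
  have [n nr] : exists n : nat, n.+1%:R^-1 < r / 2.
    have r20 : 0 < r / 2 by rewrite divr_gt0.
    have [n _ /(_ n (leqnn _)) /=] := near_infty_natSinv_lt (PosNum r20).
    by exists n.
  have [e eE] : {e : R | e = n.+1%:R^-1} by exists n.+1%:R^-1.
  have e0 : 0 < e by rewrite eE invr_gt0.
  rewrite -eE in nr.
  have /choice[q qP] : forall i : 'I_d, exists q : rat, `|x 0 i - ratr q| < e.
    move=> i; have [|q] := @rat_in_itvoo R (x 0 i - e) (x 0 i + e); first lra.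
    by rewrite in_itv /= => /andP[q1 q2]; exists q; rewrite ltr_distl; apply/andP; split; lra.
  exists (\row_i q i, n) => /=; last by move=> i; rewrite mxE -eE; exact: qP.
  move=> y By; apply: rU; apply: (@le_lt_trans _ _ (e + e)); last lra.
  apply: rV_norm_le; first lra.
  move=> i; rewrite !mxE.
  have -> : x 0 i - y 0 i = (x 0 i - ratr (q i)) - (y 0 i - ratr (q i)) by ring.
  have := By i; rewrite /= mxE -eE => yq.
  apply: (le_trans (ler_normB _ _)).
  have := qP i; lra.
rewrite bigcup_mkcond.
apply: countable_bigcupT_measurable; first exact: countableP.
by move=> p; case: ifPn => // _; exact: mB.
Qed.

Lemma open_continuous_measurable_rV (f : 'rV[R]_d -> R) (D : set 'rV[R]_d) :
  open D -> (forall x, D x -> {for x, continuous f}) -> measurable_fun D f.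
Proof.
move=> oD cf mD; apply: (measurability _ (RGenOpens.measurableE R)) => //.
move=> _ [_ [a [b ->] <-]]; apply: open_measurable_rV.
rewrite openE => x [Dx fx]; apply: filterI; first exact: open_nbhs_nbhs.
by apply: cf => //; apply: open_nbhs_nbhs; split => //; exact: interval_open.
Qed.

Lemma continuous_measurable_rV (f : 'rV[R]_d -> R) (D : set 'rV[R]_d) :
  continuous f -> measurable_fun D f.
Proof.
move=> cf; apply: measurable_funTS; apply: open_continuous_measurable_rV.
  exact: openT.
by move=> x _; exact: cf.
Qed.

End rV_norm.

(** * Lebesgue measure in 'rV[R]_d *)

Section lebesgue_rV_theory.
Variable R : realType.
Local Notation mu := (lebesgue_rV R).
Local Open Scope ereal_scope.

Lemma cons_rV0 n (a : R) (v : 'rV[R]_n) : cons_rV (a, v) ord0 ord0 = a.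
Proof. by rewrite /cons_rV mxE; case: fintype.splitP => j //= _; rewrite mxE. Qed.

Lemma cons_rV_lift n (a : R) (v : 'rV[R]_n) i :
  cons_rV (a, v) ord0 (lift ord0 i) = v ord0 i.
Proof.
have -> : lift ord0 i = rshift 1 i :> 'I_(1 + n) by exact/val_inj.
exact: (row_mxEr (const_mx a : 'rV[R]_1) v).
Qed.

Lemma integral_lebesgue_rVS n (f : 'rV[R]_n.+1 -> \bar R) :
  measurable_fun setT f -> (forall x, 0 <= f x) ->
  \int[mu n.+1]_x f x =
  \int[lebesgue_measure]_a \int[mu n]_v f (cons_rV (a, v)).
Proof.
move=> mf f0.
rewrite (@ge0_integral_pushforward _ _ _ _ _ (@cons_rV R n) (@measurable_cons_rV R n)
  (product_measure1 lebesgue_measure (mu n)) setT f) //.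
rewrite preimage_setT fubini_tonelli1//; last by move=> x; exact: f0.
by apply: measurableT_comp => //; exact: measurable_cons_rV.
Qed.

Lemma measurable_cons_slice n (a : R) (f : 'rV[R]_n.+1 -> \bar R) :
  measurable_fun setT f -> measurable_fun setT (fun v => f (cons_rV (a, v))).
Proof.
move=> mf; apply: measurableT_comp => //.
apply: (@measurableT_comp _ _ _ _ _ _ (@cons_rV R n)); first exact: measurable_cons_rV.
exact: (measurable_pair1 a).
Qed.

Lemma measurable_fun_integral_slice n (f : 'rV[R]_n.+1 -> \bar R) :
  measurable_fun setT f -> (forall x, 0 <= f x) ->
  measurable_fun setT (fun a : measurableTypeR R => \int[mu n]_v f (cons_rV (a, v))).
Proof.
move=> mf f0.
apply: (measurable_fun_fubini_tonelli_F (f \o @cons_rV R n)) => [|x]; last exact: f0.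
by apply: measurableT_comp => //; exact: measurable_cons_rV.
Qed.

Lemma measurable_coord n (i : 'I_n) (g : R -> R) : measurable_fun setT g ->
  measurable_fun setT (fun x : 'rV[R]_n => g (x ord0 i)).
Proof. by move=> mg; apply: measurableT_comp => //; exact: measurable_coord_rV. Qed.

Lemma measurable_prod_coord n (g : 'I_n -> R -> R) :
  (forall i, measurable_fun setT (g i)) ->
  measurable_fun setT (fun x : 'rV[R]_n => (\prod_i g i (x ord0 i))%R).
Proof.
by move=> mg; apply: measurable_prod => i _; apply: measurable_coord.
Qed.

Lemma integral_prod_coord n (g : 'I_n -> R -> R) (c : 'I_n -> R) :
  (forall i, measurable_fun setT (g i)) -> (forall i a, (0 <= g i a)%R) ->
  (forall i, \int[lebesgue_measure]_a (g i a)%:E = (c i)%:E) ->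
  \int[mu n]_x (\prod_i g i (x ord0 i))%R%:E = (\prod_i c i)%R%:E.
Proof.
elim: n g c => [|n IH] g c mg g0 gc.
  rewrite [LHS](_ : _ = \int[mu 0]_x (cst 1%E) x); last first.
    by apply: eq_integral => x _; rewrite big_ord0.
  by rewrite integral_cst// big_ord0 mul1e /= diracE in_setT.
rewrite integral_lebesgue_rVS; last 2 first.
- by apply/measurable_EFinP; exact: measurable_prod_coord.
- by move=> x; rewrite lee_fin prodr_ge0.
under eq_integral => a _.
  under eq_integral => v _.
    rewrite big_ord_recl cons_rV0 EFinM.
    under eq_bigr do rewrite cons_rV_lift.
    over.
  rewrite ge0_integralZl_EFin//; last 2 first.
  - by move=> v _; rewrite lee_fin prodr_ge0.
  - apply/measurable_EFinP.
    exact: (@measurable_prod_coord _ (fun i => g (lift ord0 i))).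
  rewrite (IH (fun i => g (lift ord0 i)) (fun i => c (lift ord0 i)))//.
  over.
rewrite ge0_integralZr//.
- by rewrite gc big_ord_recl EFinM.
- exact: (measurableT_comp (@EFin_measurable R setT) (mg ord0)).
- by move=> x _; rewrite lee_fin.
rewrite -(IH (fun i => g (lift ord0 i)) (fun i => c (lift ord0 i)))//.
by apply: integral_ge0 => x _; rewrite lee_fin prodr_ge0.
Qed.

Lemma lebesgue_rV_bounded n (A : set 'rV[R]_n) (M : R) :
  measurable A -> (forall x, A x -> (`|x| <= M)%R) -> mu n A < +oo.
Proof.
move=> mA AM.
pose I : set R := `[(- M)%R, M]%classic.
have mI : measurable I by exact: measurable_itv.
apply: (@le_lt_trans _ _ (\int[mu n]_x (\prod_i (\1_I (x ord0 i) : R))%R%:E)).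
  rewrite -(setIT A) -integral_indic//.
  apply: ge0_le_integral => //.
  - exact/measurable_EFinP/measurable_indic.
  - apply/measurable_EFinP; apply: (@measurable_prod_coord _ (fun=> \1_I)) => i.
    exact: measurable_indic.
  move=> x _; rewrite lee_fin indicE.
  have [/set_mem/AM xM|_] := boolP (x \in A); last by rewrite prodr_ge0.
  rewrite (eq_bigr (fun=> 1%R)) ?big1//= => i _.
  rewrite indicE mem_set// /I /= in_itv /= -ler_norml.
  exact: (le_trans (le_coord_norm _ _)).
rewrite (@integral_prod_coord _ (fun _ => \1_I) (fun=> fine (lebesgue_measure I))) ?ltry//.
move=> i; rewrite integral_indic// setIT fineK//.
by rewrite lebesgue_measure_itv/=; case: ifP.
Qed.

(** The translated measure gives every half-open interval its length, which characterises Lebesgue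
    measure. *)
Lemma lebesgue_integral_translation (c : R) (f : R -> \bar R) :
  measurable_fun setT f -> (forall x, 0 <= f x) ->
  \int[lebesgue_measure]_a f (a + c)%R = \int[lebesgue_measure]_a f a.
Proof.
move=> mf f0.
have msh : measurable_fun setT ((fun a => a + c)%R : measurableTypeR R -> measurableTypeR R).
  exact: measurable_funD.
rewrite -[LHS]/(\int[lebesgue_measure]_(a in (fun a => a + c)%R @^-1` setT) (f \o (fun a => a + c)%R) a).
rewrite -(ge0_integral_pushforward msh)//.
apply: eq_measure_integral => A mA _.
apply/esym; apply: (@lebesgue_measure_unique _ (pushforward lebesgue_measure (fun a : measurableTypeR R => a + c : measurableTypeR R)%R)) => //.
move=> _ [[x y] _ <-]; rewrite /pushforward /=.
transitivity (lebesgue_measure (`]x - c, y - c]%classic%R : set (measurableTypeR R))); last first.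
  congr (lebesgue_measure _).
  by apply/seteqP; split => z /=; rewrite !in_itv /= => /andP[? ?]; apply/andP; split; lra.
rewrite !lebesgue_measure_itv/= !lte_fin ltrD2r; case: ifP => // _.
by rewrite -!EFinB; congr EFin; ring.
Qed.

Lemma measurable_translation n (v : 'rV[R]_n) : measurable_fun setT (fun x : 'rV[R]_n => (x + v)%R : 'rV[R]_n).
Proof.
apply: measurable_fun_rV => i.
rewrite (_ : _ \o _ = fun x : 'rV[R]_n => x ord0 i + v ord0 i)%R; last first.
  by apply/funext => x; rewrite /coord_rV /= mxE.
by apply: measurable_funD => //; exact: measurable_coord_rV.
Qed.

Lemma cons_rVE n (v : 'rV[R]_n.+1) : v = cons_rV (v ord0 ord0, \row_i v ord0 (lift ord0 i)).
Proof.
apply/rowP => i; case: (unliftP ord0 i) => [j ->|->].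
- by rewrite cons_rV_lift mxE.
- by rewrite cons_rV0.
Qed.

Lemma cons_rVD n (a b : R) (v w : 'rV[R]_n) :
  (cons_rV (a, v) + cons_rV (b, w))%R = cons_rV (a + b, v + w)%R.
Proof.
apply/rowP => i; rewrite mxE; case: (unliftP ord0 i) => [j ->|->].
- by rewrite !cons_rV_lift mxE.
- by rewrite !cons_rV0.
Qed.

Lemma ge0_integral_translation n (v : 'rV[R]_n) (f : 'rV[R]_n -> \bar R) :
  measurable_fun setT f -> (forall x, 0 <= f x) ->
  \int[mu n]_x f (x + v)%R = \int[mu n]_x f x.
Proof.
elim: n v f => [|n IH] v f mf f0.
  by apply: eq_integral => x _; rewrite (thinmx0 v) addr0.
have mfv : measurable_fun setT (fun x : 'rV[R]_n.+1 => f (x + v)%R).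
  exact: (measurableT_comp mf (measurable_translation v)).
rewrite !integral_lebesgue_rVS// {mfv}.
rewrite (cons_rVE v); set a := v _ _; set w := \row_i _.
transitivity (\int[lebesgue_measure]_b \int[mu n]_u f (cons_rV (b + a, u)%R)).
  apply: eq_integral => b _.
  rewrite -(IH w (fun u => f (cons_rV (b + a, u)%R)))//; last exact: measurable_cons_slice.
  by apply: eq_integral => u _; rewrite cons_rVD.
apply: (lebesgue_integral_translation a (f := fun b => \int[mu n]_u f (cons_rV (b, u)))).
- exact: measurable_fun_integral_slice.
- by move=> b; apply: integral_ge0.
Qed.

Lemma Rintegral_translation n (v : 'rV[R]_n) (f : 'rV[R]_n -> R) :
  measurable_fun setT f ->
  (\int[mu n]_x f (x + v) = \int[mu n]_x f x)%R.
Proof.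
move=> mf; rewrite /Rintegral integralE [in RHS]integralE.
have mfE : measurable_fun setT (EFin \o f) by exact/measurable_EFinP.
congr (fine (_ - _)).
- rewrite -[RHS](ge0_integral_translation v (measurable_funepos mfE)).
    by apply: eq_integral => x _; rewrite !funeposE.
  by move=> x; exact: funepos_ge0.
- rewrite -[RHS](ge0_integral_translation v (measurable_funeneg mfE)).
    by apply: eq_integral => x _; rewrite !funenegE.
  by move=> x; exact: funeneg_ge0.
Qed.

(** Induction on the dimension by slicing along the first coordinate. If another coefficient is
    nonzero, every slice is a null set; otherwise the slices are empty except over the single value
    - b / a_0. *)
Lemma affine_null n (a : 'I_n -> R) (b : R) : (exists i, a i != 0%R) ->
  mu n [set x : 'rV[R]_n | (b + \sum_i a i * x ord0 i = 0)%R] = 0.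
Proof.
have maff m (c : 'I_m -> R) e : measurable [set x : 'rV[R]_m | (e + \sum_i c i * x ord0 i = 0)%R].
  rewrite [X in measurable X](_ : _ = (fun x : 'rV[R]_m => (e + \sum_i c i * x ord0 i)%R) @^-1` [set 0%R])//.
  rewrite -[X in measurable X]setTI.
  have mf : measurable_fun setT (fun x : 'rV[R]_m => (e + \sum_i c i * x ord0 i)%R).
    apply: measurable_funD => //; apply: measurable_sum => i.
    by apply: measurable_funM => //; exact: measurable_coord_rV.
  by apply: mf => //; exact: measurable_set1.
elim: n a b => [a b [[]//]|n IH a b [i ai]].
set A := [set x | _]; have mA : measurable A by exact: maff.
rewrite -(setIT A) -integral_indic// integral_lebesgue_rVS//; last first.
  exact/measurable_EFinP/measurable_indic.
pose B r := [set x : 'rV[R]_n | (b + a ord0 * r + \sum_i a (lift ord0 i) * x ord0 i = 0)%R].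
have -> : (fun r => \int[mu n]_v (\1_A (cons_rV (r, v)))%:E) = fun r => mu n (B r).
  apply/funext => r; rewrite -(setIT (B r)) -integral_indic//; last exact: maff.
  apply: eq_integral => v _; congr EFin; rewrite !indicE; congr ((_ : bool)%:R)%R.
  have AB : A (cons_rV (r, v)) = B r v.
    rewrite /A /B /= big_ord_recl cons_rV0 addrA.
    congr ((_ + _)%R = _); apply: eq_bigr => j _; congr (_ * _)%R.
    exact: cons_rV_lift.
  by apply/idP/idP => /set_mem; [rewrite AB|rewrite -AB] => ?; exact: mem_set.
have [[j aj]|a0] := pselect (exists j, a (lift ord0 j) != 0%R).
  by rewrite integral0_eq// => r _; exact: (IH (fun j => a (lift ord0 j)) (b + a ord0 * r)%R (ex_intro _ j aj)).
have az j : a (lift ord0 j) = 0%R.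
  by apply/eqP/negPn/negP => aj; apply: a0; exists j.
have a00 : a ord0 != 0%R.
  by move: ai; case: (unliftP ord0 i) => [j ->|-> //]; rewrite az eqxx.
rewrite (_ : (fun r => mu n (B r)) = (fun r => mu n (B r)) \_ [set (- b / a ord0)%R]).
  by rewrite -integral_mkcond integral_set1.
apply/funext => r; rewrite patchE; case: ifPn => // /negP rb.
rewrite (_ : B r = set0) ?measure0//; apply/seteqP; split => // x; rewrite /B /=.
rewrite big1 => [|j _]; last by rewrite az mul0r.
rewrite addr0 => br; apply: rb; rewrite inE /=.
by apply: (mulfI a00); rewrite mulrCA divff// mulr1; lra.
Qed.

End lebesgue_rV_theory.

(** * Integrable and square-integrable functions *)

Section real_integrable.
Context {d0 : measure_display} {T : measurableType d0} {R : realType}.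
Variable m : {measure set T -> \bar R}.
Variable D : set T.
Hypothesis mD : measurable D.
Implicit Types (f g : T -> R) (c C : R).
Local Notation itg f := (m.-integrable D (fun x => (f x)%:E)).

Lemma itg_measurable f : itg f -> measurable_fun D f.
Proof. by move=> /integrableP[/measurable_EFinP]. Qed.

Lemma eq_itg f g : (forall x, D x -> f x = g x) -> itg f -> itg g.
Proof.
move=> fg; apply: eq_integrable => // x /set_mem Dx /=; by rewrite fg.
Qed.

Lemma itgD f g : itg f -> itg g -> itg (fun x => f x + g x).
Proof. by move=> fi gi; exact: (integrableD mD fi gi). Qed.

Lemma itgB f g : itg f -> itg g -> itg (fun x => f x - g x).
Proof. by move=> fi gi; exact: (integrableB mD fi gi). Qed.

Lemma itgZ c f : itg f -> itg (fun x => c * f x).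
Proof. by move=> fi; exact: (integrableZl mD c fi). Qed.

Lemma itgN f : itg f -> itg (fun x => - f x).
Proof. by move=> fi; exact: (integrableN fi). Qed.

Lemma itg_sum (I : Type) (s : seq I) (P : pred I) (h : I -> T -> R) :
  (forall i, P i -> itg (h i)) -> itg (fun x => \sum_(i <- s | P i) h i x).
Proof.
move=> hi.
rewrite [X in _.-integrable _ X](_ : _ =
    fun x => (\sum_(i <- s | P i) (EFin \o h i) x)%E).
  exact: integrable_sum.
by apply/funext => x /=; rewrite sumEFin.
Qed.

Lemma itg_le f g : measurable_fun D f -> itg g ->
  (forall x, D x -> `|f x| <= g x) -> itg f.
Proof.
move=> mf gi fg; apply: (le_integrable mD _ _ gi).
  exact/measurable_EFinP.
by move=> x Dx /=; rewrite lee_fin (le_trans (fg _ Dx))// ler_norm.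
Qed.

Lemma itgM_bounded f g C : itg f -> measurable_fun D g ->
  (forall x, D x -> `|g x| <= C) -> itg (fun x => f x * g x).
Proof.
move=> fi mg gC; apply: (@itg_le _ (fun x => C * `|f x|)).
- by apply: measurable_funM => //; exact: itg_measurable.
- by apply: itgZ; exact: integrable_norm.
- by move=> x Dx; rewrite normrM mulrC ler_wpM2r// gC.
Qed.

Lemma itgM_boundedl f g C : itg f -> measurable_fun D g ->
  (forall x, D x -> `|g x| <= C) -> itg (fun x => g x * f x).
Proof.
move=> fi mg gC; apply: eq_itg (itgM_bounded fi mg gC) => x _.
by rewrite mulrC.
Qed.

Lemma itg_bounded f C : (m D < +oo)%E -> measurable_fun D f ->
  (forall x, D x -> `|f x| <= C) -> itg f.
Proof.
move=> Doo mf fC; apply: measurable_bounded_integrable => //.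
exists C; split; first exact: num_real.
by move=> M CM x Dx; exact: le_trans (fC _ Dx) (ltW CM).
Qed.

Lemma Rintegral_sum (I : Type) (s : seq I) (P : pred I) (h : I -> T -> R) :
  (forall i, P i -> itg (h i)) ->
  \int[m]_(x in D) (\sum_(i <- s | P i) h i x) =
  \sum_(i <- s | P i) \int[m]_(x in D) h i x.
Proof.
move=> hi; elim: s => [|i s IH].
  rewrite big_nil (_ : (fun x => _) = cst 0); last by apply/funext => x; rewrite big_nil.
  by rewrite Rintegral_cst// mul0r.
rewrite big_cons (_ : (fun x => _) = (fun x =>
    (if P i then h i x else 0) + \sum_(i <- s | P i) h i x)); last first.
  by apply/funext => x; rewrite big_cons; case: ifP => // _; rewrite add0r.
case: ifPn => Pi; last by under eq_Rintegral do rewrite add0r; exact: IH.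
rewrite RintegralD//; [by rewrite IH|exact: hi|exact: itg_sum].
Qed.

Lemma RintegralN f : itg f ->
  \int[m]_(x in D) (- f x) = - \int[m]_(x in D) f x.
Proof.
move=> fi; rewrite -mulN1r -RintegralZl//.
by apply: eq_Rintegral => x _; rewrite mulN1r.
Qed.

Lemma Rintegral_dominated_cvg (f_ : nat -> T -> R) f g :
  (forall n, measurable_fun D (f_ n)) -> measurable_fun D f ->
  {ae m, forall x, D x -> f_ ^~ x @ \oo --> f x} -> itg g ->
  (forall n x, D x -> `|f_ n x| <= g x) ->
  (fun n => \int[m]_(x in D) f_ n x) @ \oo --> \int[m]_(x in D) f x.
Proof.
move=> mf_ mf f_f gi fg.
have [||||| fi _ cv] := @dominated_convergence _ _ _ m D mD
  (fun n => EFin \o f_ n) (EFin \o f) (EFin \o g).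
- by move=> n; apply/measurable_EFinP.
- exact/measurable_EFinP.
- apply: filterS f_f => x f_f Dx; apply: cvg_EFin; last exact: f_f.
  by near=> n.
- exact: gi.
- by apply: aeW => x n Dx /=; rewrite lee_fin fg.
rewrite /Rintegral; apply: fine_cvg; rewrite fineK//.
exact: integrable_fin_num.
Unshelve. all: by end_near. Qed.

End real_integrable.

(** * L2(Omega) as an inner product space *)

Section L2_theory.
Variables (R : realType) (d : nat) (Omega : set 'rV[R]_d).
Local Notation mu := (lebesgue_rV R d).
Hypothesis mO : measurable Omega.
Hypothesis Ooo : (mu Omega < +oo)%E.
Implicit Types (f g u v : 'rV[R]_d -> R) (c C : R).
Local Notation itg f := (mu.-integrable Omega (fun x => (f x)%:E)).
Local Notation int f := (\int[mu]_(x in Omega) f x).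
Local Notation L2 := (L2 Omega).
Local Notation norm := (L2norm Omega).

Lemma eq_L2 f g : (forall x, Omega x -> f x = g x) -> L2 f -> L2 g.
Proof.
move=> fg [mf fi]; split; first by apply: eq_measurable_fun mf => x /set_mem; exact: fg.
by apply: (eq_itg mO _ fi) => x Ox; rewrite fg.
Qed.

Lemma L2_mul_itg f g : L2 f -> L2 g -> itg (fun x => f x * g x).
Proof.
move=> [mf fi] [mg gi]; apply: (@itg_le _ _ _ mu _ mO _ (fun x => f x ^+ 2 + g x ^+ 2)).
- exact: measurable_funM.
- exact: itgD.
- by move=> x _; rewrite ler_norml; apply/andP; split; nra.
Qed.

Lemma L2_sq_itg f : L2 f -> itg (fun x => f x ^+ 2).
Proof. by case. Qed.

Lemma L2_bounded f C : measurable_fun Omega f ->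
  (forall x, Omega x -> `|f x| <= C) -> L2 f.
Proof.
move=> mf fC; split => //; apply: (@itg_bounded _ _ _ mu _ mO _ (C ^+ 2)) => //.
  exact: measurable_funX.
move=> x Ox; rewrite normrX lerXn2r ?nnegrE ?fC//.
by rewrite (le_trans _ (fC _ Ox)).
Qed.

Lemma L2M_bounded f (b : 'rV[R]_d -> R) C : L2 f -> measurable_fun Omega b ->
  (forall x, Omega x -> `|b x| <= C) -> L2 (fun x => f x * b x).
Proof.
move=> [mf fi] mb bC; split; first exact: measurable_funM.
apply: (@eq_itg _ _ _ mu _ mO (fun x => f x ^+ 2 * b x ^+ 2)).
  by move=> x _; rewrite exprMn.
apply: (@itgM_bounded _ _ _ mu _ mO _ _ (C ^+ 2)) => //; first exact: measurable_funX.
move=> x Ox; rewrite normrX lerXn2r ?nnegrE ?bC//.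
by rewrite (le_trans _ (bC _ Ox)).
Qed.

Lemma L2_cst c : L2 (fun=> c).
Proof. by apply: (@L2_bounded _ `|c|) => // *; exact: measurable_cst. Qed.

Lemma L2_itg f : L2 f -> itg f.
Proof.
move=> fL; apply: (eq_itg mO _ (L2_mul_itg fL (L2_cst 1))) => x _.
by rewrite mulr1.
Qed.

Lemma L2Z c f : L2 f -> L2 (fun x => c * f x).
Proof.
move=> fL; apply: (eq_L2 _ (@L2M_bounded f (fun=> c) `|c| fL _ _)) => //.
by move=> x _; rewrite mulrC.
Qed.

Lemma L2D f g : L2 f -> L2 g -> L2 (fun x => f x + g x).
Proof.
move=> fL gL; split; first exact: measurable_funD fL.1 gL.1.
apply: (@eq_itg _ _ _ mu _ mO (fun x => (f x ^+ 2 + 2 * (f x * g x)) + g x ^+ 2)).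
  by move=> x _; ring.
apply: itgD => //; [apply: itgD => //|exact: L2_sq_itg].
- exact: L2_sq_itg.
- by apply: itgZ => //; exact: L2_mul_itg.
Qed.

Lemma L2N f : L2 f -> L2 (fun x => - f x).
Proof. by move=> /(L2Z (-1)); apply: eq_L2 => x _; rewrite mulN1r. Qed.

Lemma L2B f g : L2 f -> L2 g -> L2 (fun x => f x - g x).
Proof. by move=> fL /L2N; exact: L2D. Qed.

Lemma L2_sum (I : Type) (s : seq I) (P : pred I) (h : I -> 'rV[R]_d -> R) :
  (forall i, P i -> L2 (h i)) -> L2 (fun x => \sum_(i <- s | P i) h i x).
Proof.
move=> hL; elim: s => [|i s IH].
  by apply: (eq_L2 _ (L2_cst 0)) => x _; rewrite big_nil.
have [Pi|Pi] := boolP (P i).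
  by apply: (eq_L2 _ (L2D (hL i Pi) IH)) => x _; rewrite big_cons Pi.
by apply: (eq_L2 _ IH) => x _; rewrite big_cons (negbTE Pi).
Qed.

Lemma L2norm_ge0 f : 0 <= norm f. Proof. exact: sqrtr_ge0. Qed.

Lemma L2norm_sqr f : norm f ^+ 2 = int (fun x => f x ^+ 2).
Proof. by rewrite sqr_sqrtr//; apply: Rintegral_ge0 => x _; exact: sqr_ge0. Qed.

Lemma eq_L2norm f g : (forall x, Omega x -> f x = g x) -> norm f = norm g.
Proof.
move=> fg; congr Num.sqrt; apply: eq_Rintegral => x /set_mem Ox.
by rewrite fg.
Qed.

Lemma Rintegral_sqrDZ f g (c : R) : L2 f -> L2 g ->
  int (fun x => (f x + c * g x) ^+ 2) =
  norm f ^+ 2 + 2 * c * int (fun x => f x * g x) + c ^+ 2 * norm g ^+ 2.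
Proof.
move=> fL gL.
have fi := L2_sq_itg fL; have gi := L2_sq_itg gL; have fgi := L2_mul_itg fL gL.
transitivity (int (fun x => (f x ^+ 2 + 2 * c * (f x * g x)) + c ^+ 2 * g x ^+ 2)).
  by apply: eq_Rintegral => x _; ring.
rewrite !RintegralD//; last 3 first.
- exact: itgZ.
- by apply: itgD => //; exact: itgZ.
- exact: itgZ.
by rewrite !RintegralZl// !L2norm_sqr.
Qed.

Lemma L2_cauchy_schwarz f g : L2 f -> L2 g ->
  `|int (fun x => f x * g x)| <= norm f * norm g.
Proof.
move=> fL gL.
have H c : 0 <= norm f ^+ 2 + 2 * c * int (fun x => f x * g x) + c ^+ 2 * norm g ^+ 2.
  by rewrite -Rintegral_sqrDZ//; apply: Rintegral_ge0 => x _; exact: sqr_ge0.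
set I := Rintegral _ _ _ in H *; have := L2norm_ge0 f; have := L2norm_ge0 g.
move: (norm f) (norm g) H => a b H b0 a0.
have [b00|b00] := eqVneq b 0.
  suff -> : I = 0 by rewrite normr0 mulr_ge0.
  apply/eqP/negPn/negP => I0.
  (* For b = 0 the quadratic degenerates to a^2 + 2 c I, and this c gives it the value -1. *)
  have := H (- (a ^+ 2 + 1) / (2 * I)).
  rewrite b00 (_ : 2 * _ * I = - (a ^+ 2 + 1)); last by field; rewrite I0.
  nra.
have {b0 b00}b0 : 0 < b by rewrite lt_def b00.
(* The minimizer of the quadratic. *)
have := H (- I / b ^+ 2).
have -> : a ^+ 2 + 2 * (- I / b ^+ 2) * I + (- I / b ^+ 2) ^+ 2 * b ^+ 2 =
  a ^+ 2 - I ^+ 2 / b ^+ 2 by field; rewrite gt_eqF.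
rewrite subr_ge0 ler_pdivrMr ?exprn_gt0// -exprMn => {}H.
have ab0 : 0 <= a * b by rewrite mulr_ge0// ltW.
rewrite -(@ler_pXn2r _ 2)// ?nnegrE//.
by rewrite real_normK ?num_real.
Qed.

Lemma L2normZ c f : L2 f -> norm (fun x => c * f x) = `|c| * norm f.
Proof.
move=> fL; apply/eqP; rewrite -(@eqrXn2 _ 2)// ?mulr_ge0 ?L2norm_ge0//.
rewrite exprMn !L2norm_sqr real_normK ?num_real// -RintegralZl//; last exact: L2_sq_itg.
by apply/eqP; apply: eq_Rintegral => x _; rewrite exprMn.
Qed.

Lemma L2normN f : norm (fun x => - f x) = norm f.
Proof. by congr Num.sqrt; apply: eq_Rintegral => x _; rewrite sqrrN. Qed.

Lemma L2norm_triangle f g : L2 f -> L2 g ->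
  norm (fun x => f x + g x) <= norm f + norm g.
Proof.
move=> fL gL; rewrite -(@ler_pXn2r _ 2)// ?nnegrE ?addr_ge0 ?L2norm_ge0//.
have := Rintegral_sqrDZ 1 fL gL; under eq_Rintegral do rewrite mul1r.
rewrite -[X in X = _ -> _](L2norm_sqr (fun x => f x + g x)) => ->.
have := L2_cauchy_schwarz fL gL; rewrite ler_norml => /andP[_].
by move: (norm f) (norm g) => a b; set I := Rintegral _ _ _; nra.
Qed.

End L2_theory.

(** * C^{1,1} functions and mollifiers *)

Section C11.
Variables (R : realType) (d : nat).
Local Notation V := 'rV[R]_d.
Implicit Types (f g : V -> R) (F G : 'I_d -> V -> R) (C K : R).

(* C^{1,1} functions, F being the gradient: with the quadratic remainder as a
   definition, sums, products and mollifications are elementary estimates. *)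
Definition C11w C f F : Prop :=
  [/\ 0 <= C, forall x, `|f x| <= C, forall x y, `|f x - f y| <= C * `|x - y|
    & forall i x h, `|f (x + h *: delta_mx 0 i) - f x - h * F i x| <= C * h ^+ 2].

(** h F is an increment of f minus its remainder, hence |F| <= C + C h for every h > 0; h is chosen
    so that C h <= e. *)
Lemma C11w_deriv_bound C f F i x : C11w C f F -> `|F i x| <= C.
Proof.
move=> [C0 f1 f2 f3]; apply/ler_addgt0Pr => e e0.
pose h : R := e / (C + 1).
have h0 : 0 < h by rewrite divr_gt0// ltr_wpDl.
have Ch : C * h <= e.
  by rewrite /h mulrA ler_pdivrMr ?ltr_wpDl//; nra.
rewrite -(ler_pM2l h0) -[X in X * `|_|]gtr0_norm// -normrM.
have := f3 i x h; have := f2 (x + h *: delta_mx 0 i) x.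
rewrite addrAC subrr add0r => H1 H2.
have H3 : C * `|h *: delta_mx 0 i : V| <= C * h.
  by rewrite ler_wpM2l// (le_trans (norm_scale_delta _ _))// gtr0_norm.
have -> : h * F i x = (f (x + h *: delta_mx 0 i) - f x) -
  (f (x + h *: delta_mx 0 i) - f x - h * F i x) by ring.
rewrite (le_trans (ler_normB _ _))//.
have : C * h ^+ 2 <= h * e by have := ler_wpM2l (ltW h0) Ch; rewrite expr2; nra.
nra.
Qed.

Lemma C11w_derive C f F i x : C11w C f F ->
  (fun h => h^-1 *: (f (h *: delta_mx 0 i + x) - f x)) @ 0^' --> F i x.
Proof.
move=> [C0 f1 f2 f3]; apply/cvgrPdist_le => e e0.
near=> h.
have h0 : h != 0 by near: h; exact: nbhs_dnbhs_neq.
have hn : `|h| <= e / (C + 1).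
  near: h; apply: dnbhs0_le; by rewrite divr_gt0// ltr_wpDl.
rewrite distrC (addrC (h *: _)).
set y := f _ - f x; have -> : h^-1 *: y = h^-1 * y by [].
rewrite -(ler_pM2l (_ : 0 < `|h|)) ?normr_gt0//.
rewrite -normrM mulrBr mulrA mulfV// mul1r.
apply: (le_trans (f3 i x h)).
rewrite -real_normK ?num_real// expr2 mulrCA ler_wpM2l//.
move: hn; rewrite ler_pdivlMr ?ltr_wpDl// => hn.
have := normr_ge0 h; nra.
Unshelve. all: by end_near. Qed.

Lemma C11w_derivable C f F i x : C11w C f F -> derivable f x (delta_mx 0 i).
Proof.
by move=> fF; apply/cvg_ex; exists (F i x); exact: C11w_derive fF.
Qed.

Lemma C11w_pderiv C f F i x : C11w C f F -> pderiv i f x = F i x.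
Proof. by move=> fF; apply/cvg_lim => //; exact: C11w_derive fF. Qed.

Definition C11 f : Prop := exists C, C11w C f (fun i => pderiv i f).

Lemma C11I C f F : C11w C f F -> C11 f.
Proof.
move=> fF; exists C; have [C0 f1 f2 f3] := fF; split => // i x h.
by rewrite (C11w_pderiv i x fF).
Qed.

Lemma lipschitz_continuous_rV C f :
  (forall x y, `|f x - f y| <= C * `|x - y|) -> continuous f.
Proof.
move=> fC x; apply/continuous_at_rVP => e e0.
exists (e / (`|C| + 1)); first by rewrite divr_gt0// ltr_wpDl.
move=> y; rewrite ltr_pdivlMr ?ltr_wpDl// => xy.
apply: (le_trans (fC _ _)).
have := normr_ge0 (x - y); have := ler_norm C; nra.
Qed.

Lemma C11_continuous f : C11 f -> continuous f.
Proof. by move=> [C [_ _ f2 _]]; exact: lipschitz_continuous_rV f2. Qed.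

(* The remainder estimate alone makes the derivative a uniform limit of
   continuous difference quotients. *)
Lemma C11_pderiv_continuous f i : C11 f -> continuous (pderiv i f).
Proof.
move=> [C [C0 f1 f2 f3]] x; apply/continuous_at_rVP => e e0.
pose h : R := e / (4 * (C + 1)).
have C1 : 0 < C + 1 by rewrite ltr_wpDl.
have h0 : 0 < h by rewrite divr_gt0// mulr_gt0.
have Ch : C * h <= e / 4.
  rewrite /h mulrA ler_pdivrMr ?mulr_gt0//.
  have -> : e / 4 * (4 * (C + 1)) = e * (C + 1) by field.
  nra.
exists (e * h / (4 * (C + 1))); first by apply: divr_gt0; apply: mulr_gt0.
move=> y /ltW xy.
have Cxy : C * `|x - y| <= e * h / 4.
  move: xy; rewrite ler_pdivlMr ?mulr_gt0// => xy.
  have := normr_ge0 (x - y); nra.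
rewrite -(ler_pM2l h0) -[X in X * `|_|]gtr0_norm// -normrM.
set D := delta_mx 0 i : V.
have := f3 i x h; have := f3 i y h; have := f2 (x + h *: D) (y + h *: D).
have := f2 x y; rewrite opprD addrACA subrr addr0.
rewrite -/D.
have -> : h * (pderiv i f x - pderiv i f y) =
  (f y + h * 0 - f x + (f (x + h *: D) - f (y + h *: D))) -
  (f (x + h *: D) - f x - h * pderiv i f x) +
  (f (y + h *: D) - f y - h * pderiv i f y) by ring.
move=> H1 H2 H3 H4.
have hC : C * h ^+ 2 <= h * e / 4 by rewrite expr2; nra.
rewrite mulr0 addr0.
apply: (le_trans (ler_normD _ _)); rewrite (le_trans (lerD (ler_normB _ _) (lexx _)))//.
rewrite (le_trans (lerD (lerD (ler_normD _ _) (lexx _)) (lexx _)))//.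
rewrite distrC in H1.
rewrite distrC (_ : `|f x - f y| = `|f y - f x|) ?(distrC (f x))//.
lra.
Qed.

Lemma C11_Ck1 f : C11 f -> Ck 1 f.
Proof.
move=> fC; split; first exact: C11_continuous.
move=> i; split; last by split => //; exact: C11_pderiv_continuous.
by move=> x; case: fC => C fC; exact: C11w_derivable fC.
Qed.

Lemma C11_cst (c : R) : C11 (fun=> c).
Proof.
apply: (@C11I `|c| _ (fun _ _ => 0)); split => //.
- by move=> x y; rewrite subrr normr0 mulr_ge0.
- by move=> i x h; rewrite subrr mulr0 subrr normr0 mulr_ge0// sqr_ge0.
Qed.

Lemma C11wD C K f g F G : C11w C f F -> C11w K g G ->
  C11w (C + K) (fun x => f x + g x) (fun i x => F i x + G i x).
Proof.
move=> [C0 f1 f2 f3] [K0 g1 g2 g3]; split; first exact: addr_ge0.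
- by move=> x; rewrite (le_trans (ler_normD _ _))// lerD.
- move=> x y; rewrite opprD addrACA (le_trans (ler_normD _ _))// mulrDl lerD//.
- move=> i x h; rewrite mulrDl.
  have := lerD (f3 i x h) (g3 i x h); apply: le_trans.
  apply: le_trans (ler_normD _ _); rewrite le_eqVlt; apply/orP; left; apply/eqP.
  by congr Num.norm; ring.
Qed.

Lemma C11wM C K f g F G : C11w C f F -> C11w K g G ->
  C11w (C * K * 3) (fun x => f x * g x) (fun i x => F i x * g x + f x * G i x).
Proof.
move=> fF gG; have FC i x := C11w_deriv_bound i x fF.
case: fF gG => [C0 f1 f2 f3] [K0 g1 g2 g3].
have CK0 : 0 <= C * K by exact: mulr_ge0.
split; first exact: mulr_ge0.
- move=> x; rewrite normrM (le_trans (ler_pM _ _ (f1 x) (g1 x)))//; lra.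
- move=> x y.
  have -> : f x * g x - f y * g y = (f x - f y) * g x + f y * (g x - g y) by ring.
  rewrite (le_trans (ler_normD _ _))// !normrM.
  have H1 := ler_pM (normr_ge0 _) (normr_ge0 _) (f2 x y) (g1 x).
  have H2 := ler_pM (normr_ge0 _) (normr_ge0 _) (f1 y) (g2 x y).
  have : 0 <= C * K * `|x - y| by rewrite mulr_ge0.
  lra.
- move=> i x h; set D := delta_mx 0 i : V.
  (* Three terms, each at most C K h^2: this is the factor 3. *)
  have -> : f (x + h *: D) * g (x + h *: D) - f x * g x -
      h * (F i x * g x + f x * G i x) =
    (f (x + h *: D) - f x - h * F i x) * g (x + h *: D) +
    (h * F i x) * (g (x + h *: D) - g x) +
    f x * (g (x + h *: D) - g x - h * G i x) by ring.
  have g2h : `|g (x + h *: D) - g x| <= K * `|h|.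
    rewrite (le_trans (g2 _ _))// addrAC subrr add0r ler_wpM2l//.
    exact: norm_scale_delta.
  have H1 := ler_pM (normr_ge0 _) (normr_ge0 _) (f3 i x h) (g1 (x + h *: D)).
  have H2 := ler_pM (normr_ge0 _) (normr_ge0 _) (f1 x) (g3 i x h).
  have H3 := ler_pM (normr_ge0 _) (normr_ge0 _) (FC i x) g2h.
  have H4 := ler_wpM2l (normr_ge0 h) H3.
  rewrite (le_trans (ler_normD _ _))// (le_trans (lerD (ler_normD _ _) (lexx _)))//.
  rewrite !normrM; move: H1 H2; rewrite -/D.
  rewrite -(real_normK (num_real h)).
  lra.
Qed.

Lemma C11D f g : C11 f -> C11 g -> C11 (fun x => f x + g x).
Proof. by move=> [C fC] [K gK]; exact: C11I (C11wD fC gK). Qed.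

Lemma C11M f g : C11 f -> C11 g -> C11 (fun x => f x * g x).
Proof. by move=> [C fC] [K gK]; exact: C11I (C11wM fC gK). Qed.

Lemma pderiv_C11D f g i x : C11 f -> C11 g ->
  pderiv i (fun x => f x + g x) x = pderiv i f x + pderiv i g x.
Proof. by move=> [C fC] [K gK]; exact: (C11w_pderiv i x (C11wD fC gK)). Qed.

Lemma pderiv_C11M f g i x : C11 f -> C11 g ->
  pderiv i (fun x => f x * g x) x = pderiv i f x * g x + f x * pderiv i g x.
Proof. by move=> [C fC] [K gK]; exact: (C11w_pderiv i x (C11wM fC gK)). Qed.

Lemma pderiv_cst (c : R) (i : 'I_d) x : pderiv i (fun=> c) x = 0.
Proof. by rewrite /pderiv derive_cst. Qed.

Lemma C11_sum (I : Type) (s : seq I) (h : I -> V -> R) :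
  (forall k, C11 (h k)) -> C11 (fun x => \sum_(k <- s) h k x).
Proof.
move=> hC; elim: s => [|k s IH].
  rewrite (_ : (fun x => _) = fun=> 0); first exact: C11_cst.
  by apply/funext => x; rewrite big_nil.
rewrite (_ : (fun x => _) = fun x => h k x + \sum_(k <- s) h k x).
  exact: C11D.
by apply/funext => x; rewrite big_cons.
Qed.

Lemma pderiv_C11_sum (I : Type) (s : seq I) (h : I -> V -> R) i x :
  (forall k, C11 (h k)) ->
  pderiv i (fun x => \sum_(k <- s) h k x) x = \sum_(k <- s) pderiv i (h k) x.
Proof.
move=> hC; elim: s => [|k s IH].
  rewrite (_ : (fun x => _) = fun=> 0) ?big_nil ?pderiv_cst//.
  by apply/funext => y; rewrite big_nil.
rewrite (_ : (fun x => _) = fun x => h k x + \sum_(k <- s) h k x).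
  by rewrite pderiv_C11D// ?IH ?big_cons//; exact: C11_sum.
by apply/funext => y; rewrite big_cons.
Qed.

Lemma C11_prod (I : Type) (s : seq I) (h : I -> V -> R) :
  (forall k, C11 (h k)) -> C11 (fun x => \prod_(k <- s) h k x).
Proof.
move=> hC; elim: s => [|k s IH].
  rewrite (_ : (fun x => _) = fun=> 1); first exact: C11_cst.
  by apply/funext => x; rewrite big_nil.
rewrite (_ : (fun x => _) = fun x => h k x * \prod_(k <- s) h k x).
  exact: C11M.
by apply/funext => x; rewrite big_cons.
Qed.

Lemma C11N f : C11 f -> C11 (fun x => - f x).
Proof.
move=> fC; rewrite (_ : (fun x => _) = fun x => (-1) * f x).
  by apply: C11M => //; exact: C11_cst.
by apply/funext => x; rewrite mulN1r.
Qed.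

Lemma C11w_shift C f F b : C11w C f F ->
  C11w C (fun x => f (x - b)) (fun i x => F i (x - b)).
Proof.
move=> [C0 f1 f2 f3]; split => //.
- by move=> x y; rewrite (le_trans (f2 _ _))// opprB addrA subrK.
- by move=> i x h; rewrite (addrAC x); exact: f3.
Qed.

(** Serves to see the kernel of a mollification as a function of the integration variable. *)
Lemma C11w_refl C f F b : C11w C f F ->
  C11w C (fun x => f (b - x)) (fun i x => - F i (b - x)).
Proof.
move=> [C0 f1 f2 f3]; split => //.
- by move=> x y; rewrite (le_trans (f2 _ _))// opprB addrC addrA subrK (distrC x).
- move=> i x h; rewrite mulrN -mulNr opprD addrA -scaleNr.
  by rewrite -[h ^+ 2]sqrrN; exact: f3.

Qed.

End C11.

(** * One-dimensional bump and step functions *)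

Section kernels.
Variable R : realType.
Implicit Types (s t a b c h : R) (C : R).

Definition clip s : R := if s <= -1 then -1 else if 1 <= s then 1 else s.

Lemma clipP s : [\/ (s <= -1) /\ clip s = -1, 1 <= s /\ clip s = 1 |
  -1 < s < 1 /\ clip s = s].
Proof.
rewrite /clip; case: (leP s (-1)) => s1; first by constructor 1.
by case: (leP 1 s) => s2; [constructor 2|constructor 3; split => //; lra].
Qed.

Lemma clip_itv s : -1 <= clip s <= 1.
Proof. by case: (clipP s) => -[? ->]; lra. Qed.

Lemma clip_id s : `|s| <= 1 -> clip s = s.
Proof.
by rewrite ler_norml => /andP[s1 s2]; case: (clipP s) => -[? ->]; lra.
Qed.

Lemma clip_ge1 s : 1 <= s -> clip s = 1.
Proof. by move=> ?; case: (clipP s) => -[? ->]; lra. Qed.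

Lemma clip_leN1 s : s <= -1 -> clip s = -1.
Proof. by rewrite /clip => ->. Qed.

Lemma clip_lip s t : `|clip s - clip t| <= `|s - t|.
Proof.
have H : forall a b c, (a <= c /\ - a <= c) -> `|a| <= c.
  by move=> a _ c [? ?]; rewrite ler_norml; lra.
apply: (H _ 0); have h1 := ler_norm (s - t); have h2 := ler_norm (- (s - t)).
rewrite normrN in h2.
by case: (clipP s) => -[s1 ->]; case: (clipP t) => -[t1 ->]; lra.
Qed.

Definition c11 C (g g' : R -> R) : Prop :=
  [/\ 0 <= C, forall s, `|g s| <= C, forall s t, `|g s - g t| <= C * `|s - t|
    & forall s h, `|g (s + h) - g s - h * g' s| <= C * h ^+ 2].

(* [P \o clip] is C^{1,1} as soon as the derivative of P vanishes at -1 and 1. *)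
Lemma c11_clip C (P P' Q : R -> R) : 0 <= C ->
  (forall a, -1 <= a <= 1 -> `|P a| <= C) ->
  (forall a, -1 <= a <= 1 -> `|Q a| <= C) ->
  (forall a, P' a = (1 - a ^+ 2) * Q a) ->
  (forall a b, -1 <= a <= 1 -> -1 <= b <= 1 ->
     `|P b - P a - P' a * (b - a)| <= C * (b - a) ^+ 2) ->
  c11 (3 * C) (P \o clip) (P' \o clip).
Proof.
move=> C0 PC QC P'Q PP'.
have P'C a : -1 <= a <= 1 -> `|P' a| <= C.
  move=> a1; rewrite P'Q normrM; have := QC _ a1.
  have : `|1 - a ^+ 2| <= 1 by rewrite ler_norml; nra.
  have := normr_ge0 (Q a); have := normr_ge0 (1 - a ^+ 2); nra.
split; first lra.
- by move=> s /=; rewrite (le_trans (PC _ (clip_itv s)))//; lra.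
- move=> s t /=; set b := clip s; set a := clip t.
  have := PP' _ _ (clip_itv t) (clip_itv s); rewrite -/a -/b => H1.
  have H2 := P'C _ (clip_itv t).
  have H3 : `|P b - P a| <= C * (b - a) ^+ 2 + C * `|b - a|.
    have -> : P b - P a = (P b - P a - P' a * (b - a)) + P' a * (b - a) by ring.
    by rewrite (le_trans (ler_normD _ _))// lerD// normrM ler_wpM2r.
  have H4 : (b - a) ^+ 2 <= 2 * `|b - a|.
    rewrite -(real_normK (num_real (b - a))) expr2 ler_wpM2r//.
    have := clip_itv t; have := clip_itv s; rewrite -/a -/b ler_norml; lra.
  have := clip_lip s t; rewrite -/a -/b => H5.
  have := ler_wpM2l C0 H4; have := ler_wpM2l C0 H5; lra.
- move=> s h /=; set b := clip (s + h); set a := clip s.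
  have := PP' _ _ (clip_itv s) (clip_itv (s + h)); rewrite -/a -/b => H1.
  have H5 : (b - a) ^+ 2 <= h ^+ 2.
    rewrite -(real_normK (num_real (b - a))) -(real_normK (num_real h)).
    rewrite lerXn2r ?nnegrE//; have := clip_lip (s + h) s.
    by rewrite -/a -/b addrAC subrr add0r.
  (* Truncation causes an error beside a nonzero factor only when s lies inside the interval and s +
     h does not. Then the error and the distance from s to the endpoint that is crossed are both at
     most |h|, and 1 - a^2 is at most twice this distance. *)
  have H6 : (1 - a ^+ 2) * `|b - a - h| <= 2 * h ^+ 2.
    have h2 := real_normK (num_real h).
    rewrite /a /b; case: (clipP s) => -[s1 ->].
    + by rewrite sqrrN expr1n subrr mul0r mulr_ge0// sqr_ge0.
    + by rewrite expr1n subrr mul0r mulr_ge0// sqr_ge0.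
    case: (clipP (s + h)) => -[s2 ->].
    + have -> : `|-1 - s - h| = -1 - s - h by apply/ger0_norm; lra.
      have h0 : h <= 0 by lra.
      have -> : 2 * h ^+ 2 = (2 * - h) * (- h) by ring.
      by apply: ler_pM; [nra|lra|nra|lra].
    + have -> : `|1 - s - h| = s + h - 1 by rewrite ler0_norm; lra.
      have h0 : 0 <= h by lra.
      have -> : 2 * h ^+ 2 = (2 * h) * h by ring.
      by apply: ler_pM; [nra|lra|nra|lra].
    + have -> : s + h - s - h = 0 by ring.
      by rewrite normr0 mulr0 mulr_ge0// sqr_ge0.
  have -> : P b - P a - h * P' a =
      (P b - P a - P' a * (b - a)) + P' a * (b - a - h) by ring.
  have H7 : `|P' a * (b - a - h)| <= C * (2 * h ^+ 2).
    rewrite P'Q normrM normrM ger0_norm; last first.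
      by have := clip_itv s; rewrite -/a; nra.
    have := QC _ (clip_itv s); rewrite -/a => Qa.
    rewrite mulrAC [_ * `|Q a|]mulrC; apply: ler_pM => //.
    by rewrite mulr_ge0//; have := clip_itv s; rewrite -/a; nra.
  rewrite (le_trans (ler_normD _ _))//.
  have := ler_wpM2l C0 H5; lra.
Qed.

(* Both derivatives vanish at -1 and 1, so that truncation by [clip] preserves
   C^{1,1}; the factor 15 / 16 gives [bump] the integral 1. *)
Definition bump s : R := 15 / 16 * (1 - clip s ^+ 2) ^+ 2.
Definition step s : R := (2 + 3 * clip s - clip s ^+ 3) / 4.

Lemma c11_bump : c11 54 bump (fun s => -15 / 4 * clip s * (1 - clip s ^+ 2)).
Proof.
have -> : 54 = 3 * 18 :> R by ring.
apply: (@c11_clip 18 (fun c => 15 / 16 * (1 - c ^+ 2) ^+ 2)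
  (fun c => -15 / 4 * c * (1 - c ^+ 2)) (fun c => -15 / 4 * c)) => //.
- move=> a a1; have a0 : 0 <= a ^+ 2 <= 1 by nra.
  by rewrite ler_norml; nra.
- by move=> a a1; rewrite ler_norml; lra.
- by move=> a; rewrite mulrC.
move=> a b a1 b1.
(* The bracket left in front of (b - a)^2 is at most 4 + 4 + 2 + 8 = 18 in absolute value. *)
have -> : 15 / 16 * (1 - b ^+ 2) ^+ 2 - 15 / 16 * (1 - a ^+ 2) ^+ 2 -
   -15 / 4 * a * (1 - a ^+ 2) * (b - a) =
  (15 / 16 * (4 * a ^+ 2 + (b - a) ^+ 2 - 2 * (1 - a ^+ 2) + 4 * a * (b - a))) *
   (b - a) ^+ 2 by field.
rewrite normrM [X in _ * X]ger0_norm ?sqr_ge0// ler_wpM2r ?sqr_ge0//.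
by rewrite ler_norml; nra.
Qed.

Lemma c11_step : c11 54 step (fun s => 3 / 4 * (1 - clip s ^+ 2)).
Proof.
have -> : 54 = 3 * 18 :> R by ring.
apply: (@c11_clip 18 (fun c => (2 + 3 * c - c ^+ 3) / 4)
  (fun c => 3 / 4 * (1 - c ^+ 2)) (fun c => 3 / 4)) => //.
- move=> a a1; have -> : a ^+ 3 = a * a ^+ 2 by ring.
  have a0 : 0 <= a ^+ 2 <= 1 by nra.
  rewrite ler_norml; move: (a ^+ 2) a0 => q q0.
  have h1 : 0 <= (1 - a) * q by apply: mulr_ge0; lra.
  have h2 : 0 <= (1 + a) * q by apply: mulr_ge0; lra.
  lra.
- by move=> a a1; rewrite ler_norml; lra.
- by move=> a; rewrite mulrC.
move=> a b a1 b1.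
have -> : (2 + 3 * b - b ^+ 3) / 4 - (2 + 3 * a - a ^+ 3) / 4 -
   3 / 4 * (1 - a ^+ 2) * (b - a) =
  (- (b + 2 * a) / 4) * (b - a) ^+ 2 by field.
rewrite normrM [X in _ * X]ger0_norm ?sqr_ge0// ler_wpM2r ?sqr_ge0//.
by rewrite ler_norml; lra.
Qed.

Lemma bump_ge0 s : 0 <= bump s.
Proof. by rewrite mulr_ge0// sqr_ge0. Qed.

Lemma bump_out s : 1 <= `|s| -> bump s = 0.
Proof.
rewrite /bump ler_normr => /orP[] s1.
- by rewrite clip_ge1// expr1n subrr expr0n mulr0.
- by rewrite clip_leN1 ?sqrrN ?expr1n ?subrr ?expr0n ?mulr0//; lra.
Qed.

Lemma step_itv s : 0 <= step s <= 1.
Proof.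
rewrite /step; have := clip_itv s; move: (clip s) => a a1.
have -> : (2 + 3 * a - a ^+ 3) / 4 = (2 - a) * (1 + a) ^+ 2 / 4 by field.
apply/andP; split.
  by rewrite divr_ge0// mulr_ge0 ?sqr_ge0//; lra.
have -> : (2 - a) * (1 + a) ^+ 2 / 4 = 1 - (2 + a) * (1 - a) ^+ 2 / 4 by field.
by rewrite lerBlDr lerDl divr_ge0// mulr_ge0 ?sqr_ge0//; lra.
Qed.

Lemma step_ge0 s : 0 <= step s.
Proof. by case/andP: (step_itv s). Qed.

Lemma step1 s : 1 <= s -> step s = 1.
Proof. by move=> s1; rewrite /step clip_ge1//; field. Qed.

Lemma step0 s : s <= -1 -> step s = 0.
Proof. by move=> s1; rewrite /step clip_leN1//; field. Qed.

End kernels.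

(** * Mollifiers and cut-off functions in several variables *)

Section kernels_rV.
Variables (R : realType) (d : nat).
Local Notation V := 'rV[R]_d.

Lemma c11_coord (C : R) (g g' : R -> R) (a b : R) (i : 'I_d) : c11 C g g' ->
  C11 (fun x : V => g (a * x 0 i + b)).
Proof.
move=> [C0 g1 g2 g3].
(* The chain rule costs |a| in the Lipschitz bound and a^2 in the remainder; 1 + a^2 dominates
   both. *)
have a1 : `|a| <= 1 + a ^+ 2.
  by rewrite -(real_normK (num_real a)); have := normr_ge0 a; nra.
have CC : C <= C * (1 + a ^+ 2) by rewrite ler_peMr// lerDl sqr_ge0.
apply: (@C11I _ _ (C * (1 + a ^+ 2)) _
  (fun j x => if j == i then a * g' (a * x 0 i + b) else 0)); split.
- exact: le_trans CC.
- by move=> x; exact: le_trans (g1 _) CC.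
- move=> x y; rewrite (le_trans (g2 _ _))// -mulrA ler_wpM2l//.
  have -> : a * x 0 i + b - (a * y 0 i + b) = a * (x - y) 0 i by rewrite !mxE; ring.
  by rewrite normrM ler_pM// le_coord_norm.
- move=> j x h; rewrite !mxE eqxx /=.
  have [->|ij] := eqVneq i j.
    rewrite mulr1.
    have := g3 (a * x 0 j + b) (a * h).
    have -> : a * x 0 j + b + a * h = a * (x 0 j + h) + b by ring.
    rewrite mulrA (mulrC h) => /le_trans -> //.
    rewrite exprMn mulrA ler_wpM2r ?sqr_ge0// ler_wpM2l//.
    by rewrite lerDr.
  set X : R := x 0 i + _; have -> : X = x 0 i by rewrite /X mulr0n mulr0 addr0.
  rewrite subrr mulr0 subrr normr0.
  by rewrite mulr_ge0 ?sqr_ge0// (le_trans C0).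
Qed.

(** A product of one-dimensional kernels: its support is a ball of the sup norm, and its integral is
    a product of integrals equal to 1. *)
Definition mollifier (e : R) (z : V) : R := \prod_(i < d) (bump (e^-1 * z 0 i) / e).

Lemma mollifier_C11 e : C11 (mollifier e).
Proof.
apply: C11_prod => i; apply: C11M; last exact: C11_cst.
rewrite (_ : (fun x => _) = fun x : V => bump (e^-1 * x 0 i + 0)).
  exact: (c11_coord _ _ _ (c11_bump R)).
by apply/funext => x; rewrite addr0.
Qed.

Lemma mollifier_ge0 e z : 0 < e -> 0 <= mollifier e z.
Proof.
by move=> e0; apply: prodr_ge0 => i _; rewrite divr_ge0 ?bump_ge0// ltW.
Qed.

Lemma mollifier_out e z : 0 < e -> e <= `|z| -> mollifier e z = 0.
Proof.
move=> e0 ez; have [i ei] : exists i, e <= `|z 0 i|.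
  apply: contrapT => /forallNP H; have : `|z| < e.
    by apply: rV_norm_lt => // i; rewrite ltNge; apply/negP/H.
  by rewrite ltNge ez.
rewrite /mollifier (bigD1 i)//= bump_out ?mul0r//.
by rewrite normrM gtr0_norm ?invr_gt0// ler_pdivlMl// mulr1.
Qed.

(** A cut-off function for sup-norm balls around c: the argument 3 - 2 u / s of [step] is at least 1
    for u <= s and at most -1 for u >= 2 s, and likewise for - u. *)
Definition plateau (c : V) (s : R) (x : V) : R :=
  \prod_(i < d) (step (3 - 2 / s * (x 0 i - c 0 i)) * step (3 + 2 / s * (x 0 i - c 0 i))).

Lemma plateau_C11 c s : C11 (plateau c s).
Proof.
apply: C11_prod => i; apply: C11M.
- rewrite (_ : (fun x => _) = fun x : V => step (- (2 / s) * x 0 i + (3 + 2 / s * c 0 i))).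
    exact: (c11_coord _ _ _ (c11_step R)).
  by apply/funext => x; congr step; ring.
- rewrite (_ : (fun x => _) = fun x : V => step (2 / s * x 0 i + (3 - 2 / s * c 0 i))).
    exact: (c11_coord _ _ _ (c11_step R)).
  by apply/funext => x; congr step; ring.
Qed.

Lemma plateau_itv c s x : 0 <= plateau c s x <= 1.
Proof.
rewrite /plateau; apply/andP; split.
  by apply: prodr_ge0 => i _; apply: mulr_ge0; apply: step_ge0.
apply: prodr_ile1 => i _; set a := step _; set b := step _.
have /andP[a0 a1] : 0 <= a <= 1 by exact: step_itv.
have /andP[b0 b1] : 0 <= b <= 1 by exact: step_itv.
by rewrite mulr_ge0//= mulr_ile1.
Qed.

Lemma plateau1 c s x : 0 < s -> `|x - c| <= s -> plateau c s x = 1.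
Proof.
move=> s0 xs; rewrite /plateau big1// => i _.
have : `|(x - c) 0 i| <= s by exact: le_trans (le_coord_norm _ _) xs.
rewrite !mxE; move: (x 0 i - c 0 i) => u.
rewrite ler_norml => /andP[u1 u2].
have -> : 2 / s * u = 2 * (u / s) by ring.
have v1 : u / s <= 1 by rewrite ler_pdivrMr// mul1r.
have v2 : - 1 <= u / s by rewrite ler_pdivlMr//; lra.
by rewrite !step1 ?mulr1//; lra.
Qed.

Lemma plateau0 c s x : 0 < s -> 2 * s <= `|x - c| -> plateau c s x = 0.
Proof.
move=> s0 xs; have [i ei] : exists i, 2 * s <= `|(x - c) 0 i|.
  apply: contrapT => /forallNP H; have : `|x - c| < 2 * s.
    by apply: rV_norm_lt => [|i]; [lra|rewrite ltNge; apply/negP/H].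
  by rewrite ltNge xs.
rewrite /plateau (bigD1 i)//=; move: ei; rewrite !mxE.
move: (x 0 i - c 0 i) => u.
have -> : 2 / s * u = 2 * (u / s) by ring.
rewrite ler_normr => /orP[] su.
- have v1 : 2 <= u / s by rewrite ler_pdivlMr.
  rewrite [step (3 - 2 * _)]step0; last lra.
  by rewrite !mul0r.
- have v1 : u / s <= - 2 by rewrite ler_pdivrMr//; lra.
  rewrite [step (3 + 2 * _)]step0; last lra.
  by rewrite mulr0 mul0r.
Qed.

End kernels_rV.

(** * Normalisation of the mollifier *)

Section mollifier_integral.
Variable R : realType.

Lemma bumpN (s : R) : bump (- s) = bump s.
Proof.
rewrite /bump; case: (clipP s) => -[s1 ->].
- by rewrite clip_ge1 ?sqrrN//; lra.
- by rewrite clip_leN1 ?sqrrN//; lra.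
- by rewrite clip_id ?sqrrN// ler_norml; lra.
Qed.

Lemma measurable_bump (e b : R) :
  measurable_fun setT (fun a : R => bump (e^-1 * (a - b)) / e).
Proof.
apply: continuous_measurable_fun => x.
have [_ _ lip _] := c11_bump R.
apply/cvgrPdist_le => eps eps0.
have K0 : 0 < 54 * `|e^-1| * `|e^-1| + 1 by rewrite ltr_wpDl// !mulr_ge0.
apply/nbhs_ballP; exists (eps / (54 * `|e^-1| * `|e^-1| + 1)) => /=.
  exact: divr_gt0.
move=> y; rewrite /ball_ /= ltr_pdivlMr// => xy.
rewrite -mulrBl normrM.
apply: (@le_trans _ _ (54 * `|e^-1| * `|e^-1| * `|x - y|)).
  rewrite [leRHS]mulrAC ler_wpM2r// (le_trans (lip _ _))// -mulrA ler_wpM2l//.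
  by rewrite -mulrBr normrM opprB addrA subrK.
by have := normr_ge0 (x - y); lra.
Qed.

Lemma integral_bump (e b : R) : 0 < e ->
  (\int[lebesgue_measure]_a (bump (e^-1 * (a - b)) / e)%:E = 1)%E.
Proof.
move=> e0.
rewrite (lebesgue_integral_translation (- b) (f := fun a => (bump (e^-1 * a) / e)%:E)); last 2 first.
- apply/measurable_EFinP; have := measurable_bump e 0.
  by under eq_fun do rewrite subr0.
- by move=> x; rewrite lee_fin divr_ge0 ?bump_ge0// ltW.
(* On [-e, e] the truncation in [bump] is the identity. P is the odd antiderivative of the kernel
   there, with P(e) = 15/16 (1 - 2/3 + 1/5) = 1/2. *)
pose q : {poly R} := e^-1 *: 'X.
pose P : {poly R} := (15 / 16) *: (q - (2 / 3) *: q ^+ 3 + (5^-1) *: q ^+ 5).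
have PE x : P^`().[x] = 15 / 16 * (1 - (e^-1 * x) ^+ 2) ^+ 2 / e.
  rewrite /P /q !(poly.derivE, hornerE)/=.
  by field; rewrite gt_eqF.
transitivity (\int[lebesgue_measure]_(x in `[(- e)%R, e]) (horner P^`() x)%:E)%E.
  rewrite [RHS]integral_mkcond; apply: eq_integral => x _.
  rewrite patchE; case: ifPn => [/set_mem /= /[!in_itv] /= xe|/negP xe].
    rewrite PE /bump clip_id// ler_norml ler_pdivlMl// mulrN1.
    by rewrite ler_pdivrMl// mulr1.
  congr EFin; rewrite bump_out ?mul0r// normrM gtr0_norm ?invr_gt0//.
  rewrite ler_pdivlMl// mulr1 leNgt; apply/negP => /ltW.
  by rewrite ler_norml => xe'; apply: xe; rewrite inE /= in_itv.
rewrite (@continuous_FTC2 _ _ (horner P)).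
- rewrite -EFinB; congr EFin; rewrite /P /q !(hornerD, hornerN, hornerZ, horner_exp, hornerX).
  by field; rewrite gt_eqF.
- by lra.
- exact/continuous_subspaceT/continuous_horner.
- split=> [x _| |].
  + exact: derivable_horner.
  + by apply: cvg_at_right_filter; exact: continuous_horner.
  + by apply: cvg_at_left_filter; exact: continuous_horner.
- by move=> x _; rewrite derivE.
Qed.

Lemma integral_mollifier d (e : R) (x : 'rV[R]_d) : 0 < e ->
  (\int[lebesgue_rV R d]_y (mollifier e (y - x))%:E = 1)%E.
Proof.
move=> e0; have := @integral_prod_coord R d (fun i a => bump (e^-1 * (a - x ord0 i)) / e)
  (fun=> 1); rewrite big1// => <-.
- by apply: eq_integral => y _; congr EFin; apply: eq_bigr => i _; rewrite !mxE.
- by move=> i; exact: measurable_bump.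
- by move=> i a; rewrite divr_ge0 ?bump_ge0// ltW.
- by move=> i; exact: integral_bump.
Qed.

Lemma mollifierN d (e : R) (x : 'rV[R]_d) : mollifier e (- x) = mollifier e x.
Proof. by apply: eq_bigr => i _; rewrite mxE mulrN bumpN. Qed.

End mollifier_integral.

(** * Mollification in L2 *)

Section mollification.
Variables (R : realType) (d : nat) (Omega : set 'rV[R]_d).
Local Notation V := 'rV[R]_d.
Local Notation mu := (lebesgue_rV R d).
Hypothesis mO : measurable Omega.
Hypothesis Ooo : (mu Omega < +oo)%E.
Implicit Types (f g u : V -> R) (c C e : R) (v x y : V).
Local Notation itg f := (mu.-integrable Omega (fun x => (f x)%:E)).
Local Notation int f := (\int[mu]_(x in Omega) f x).
Local Notation norm := (L2norm Omega).
Local Notation L2 := (L2 Omega).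

Lemma C11_measurable f (D : set V) : C11 f -> measurable_fun D f.
Proof. by move=> fC; apply: continuous_measurable_rV; exact: C11_continuous. Qed.

Lemma C11_pderiv_measurable f i (D : set V) : C11 f -> measurable_fun D (pderiv i f).
Proof. by move=> fC; apply: continuous_measurable_rV; exact: C11_pderiv_continuous. Qed.

(** Integration over Omega amounts to extending f by zero. The value at x samples f near x - v, so
    that the graph of f is moved by v. *)
Definition mollify e v f x : R := int (fun y => f y * mollifier e (x - y - v)).

Lemma measurable_mollifier_sub e v x (D : set V) :
  measurable_fun D (fun y => mollifier e (x - y - v)).
Proof.
have [C mC] := mollifier_C11 d e.
rewrite (_ : (fun y => _) = (fun y => mollifier e (x - v - y))); last first.
  by apply/funext => y; rewrite addrAC.
by apply: C11_measurable; apply: C11I (C11w_refl (x - v) mC).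
Qed.

Lemma itg_mollify e v f x : itg f -> itg (fun y => f y * mollifier e (x - y - v)).
Proof.
move=> fi; have [C [C0 m1 _ _]] := mollifier_C11 d e.
apply: (@itgM_bounded _ _ _ mu _ mO _ _ C) => //; exact: measurable_mollifier_sub.
Qed.

(** The left-hand side of each estimate in [C11w] is linear in the kernel, so integration against f
    preserves the estimate, with the constant multiplied by the L1 norm of f. Differentiation under
    the integral sign is a consequence. *)
Lemma C11w_mollify e v f : itg f -> exists C,
  C11w C (mollify e v f)
    (fun i x => int (fun y => f y * pderiv i (@mollifier R d e) (x - y - v))).
Proof.
move=> fi; have [C mC] := mollifier_C11 d e.
have FC i x := C11w_deriv_bound i x mC.
have [C0 m1 m2 m3] := mC.
pose I := int (fun y => `|f y|).
have I0 : 0 <= I by apply: Rintegral_ge0.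
have fn : itg (fun y => `|f y|) by exact: integrable_norm.
have key (h : V -> R) c : measurable_fun Omega h -> 0 <= c ->
    (forall y, `|h y| <= c) -> `|int (fun y => f y * h y)| <= c * I.
  move=> mh c0 hc.
  have fhi : itg (fun y => f y * h y) by apply: (@itgM_bounded _ _ _ mu _ mO _ _ c).
  rewrite (le_trans (le_normr_Rintegral mO fhi))// -RintegralZl//.
  apply: le_Rintegral => //; first exact: integrable_norm.
    exact: itgZ.
  by move=> y _; rewrite normrM mulrC ler_wpM2r.
have mm x : measurable_fun Omega (fun y => mollifier e (x - y - v)).
  exact: measurable_mollifier_sub.
have mp i x : measurable_fun Omega (fun y => pderiv i (@mollifier R d e) (x - y - v)).
  rewrite (_ : (fun y => _) =
      (fun y => - pderiv i (fun z => mollifier e (x - v - z)) y)); last first.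
    apply/funext => y; rewrite (C11w_pderiv _ _ (C11w_refl (x - v) mC)) opprK.
    by rewrite addrAC.
  apply: measurable_funN; apply: C11_pderiv_measurable.
  exact: C11I (C11w_refl (x - v) mC).
have fpi i x : itg (fun y => f y * pderiv i (@mollifier R d e) (x - y - v)).
  by apply: (@itgM_bounded _ _ _ mu _ mO _ _ C).
exists (C * I); split; first exact: mulr_ge0.
- by move=> x; exact: key.
- move=> x y; rewrite -RintegralB//; [|exact: itg_mollify..].
  under eq_Rintegral do rewrite -mulrBr.
  rewrite mulrAC; apply: key; first exact: measurable_funB.
    exact: mulr_ge0.
  move=> z; rewrite (le_trans (m2 _ _))// opprB addrA subrK.
  by rewrite opprB addrA subrK.
- move=> i x h.
  rewrite (_ : h * Rintegral _ _ _ =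
    int (fun y => h * (f y * pderiv i (@mollifier R d e) (x - y - v)))); last first.
    by apply/esym; apply: RintegralZl => //; exact: fpi.
  rewrite /mollify -RintegralB//; [|exact: itg_mollify..].
  rewrite -RintegralB//; [|by apply: itgB => //; exact: itg_mollify|exact: itgZ].
  rewrite (_ : Rintegral _ _ _ = int (fun y => f y *
     (mollifier e (x - y - v + h *: delta_mx 0 i) - mollifier e (x - y - v) -
      h * pderiv i (@mollifier R d e) (x - y - v)))); last first.
    apply: eq_Rintegral => y _.
    have -> : x + h *: delta_mx 0 i - y - v = x - y - v + h *: delta_mx 0 i.
      by rewrite (addrAC x) (addrAC (x - y)).
    ring.
  rewrite mulrAC; apply: key => //; last by rewrite mulr_ge0 ?sqr_ge0.
  apply: measurable_funB; last exact: measurable_funM.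
  apply: measurable_funB => //.
  rewrite (_ : (fun y => _) =
    (fun y => mollifier e (x + h *: delta_mx 0 i - y - v))) //.
  by apply/funext => y; rewrite [in RHS](addrAC x) [in RHS](addrAC (x - y)).
Qed.

Lemma C11_mollify e v f : itg f -> C11 (mollify e v f).
Proof. by move=> /(C11w_mollify e v)[C]; exact: C11I. Qed.

Lemma pderiv_mollify e v f i x : itg f -> pderiv i (mollify e v f) x =
  int (fun y => f y * pderiv i (@mollifier R d e) (x - y - v)).
Proof. by move=> /(C11w_mollify e v)[C] /C11w_pderiv ->. Qed.

Lemma L2_mollify e v f : itg f -> L2 (mollify e v f).
Proof.
move=> fi; have fC := C11_mollify e v fi; have [C [_ f1 _ _]] := fC.
by apply: (@L2_bounded _ _ _ mO Ooo _ C) => //; exact: C11_measurable.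
Qed.

Lemma integral_mollifier_subr e v x : 0 < e ->
  (\int[mu]_y (mollifier e (x - y - v))%:E = 1)%E.
Proof.
move=> e0; rewrite -(integral_mollifier (x - v) e0).
by apply: eq_integral => y _; rewrite -mollifierN !opprB addrCA.
Qed.

Lemma integral_mollifier_subl e v y : 0 < e ->
  (\int[mu]_x (mollifier e (x - y - v))%:E = 1)%E.
Proof.
move=> e0; rewrite -(integral_mollifier (y + v) e0).
by apply: eq_integral => x _; rewrite opprD addrA.
Qed.

Lemma itgT_mollifier e v x : 0 < e ->
  mu.-integrable setT (fun y => (mollifier e (x - y - v))%:E).
Proof.
move=> e0; apply/integrableP; split.
  by apply/measurable_EFinP; exact: measurable_mollifier_sub.
under eq_integral do rewrite /= ger0_norm ?mollifier_ge0//.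
by rewrite integral_mollifier_subr// ltry.
Qed.

Lemma Rintegral_mollifier_le1 e v x : 0 < e ->
  int (fun y => mollifier e (x - y - v)) <= 1.
Proof.
move=> e0; rewrite -lee_fin /Rintegral fineK; last first.
  apply: integrable_fin_num => //; apply: integrableS (itgT_mollifier v x e0) => //.
rewrite -(integral_mollifier_subr v x e0).
apply: ge0_subset_integral => //.
- by apply/measurable_EFinP; exact: measurable_mollifier_sub.
- by move=> y _; rewrite lee_fin mollifier_ge0.
Qed.

(* Jensen's inequality for the sub-probability density y |-> mollifier e (x - y - v) *)
Lemma sqr_mollify_le e v f x : 0 < e -> L2 f ->
  mollify e v f x ^+ 2 <= int (fun y => f y ^+ 2 * mollifier e (x - y - v)).
Proof.
move=> e0 fL; set m := mollify e v f x; set k := fun y => mollifier e (x - y - v).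
have fi := L2_itg mO Ooo fL; have f2 := L2_sq_itg fL.
have ki : itg k by apply: integrableS (itgT_mollifier v x e0).
have i1 : itg (fun y => f y ^+ 2 * k y) by exact: (itg_mollify e v x f2).
have i2 : itg (fun y => f y * k y) by exact: itg_mollify.
have : 0 <= int (fun y => (f y - m) ^+ 2 * k y).
  by apply: Rintegral_ge0 => y _; rewrite mulr_ge0 ?sqr_ge0 ?mollifier_ge0.
rewrite (_ : Rintegral _ _ _ =
    int (fun y => f y ^+ 2 * k y) - 2 * m * m + m ^+ 2 * int k); last first.
  rewrite -[in 2 * m * m]RintegralZl// -RintegralZl// -RintegralB//; last exact: itgZ.
  rewrite -RintegralD//; [|by apply: itgB => //; exact: itgZ|exact: itgZ].
  apply: eq_Rintegral => y _; rewrite /k.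
  by move: (f y) (mollifier _ _) m => a b c; ring.
have := Rintegral_mollifier_le1 v x e0; rewrite -/k => k1.
have := ler_wpM2l (sqr_ge0 m) k1.
rewrite mulr1; lra.
Qed.

(** Pointwise Jensen, then Tonelli: the kernel has mass 1 in x as well, and restricting x to Omega
    only lowers the integral. *)
Lemma L2norm_mollify e v f : 0 < e -> L2 f -> norm (mollify e v f) <= norm f.
Proof.
move=> e0 fL; have fi := L2_itg mO Ooo fL; have f2 := L2_sq_itg fL.
rewrite -(@ler_pXn2r _ 2)// ?nnegrE ?L2norm_ge0// !L2norm_sqr//.
rewrite -lee_fin /Rintegral fineK; last first.
  by apply: integrable_fin_num => //; apply: L2_sq_itg; exact: L2_mollify.
rewrite fineK; last exact: integrable_fin_num.
(* The extension by zero allows Tonelli on the whole space, where the mass of the kernel in x is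
   exactly 1. *)
pose fO := (fun y => f y ^+ 2) \_ Omega.
have mfO : measurable_fun setT fO.
  by apply/(measurable_restrictT _ mO); exact: measurable_funX fL.1.
have fO0 y : 0 <= fO y by rewrite /fO patchE; case: ifP => // _; exact: sqr_ge0.
pose F (p : V * V) : \bar R := (fO p.2 * mollifier e (p.1 - p.2 - v))%:E.
have mF : measurable_fun setT F.
  apply/measurable_EFinP; apply: measurable_funM.
    by apply: measurableT_comp => //; exact: measurable_snd.
  apply: measurable_prod => i _.
  rewrite [X in measurable_fun _ X](_ : _ = (fun a => bump (e^-1 * (a - v 0 i)) / e) \o
     (fun p : V * V => coord_rV i p.1 - coord_rV i p.2)); last first.
    by apply/funext => p; rewrite /= !mxE.
  apply: measurableT_comp; first exact: measurable_bump.
  apply: measurable_funB.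
  - by apply: measurableT_comp; [exact: measurable_coord_rV|exact: measurable_fst].
  - by apply: measurableT_comp; [exact: measurable_coord_rV|exact: measurable_snd].
have F0 p : (0 <= F p)%E by rewrite lee_fin mulr_ge0// mollifier_ge0.
apply: (@le_trans _ _ (\int[mu]_x \int[mu]_y F (x, y)))%E; last first.
  rewrite [leLHS](_ : _ = \int[mu]_y \int[mu]_x F (x, y))%E; last first.
    exact: (fubini_tonelli F mF F0).
  rewrite [leRHS]integral_mkcond le_eqVlt; apply/orP; left; apply/eqP.
  apply: eq_integral => y _; rewrite /F /=.
  under eq_integral do rewrite EFinM.
  rewrite ge0_integralZl_EFin//; last 2 first.
  - by move=> x _; rewrite lee_fin mollifier_ge0.
  - apply/measurable_EFinP; apply: C11_measurable.
    have [C mC] := mollifier_C11 d e.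
    rewrite (_ : (fun x => _) = (fun x => mollifier e (x - (y + v)))).
      exact: C11I (C11w_shift _ mC).
    by apply/funext => x; rewrite opprD addrA.
  by rewrite integral_mollifier_subl// mule1 /fO restrict_EFin.
have mG : measurable_fun setT (fun x => \int[mu]_y F (x, y))%E.
  exact: (measurable_fun_fubini_tonelli_F F).
apply: (@le_trans _ _ (\int[mu]_(x in Omega) \int[mu]_y F (x, y)))%E.
  apply: ge0_le_integral => //.
  - by move=> x _; rewrite lee_fin sqr_ge0.
  - apply/measurable_EFinP; apply: measurable_funX.
    by apply: C11_measurable; exact: C11_mollify.
  - exact: measurable_funTS.
  move=> x _.
  apply: (@le_trans _ _ (int (fun y => f y ^+ 2 * mollifier e (x - y - v)))%:E).
    by rewrite lee_fin sqr_mollify_le.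
  rewrite /Rintegral fineK; last first.
    by apply: integrable_fin_num => //; exact: (itg_mollify e v x f2).
  rewrite integral_mkcond le_eqVlt; apply/orP; left; apply/eqP.
  apply: eq_integral => y _; rewrite /F /fO /= !patchE.
  by case: ifP => //; rewrite mul0r.
apply: ge0_subset_integral => // x _; exact: integral_ge0.
Qed.

(** The kernel has mass 1 and lives where |x - y - v| < e, hence |x - y| < |v| + e. As f vanishes
    off Omega, no mass is lost near the boundary. *)
Lemma mollify_lipschitz e v f C x : 0 < e -> 0 <= C -> itg f ->
  (forall y, ~ Omega y -> f y = 0) -> (forall y z, `|f y - f z| <= C * `|y - z|) ->
  `|mollify e v f x - f x| <= C * (`|v| + e).
Proof.
move=> e0 C0 fi fO fC.
have kT := itgT_mollifier v x e0.
have mk : measurable_fun setT (fun y => mollifier e (x - y - v)).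
  exact: measurable_mollifier_sub.
have RkT : \int[mu]_y mollifier e (x - y - v) = 1.
  by rewrite /Rintegral integral_mollifier_subr.
have fkT : mu.-integrable setT (fun y => (f y * mollifier e (x - y - v))%:E).
  have := (integrable_mkcond (fun y => (f y * mollifier e (x - y - v))%:E) mO).1
    (itg_mollify e v x fi).
  congr (_.-integrable _ _); apply/funext => y; rewrite patchE.
  by case: ifPn => // /negP yO; rewrite fO ?mul0r// => /mem_set.
have -> : mollify e v f x = \int[mu]_y (f y * mollifier e (x - y - v)).
  rewrite /mollify Rintegral_mkcond; apply: eq_Rintegral => y _; rewrite patchE.
  by case: ifPn => // /negP yO; rewrite fO ?mul0r// => /mem_set.
have -> : f x = \int[mu]_y (f x * mollifier e (x - y - v)).
  by rewrite RintegralZl// RkT mulr1.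
have fxkT : mu.-integrable setT (fun y => (f x * mollifier e (x - y - v))%:E).
  exact: itgZ.
rewrite -RintegralB//.
have dT : mu.-integrable setT (fun y => (f y * mollifier e (x - y - v) -
   f x * mollifier e (x - y - v))%:E) by exact: itgB.
rewrite (le_trans (le_normr_Rintegral _ dT))//.
rewrite -[leRHS]mulr1 -RkT -RintegralZl//.
apply: le_Rintegral => //; [exact: integrable_norm|exact: itgZ|].
move=> y _; rewrite -mulrBl normrM (ger0_norm (mollifier_ge0 _ e0)).
have [ek|ke] := leP e `|x - y - v|; first by rewrite mollifier_out// !mulr0.
rewrite ler_wpM2r ?mollifier_ge0// (le_trans (fC _ _))// ler_wpM2l//.
rewrite distrC -(subrK v (x - y)) (le_trans (ler_normD _ _))//.
by rewrite addrC lerD2l ltW.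
Qed.

End mollification.

(** * Borel sets and the distance to the complement *)

Section borel_rV.
Variables (R : realType) (d : nat).
Local Notation V := 'rV[R]_d.

(** Makes the open sets a generating pi-system, from which density arguments in L2 can start. *)
Lemma measurable_rV_open : @measurable _ V = <<s @open V >>.
Proof.
apply/seteqP; split; last first.
  apply: smallest_sub; first exact: sigma_algebra_measurable.
  exact: open_measurable_rV.
apply: smallest_sub; first exact: smallest_sigma_algebra.
rewrite -bigcup_seq => B /= [i _] [C mC <-]; rewrite setTI.
have : @measurable _ (measurableTypeR R) `<=` [set B | <<s @open V >> (coord_rV i @^-1` B)].
  rewrite RGenOpens.measurableE; apply: smallest_sub.
    split => /=.
    - by rewrite preimage_set0; exact: sigma_algebra0.
    - by move=> D mD; rewrite setTD preimage_setC; exact: sigma_algebraC.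
    - by move=> F mF; rewrite preimage_bigcup; exact: sigma_algebra_bigcup.
  move=> _ [a [b ->]] /=; apply: sub_gen_smallest.
  apply: open_comp; last exact: interval_open.
  by move=> x _; exact: coord_continuous.
exact.
Qed.

(* The element 1 keeps the set nonempty when W is the whole space. *)
Definition distC (W : set V) (x : V) : R :=
  inf (1%R |` [set `|x - y| | y in ~` W]).

Lemma distC_lb (W : set V) x : has_inf (1%R |` [set `|x - y| | y in ~` W]).
Proof.
split; first by exists 1; left.
by exists 0 => _ [->//|[y _ <-]].
Qed.

Lemma distC_ge0 W x : 0 <= distC W x.
Proof.
apply: lb_le_inf; first by exists 1; left.
by move=> _ [->//|[y _ <-]].
Qed.

Lemma distC_le W x y : ~ W y -> distC W x <= `|x - y|.
Proof.
by move=> Wy; apply: ge_inf; [exact: (distC_lb W x).2|right; exists y].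
Qed.

Lemma distC_out W x : ~ W x -> distC W x = 0.
Proof.
move=> Wx; apply/eqP; rewrite eq_le distC_ge0 andbT.
by have := @distC_le W x x Wx; rewrite subrr normr0.
Qed.

Lemma distC_gt0 W x : open W -> W x -> 0 < distC W x.
Proof.
move=> /openP_norm oW /oW[r r0 rW].
apply: (@lt_le_trans _ _ (Num.min 1 r)); first by rewrite lt_min ltr01.
apply: lb_le_inf; first by exists 1; left.
move=> _ [->|[y Wy <-]]; first by rewrite ge_min lexx.
by rewrite ge_min [r <= _]leNgt; apply/orP; right; apply/negP => /rW.
Qed.

Lemma distC_lipschitz W x y : `|distC W x - distC W y| <= `|x - y|.
Proof.
have H a b : distC W a - distC W b <= `|a - b|.
  rewrite lerBlDl -lerBlDr; apply: lb_le_inf; first by exists 1; left.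
  move=> _ [->|[z Wz <-]]; rewrite lerBlDr.
    apply: (@le_trans _ _ 1); last by rewrite lerDl.
    by apply: ge_inf; [exact: (distC_lb W a).2|left].
  rewrite (le_trans (distC_le _ Wz))// -[in leLHS](subrK b a) -addrA addrC.
  exact: ler_normD.
rewrite ler_norml H andbT lerNl opprB.
by rewrite (distrC x).
Qed.

End borel_rV.

(** * Convergence in L2 of shifted mollifications *)

Section mollify_cvg.
Variables (R : realType) (d : nat) (Omega : set 'rV[R]_d).
Local Notation V := 'rV[R]_d.
Local Notation mu := (lebesgue_rV R d).
Hypothesis oO : open Omega.
Let mO : measurable Omega := open_measurable_rV oO.
Hypothesis Ooo : (mu Omega < +oo)%E.
Variables (e_ : nat -> R) (v_ : nat -> V).
Hypothesis e0 : forall n, 0 < e_ n.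
Hypothesis ev : forall eps : R, 0 < eps -> exists N, forall n, (N <= n)%N -> `|v_ n| + e_ n <= eps.
Implicit Types (f g u : V -> R) (c C e eps : R) (v x y : V).
Local Notation itg f := (mu.-integrable Omega (fun x => (f x)%:E)).
Local Notation int f := (\int[mu]_(x in Omega) f x).
Local Notation norm := (L2norm Omega).
Local Notation L2 := (L2 Omega).
Local Notation M n f := (mollify Omega (e_ n) (v_ n) f).

(** A predicate on f, so that the class of good functions can grow from Lipschitz functions to
    indicators of open sets, indicators of measurable sets, simple functions and finally all of
    L2. *)
Definition mollify_cvg f := L2 f /\ forall eps, 0 < eps ->
  exists N, forall n, (N <= n)%N -> norm (fun x => M n f x - f x) <= eps.

Lemma eq_mollify f g e v x : (forall y, Omega y -> f y = g y) ->
  mollify Omega e v f x = mollify Omega e v g x.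
Proof. by move=> fg; apply: eq_Rintegral => y /set_mem Oy; rewrite fg. Qed.

Lemma mollifyB f g e v x : itg f -> itg g ->
  mollify Omega e v (fun y => f y - g y) x = mollify Omega e v f x - mollify Omega e v g x.
Proof.
move=> fi gi; rewrite -RintegralB//; [|exact: itg_mollify..].
by apply: eq_Rintegral => y _; rewrite mulrBl.
Qed.

Lemma mollifyD f g e v x : itg f -> itg g ->
  mollify Omega e v (fun y => f y + g y) x = mollify Omega e v f x + mollify Omega e v g x.
Proof.
move=> fi gi; rewrite -RintegralD//; [|exact: itg_mollify..].
by apply: eq_Rintegral => y _; rewrite mulrDl.
Qed.

Lemma mollifyZ c f e v x : itg f ->
  mollify Omega e v (fun y => c * f y) x = c * mollify Omega e v f x.
Proof.
move=> fi; rewrite -RintegralZl//; last exact: itg_mollify.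
by apply: eq_Rintegral => y _; rewrite mulrA.
Qed.

Lemma eq_mollify_cvg f g : (forall x, Omega x -> f x = g x) ->
  mollify_cvg f -> mollify_cvg g.
Proof.
move=> fg [fL fc]; split; first exact: eq_L2 fL.
move=> eps /fc[N NP]; exists N => n /NP.
by congr (_ <= _); apply: eq_L2norm => x Ox; rewrite (eq_mollify _ _ _ fg) fg.
Qed.

Lemma mollify_cvgD f g : mollify_cvg f -> mollify_cvg g -> mollify_cvg (fun x => f x + g x).
Proof.
move=> [fL fc] [gL gc]; split; first exact: L2D.
have fi := L2_itg mO Ooo fL; have gi := L2_itg mO Ooo gL.
move=> eps eps0; have e20 : 0 < eps / 2 by rewrite divr_gt0.
have [N1 N1P] := fc _ e20; have [N2 N2P] := gc _ e20.
exists (maxn N1 N2) => n; rewrite geq_max => /andP[/N1P H1 /N2P H2].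
rewrite (eq_L2norm (g := fun x => (M n f x - f x) + (M n g x - g x))); last first.
  by move=> x _; rewrite mollifyD//; ring.
rewrite (le_trans (L2norm_triangle mO _ _))//.
- by apply: L2B => //; exact: L2_mollify.
- by apply: L2B => //; exact: L2_mollify.
- lra.
Qed.

Lemma mollify_cvgZ c f : mollify_cvg f -> mollify_cvg (fun x => c * f x).
Proof.
move=> [fL fc]; split; first exact: L2Z.
have fi := L2_itg mO Ooo fL.
move=> eps eps0; have c0 : 0 < `|c| + 1 by rewrite ltr_wpDl.
have [|N NP] := fc (eps / (`|c| + 1)); first exact: divr_gt0.
exists N => n /NP; rewrite ler_pdivlMr// => H.
rewrite (eq_L2norm (g := fun x => c * (M n f x - f x))); last first.
  by move=> x _; rewrite mollifyZ//; ring.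
rewrite L2normZ//; last by apply: L2B => //; exact: L2_mollify.
by have := L2norm_ge0 Omega (fun x => M n f x - f x); lra.
Qed.

Lemma mollify_cvgB f g : mollify_cvg f -> mollify_cvg g -> mollify_cvg (fun x => f x - g x).
Proof.
move=> fc /(mollify_cvgZ (-1)) gc; apply: eq_mollify_cvg (mollify_cvgD fc gc) => x _.
by rewrite mulN1r.
Qed.

Lemma mollify_cvg_cst0 : mollify_cvg (fun=> 0).
Proof.
split; first exact: L2_cst.
move=> eps eps0; exists 0%N => n _.
rewrite (eq_L2norm (g := fun=> 0 * 0)); last first.
  move=> x _; rewrite subr0 mul0r /mollify; under eq_Rintegral do rewrite mul0r.
  by rewrite Rintegral_cst// mul0r.
by rewrite L2normZ ?normr0 ?mul0r ?ltW//; exact: L2_cst.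
Qed.

(** Mollification does not increase the L2 norm, uniformly in n, so an approximation of f by g costs
    eps / 3 twice. *)
Lemma mollify_cvg_lim f : L2 f ->
  (forall eps, 0 < eps -> exists2 g, mollify_cvg g & norm (fun x => f x - g x) <= eps) ->
  mollify_cvg f.
Proof.
move=> fL fg; split => // eps eps0.
have [|g [gL gc] fgn] := fg (eps / 3); first by rewrite divr_gt0.
have [|N NP] := gc (eps / 3); first by rewrite divr_gt0.
exists N => n /NP H; have fi := L2_itg mO Ooo fL; have gi := L2_itg mO Ooo gL.
have fgL := L2B mO fL gL; have fgi := L2_itg mO Ooo fgL.
have L1 : L2 (M n (fun x => f x - g x)) by exact: L2_mollify.
have L2' : L2 (fun x => M n g x - g x) by apply: L2B => //; exact: L2_mollify.
rewrite (eq_L2norm (g := fun x => M n (fun x => f x - g x) x +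
    ((M n g x - g x) + - (f x - g x)))); last first.
  by move=> x _; rewrite mollifyB//; ring.
rewrite (le_trans (L2norm_triangle mO _ _))//.
  by apply: L2D => //; exact: L2N.
have H2 := L2norm_mollify mO Ooo (v_ n) (e0 n) fgL.
have := L2norm_triangle mO L2' (L2N mO fgL).
rewrite L2normN; lra.
Qed.

Lemma mollify_cvg_lipschitz f C : 0 <= C -> (forall x, `|f x| <= C) ->
  (forall x, ~ Omega x -> f x = 0) -> (forall y z, `|f y - f z| <= C * `|y - z|) ->
  mollify_cvg f.
Proof.
move=> C0 fC fO fl; have cf : continuous f by exact: lipschitz_continuous_rV fl.
have mf D : measurable_fun D f by exact: continuous_measurable_rV.
have fL : L2 f by apply: (@L2_bounded _ _ _ mO Ooo _ C).
split => // eps eps0.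
pose K := C * norm (fun=> 1) + 1.
have K0 : 0 < K by rewrite ltr_wpDl// mulr_ge0// L2norm_ge0.
have [|N NP] := ev (_ : 0 < eps / K); first exact: divr_gt0.
exists N => n /NP H; have fi := L2_itg mO Ooo fL.
set c := `|v_ n| + e_ n in H.
have c0 : 0 <= c by rewrite addr_ge0// ltW.
apply: (@le_trans _ _ (norm (fun=> (C * c) * 1))).
  rewrite -(@ler_pXn2r _ 2)// ?nnegrE ?L2norm_ge0// !L2norm_sqr//.
  apply: le_Rintegral => //.
  - by apply: L2_sq_itg; apply: L2B => //; exact: L2_mollify.
  - by apply: L2_sq_itg; exact: L2_cst.
  move=> x _; rewrite mulr1 -(real_normK (num_real (_ - _))).
  rewrite lerXn2r ?nnegrE ?mulr_ge0//.
  exact: mollify_lipschitz.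
rewrite L2normZ; [|exact: mO|exact: L2_cst].
rewrite ger0_norm ?mulr_ge0//.
move: H; rewrite ler_pdivlMr// /K => H.
have := L2norm_ge0 Omega (fun=> 1); nra.
Qed.


Lemma L2_dominated f (g_ : nat -> V -> R) h eps : L2 f -> (forall n, L2 (g_ n)) ->
  L2 h -> (forall n x, Omega x -> `|f x - g_ n x| <= h x) ->
  (forall x, Omega x -> g_ ^~ x @ \oo --> f x) -> 0 < eps ->
  exists n, norm (fun x => f x - g_ n x) <= eps.
Proof.
move=> fL gL hL fgh gf eps0.
have I0 : int (fun=> 0) = 0 by rewrite Rintegral_cst// mul0r.
have cv : (fun n => int (fun x => (f x - g_ n x) ^+ 2)) @ \oo --> 0.
  rewrite -[X in _ --> X]I0.
  apply: (@Rintegral_dominated_cvg _ _ _ mu Omega mO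
    (fun n x => (f x - g_ n x) ^+ 2) (fun=> 0) (fun x => h x ^+ 2)).
  - by move=> n; apply: measurable_funX; exact: (L2B mO fL (gL n)).1.
  - exact: measurable_cst.
  - apply: aeW => x /gf gfx.
    rewrite (_ : 0 = (f x - f x) ^+ 2); last by rewrite subrr expr0n.
    have c1 : f x - g_ n x @[n --> \oo] --> f x - f x.
      by apply: cvgB; [exact: cvg_cst|exact: gfx].
    exact: (cvgM c1 c1).
  - exact: L2_sq_itg.
  - move=> n x Ox; rewrite normrX lerXn2r ?nnegrE//; last exact: fgh.
    by rewrite (le_trans _ (fgh n x Ox)).
have : \forall n \near \oo, `|int (fun x => (f x - g_ n x) ^+ 2)| < eps ^+ 2.
  have /cvgr0Pnorm_lt := cv; apply; exact: exprn_gt0.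
move=> [n _ /(_ n (leqnn n)) /= H]; exists n.
rewrite -(@ler_pXn2r _ 2)// ?nnegrE ?L2norm_ge0//; last exact: ltW.
by rewrite L2norm_sqr (le_trans (ler_norm _))//; exact: ltW.
Qed.

Lemma L2_indic (A : set V) : measurable A -> L2 (\1_A : V -> R).
Proof.
move=> mA; apply: (@L2_bounded _ _ _ mO Ooo _ 1); first exact: measurable_indic.
by move=> x _; rewrite indicE; case: (_ \in _); rewrite ?normr1 ?normr0.
Qed.

(** The indicator is the limit of the truncated multiples min(1, n dist) of the distance to the
    complement, which are Lipschitz. Passing to U [&] Omega makes these approximants vanish off
    Omega. *)
Lemma mollify_cvg_open (U : set V) : open U -> mollify_cvg (\1_U : V -> R).
Proof.
move=> oU; pose W := U `&` Omega; have oW : open W by exact: openI.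
apply: (@eq_mollify_cvg (\1_W)).
  by move=> x Ox; rewrite !indicE /W in_setI (mem_set Ox) andbT.
apply: mollify_cvg_lim; first by apply: L2_indic; exact: open_measurable_rV.
pose g n x := Num.min 1 (n%:R * distC W x).
have gC n : mollify_cvg (g n).
  have n0 : 0 <= n%:R :> R by [].
  apply: (@mollify_cvg_lipschitz _ (n%:R + 1)); first exact: addr_ge0.
  - move=> x; rewrite ger0_norm ?le_min ?ler01 ?mulr_ge0 ?distC_ge0//.
    by rewrite ge_min lerDr n0.
  - by move=> x Ox; rewrite /g distC_out ?mulr0 ?min_r//; move=> [].
  - move=> y z; have := distC_lipschitz W y z; rewrite /g.
    have := normr_ge0 (y - z).
    move: (distC W y) (distC W z) (`|y - z|) => a b c c0 abc.
    have H (p q : R) : `|Num.min 1 p - Num.min 1 q| <= `|p - q|.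
      have h1 := ler_norm (p - q); have h2 := ler_norm (q - p); rewrite distrC in h2.
      by rewrite ler_norml; case: (leP 1 p) => p1; case: (leP 1 q) => q1; lra.
    rewrite (le_trans (H _ _))// -mulrBr normrM ger0_norm//; nra.
move=> eps eps0.
suff [n H] : exists n, norm (fun x => \1_W x - g n x) <= eps by exists (g n).
apply: (@L2_dominated _ g (fun=> 1)); last exact: eps0.
- by apply: L2_indic; exact: open_measurable_rV.
- by move=> n; have [] := gC n.
- exact: L2_cst.
- move=> n x _; rewrite indicE.
  have g01 : 0 <= g n x <= 1.
    by rewrite le_min ler01 mulr_ge0 ?distC_ge0//= ge_min lexx.
  by case: (_ \in _); rewrite ?mulr1n ?mulr0n ler_norml; lra.
- move=> x _; rewrite indicE; have [xW|xW] := boolP (x \in W); last first.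
    rewrite (_ : g ^~ x = fun=> 0); first exact: cvg_cst.
    apply/funext => n; rewrite /g distC_out ?mulr0 ?min_r//.
    by move=> /mem_set; rewrite (negbTE xW).
  have D0 := distC_gt0 oW (set_mem xW).
  apply: cvg_near_cst; near=> n; rewrite /g min_l//.
  rewrite -ler_pdivrMr// div1r.
  by near: n; exact: nbhs_infty_ger.
Unshelve. all: by end_near. Qed.

Lemma trivIset_sum_indic (F : nat -> set V) n x : trivIset setT F ->
  \sum_(i < n) (\1_(F i) x : R) = (\1_(\big[setU/set0]_(i < n) F i) x).
Proof.
move=> tF; elim: n => [|n IH]; first by rewrite !big_ord0 indic0.
rewrite !big_ord_recr /= {}IH !indicE in_setU.
have [xn|xn] := boolP (x \in F n); last by rewrite orbF addr0.
rewrite orbT memNset ?add0r// -bigcup_mkord => -[k /= kn Fk].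
have := tF k n Logic.I Logic.I; apply/not_implyP; split; last by move=> kE; move: kn; rewrite kE ltnn.
by exists x; split => //; exact: set_mem.
Qed.

(** Dynkin's pi-lambda argument: complements follow by subtraction from the whole space, disjoint
    unions by dominated convergence of the partial sums. *)
Lemma mollify_cvg_indic (A : set V) : measurable A -> mollify_cvg (\1_A : V -> R).
Proof.
move=> mA; have : <<s @open V >> A by rewrite -measurable_rV_open.
apply: (@dynkin_induction _ V open (fun A => mollify_cvg (\1_A : V -> R))).
- exact: measurable_rV_open.
- by move=> B C oB oC; exact: openI.
- by apply: mollify_cvg_open; exact: openT.
- by move=> B; exact: mollify_cvg_open.
- move=> S mS SC; have TC := mollify_cvg_open (@openT V).
  apply: eq_mollify_cvg (mollify_cvgB TC SC) => x _.
  rewrite !indicE in_setT in_setC; case: (_ \in S) => /=; ring.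
move=> F mF tF FC.
apply: mollify_cvg_lim; first by apply: L2_indic; exact: bigcupT_measurable.
pose g n x := \sum_(i < n) (\1_(F i) x : R).
have gC n : mollify_cvg (g n).
  elim: n => [|n IH].
    by apply: eq_mollify_cvg mollify_cvg_cst0 => x _; rewrite /g big_ord0.
  apply: eq_mollify_cvg (mollify_cvgD IH (FC n)) => x _.
  by rewrite /g big_ord_recr.
move=> eps eps0.
suff [n H] : exists n, norm (fun x => \1_(\bigcup_k F k) x - g n x) <= eps by exists (g n).
apply: (@L2_dominated _ g (fun=> 1)); last exact: eps0.
- by apply: L2_indic; exact: bigcupT_measurable.
- by move=> n; have [] := gC n.
- exact: L2_cst.
- move=> n x _; rewrite /g trivIset_sum_indic// !indicE.
  by case: (_ \in _); case: (_ \in _); rewrite ?subrr ?subr0 ?sub0r ?normrN ?normr1 ?normr0.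
- move=> x _; have [[k _ Fk]|nF] := pselect ((\bigcup_k F k) x).
    apply: cvg_near_cst; near=> n; rewrite /g trivIset_sum_indic// !indicE !mem_set//.
      by exists k.
    rewrite -bigcup_mkord; exists k => //=.
    by near: n; exact: nbhs_infty_gt.
  rewrite (_ : g ^~ x = fun=> \1_(\bigcup_k F k) x); first exact: cvg_cst.
  apply/funext => n; rewrite /g trivIset_sum_indic// !indicE !memNset//.
  by rewrite -bigcup_mkord => -[k _ Fk]; apply: nF; exists k.
Unshelve. all: by end_near. Qed.

Import HBNNSimple.

Lemma mollify_cvg_nnsfun (h : {nnsfun V >-> R}) : mollify_cvg h.
Proof.
rewrite (_ : (h : V -> R) =
  fun x => \sum_(y <- finmap.enum_fset (fset_set (range h))) y * \1_(h @^-1` [set y]) x); last first.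
  by apply/funext => x; rewrite fimfunE fsbig_finite//=; exact: fimfunP.
elim: (finmap.enum_fset _) => [|y s IH].
  by apply: eq_mollify_cvg mollify_cvg_cst0 => x _; rewrite big_nil.
apply: (@eq_mollify_cvg (fun x => y * \1_(h @^-1` [set y]) x +
    \sum_(y <- s) y * \1_(h @^-1` [set y]) x)).
  by move=> x _; rewrite big_cons.
apply: mollify_cvgD => //; apply: mollify_cvgZ; apply: mollify_cvg_indic.
exact: measurable_sfunP.
Qed.

(** Simple functions increase to f, and their distance to f is dominated by f itself. *)
Lemma mollify_cvg_ge0 f : L2 f -> (forall x, 0 <= f x) -> mollify_cvg f.
Proof.
move=> fL f0; apply: mollify_cvg_lim => // eps eps0.
have mf : measurable_fun Omega (EFin \o f) by apply/measurable_EFinP; exact: fL.1.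
have f0E x : Omega x -> (0 <= (EFin \o f) x)%E by move=> _; rewrite lee_fin.
pose g := nnsfun_approx mO mf.
suff [n H] : exists n, norm (fun x => f x - g n x) <= eps.
  by exists (g n) => //; exact: mollify_cvg_nnsfun.
apply: (@L2_dominated _ g f) => //.
- by move=> n; have [] := mollify_cvg_nnsfun (g n).
- move=> n x Ox; have : (g n x)%:E%E = (g n x)%:E by [].
  have := le_approx n f0E Ox; rewrite -(nnsfun_approxE mO mf) lee_fin => gf.
  have : 0 <= g n x by [].
  by rewrite ler_norml; move: gf; rewrite -/(g n) /=; have := f0 x; lra.
- move=> x Ox; have := cvg_nnsfun_approx mO mf f0E Ox.
  by move=> /fine_cvgP[_].
Qed.

Theorem mollify_cvg_L2 f : L2 f -> mollify_cvg f.
Proof.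
move=> fL.
have L2p : L2 (fun x => `|f x|).
  split; first by apply: measurableT_comp => //; exact: fL.1.
  by apply: eq_itg fL.2 => // x _; rewrite real_normK ?num_real.
have H1 : mollify_cvg (fun x => `|f x| + f x).
  apply: mollify_cvg_ge0; first exact: L2D.
  by move=> x; have := ler_norm (- f x); rewrite normrN; lra.
have H2 : mollify_cvg (fun x => `|f x|) by apply: mollify_cvg_ge0.
by apply: eq_mollify_cvg (mollify_cvgB H1 H2) => x _; ring.
Qed.

Lemma Rintegral_mollify_cvg u f : L2 u -> L2 f ->
  (fun n => int (fun x => u x * M n f x)) @ \oo --> int (fun x => u x * f x).
Proof.
move=> uL fL; have [_ fc] := mollify_cvg_L2 fL.
have fi := L2_itg mO Ooo fL.
apply/cvgrPdist_le => eps eps0.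
have n0 := L2norm_ge0 Omega u; have n1 : 0 < norm u + 1 by lra.
have [|N NP] := fc (eps / (norm u + 1)); first exact: divr_gt0.
exists N => // n /= /NP H; rewrite distrC.
have ML := L2_mollify mO Ooo (e_ n) (v_ n) fi.
rewrite -RintegralB//; [|exact: L2_mul_itg..].
under eq_Rintegral do rewrite -mulrBr.
rewrite (le_trans (L2_cauchy_schwarz mO _ _))//; first exact: L2B.
by move: H; rewrite ler_pdivlMr//; have := L2norm_ge0 Omega (fun x => M n f x - f x); nra.
Qed.

End mollify_cvg.

(** * Lipschitz domains *)

Section euclidean_theory.
Variables (R : realType) (d : nat).
Local Notation V := 'rV[R]_d.
Implicit Types (x y z e : V) (c t : R).

Lemma dotpDl x y z : dotp (x + y) z = dotp x z + dotp y z.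
Proof. by rewrite -big_split; apply: eq_bigr => i _; rewrite mxE mulrDl. Qed.

Lemma dotpZl c x y : dotp (c *: x) y = c * dotp x y.
Proof. by rewrite mulr_sumr; apply: eq_bigr => i _; rewrite mxE mulrA. Qed.

Lemma dotpC x y : dotp x y = dotp y x.
Proof. by apply: eq_bigr => i _; rewrite mulrC. Qed.

Lemma dotp_ge0 x : 0 <= dotp x x.
Proof. by apply: sumr_ge0 => i _; rewrite -expr2 sqr_ge0. Qed.

Lemma enorm_ge0 x : 0 <= enorm x. Proof. exact: sqrtr_ge0. Qed.

Lemma enorm_sqr x : enorm x ^+ 2 = dotp x x.
Proof. by rewrite sqr_sqrtr// dotp_ge0. Qed.

Lemma dotp_cauchy_schwarz x y : dotp x y <= enorm x * enorm y.
Proof.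
have H c : 0 <= enorm x ^+ 2 - 2 * c * dotp x y + c ^+ 2 * enorm y ^+ 2.
  have := dotp_ge0 (x + (- c) *: y).
  rewrite dotpDl (dotpC x) (dotpC (_ *: y)) !dotpDl !dotpZl (dotpC x (_ *: y)) dotpZl.
  by rewrite (dotpC y (_ *: y)) dotpZl (dotpC y x) !enorm_sqr; lra.
have := enorm_ge0 x; have := enorm_ge0 y.
move: (enorm x) (enorm y) (dotp x y) H => a b s H b0 a0.
have [b00|b00] := eqVneq b 0.
  subst b; rewrite mulr0 leNgt; apply/negP => s0.
  (* For b = 0 the expression in [H] is affine in c, and this c makes it negative. *)
  have := H ((a ^+ 2 + 1) / s).
  have -> : 2 * ((a ^+ 2 + 1) / s) * s = 2 * (a ^+ 2 + 1) by field; rewrite gt_eqF.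
  by rewrite expr0n mulr0; have := sqr_ge0 a; lra.
have {b0 b00}b0 : 0 < b by rewrite lt_def b00.
have := H (a / b).
have -> : a ^+ 2 - 2 * (a / b) * s + (a / b) ^+ 2 * b ^+ 2 = 2 * (a / b) * (a * b - s).
  by field; rewrite gt_eqF.
have [a00|a00] := eqVneq a 0; last first.
  have {a0 a00}a0 : 0 < a by rewrite lt_def a00.
  by rewrite pmulr_rge0 ?subr_ge0// mulr_gt0// divr_gt0.
subst a => _; rewrite mul0r leNgt; apply/negP => s0.
have := H (s / b ^+ 2).
have -> : 0 ^+ 2 - 2 * (s / b ^+ 2) * s + (s / b ^+ 2) ^+ 2 * b ^+ 2 = - (s ^+ 2 / b ^+ 2).
  by field; rewrite gt_eqF.
by rewrite oppr_ge0 leNgt divr_gt0// exprn_gt0.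
Qed.

Lemma norm_le_enorm x : `|x| <= enorm x.
Proof.
apply: rV_norm_le; first exact: enorm_ge0.
move=> i; rewrite -(@ler_pXn2r _ 2)// ?nnegrE ?enorm_ge0// enorm_sqr real_normK ?num_real//.
rewrite /dotp (bigD1 i)//= -expr2 lerDl; apply: sumr_ge0 => j _.
by rewrite -expr2 sqr_ge0.
Qed.

Lemma dotp_le_norm x y : `|dotp x y| <= d%:R * (`|x| * `|y|).
Proof.
rewrite (le_trans (ler_norm_sum _ _ _))//.
rewrite (le_trans (ler_sum _ (G := fun=> `|x| * `|y|) _))//.
  by move=> i _; rewrite normrM ler_pM// le_coord_norm.
by rewrite sumr_const card_ord mulr_natl.
Qed.

End euclidean_theory.

Section inward_cone.
Variables (R : realType) (d : nat) (Omega : set 'rV[R]_d).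
Local Notation V := 'rV[R]_d.

(** A cone condition uniform in y near x, with axis w and aperture k: a shift of length t along w
    tolerates any further error up to k t. *)
Definition inward_cone (x w : V) (r k : R) := forall y t z, Omega y -> `|y - x| < r ->
  0 < t < r -> `|z| <= k * t -> Omega (y + t *: w + z).

(** In the chart, a shift by t along e raises the height by t and leaves the graph function
    unchanged, while an error z changes the height above the graph by at most a fixed multiple of
    |z|. *)
Lemma lipschitz_inward_cone (x : V) : open Omega -> lipschitz_boundary Omega ->
  closure Omega x -> exists w r k,
  [/\ 0 < r, 0 < k, k <= 1, `|w| <= 1 & inward_cone x w r k].
Proof.
move=> oO lO cx; have [Ox|Ox] := pselect (Omega x).
  have [r r0 rO] := (openP_norm _).1 oO _ Ox.
  exists 0, (r / 2), 1; split => //; first by rewrite divr_gt0.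
    by rewrite normr0.
  move=> y t z Oy yx t0 zt; apply: rO; rewrite scaler0 addr0 distrC.
  rewrite addrAC (le_lt_trans (ler_normD _ _))//; lra.
have [e [gamma [e1 lg]]] := lO x (conj cx Ox).
move=> /nbhs_ballP[r /= r0 rP].
have [L [L0 gL]] : exists L, 0 <= L /\ forall a b, `|gamma a - gamma b| <= L * `|a - b|.
  case: lg => M [Mr H]; exists (`|M| + 1); split; first by rewrite addr_ge0.
  move=> a b; have := H (`|M| + 1); rewrite /= => /(_ _ (a, b)); apply => //.
  by rewrite (le_lt_trans (ler_norm _))// ltrDl.
have ne : `|e| <= 1 by rewrite -e1; exact: norm_le_enorm.
have ee : dotp e e = 1 by rewrite -enorm_sqr e1 expr1n.
(* L (1 + d) bounds the change of [gamma] under the component of z orthogonal to e, and d the change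
   of height; the factors d come from the inner product in the sup norm. The summand 1 ensures K >=
   1. *)
pose K : R := L * (1 + d%:R) + d%:R + 1.
have d0 : 0 <= d%:R :> R by [].
have K1 : 1 <= K by rewrite /K; nra.
have K0 : 0 < K by lra.
(* The distance from x to y, the shift and the error each use a third of the radius of the chart. *)
exists e, (r / 3), K^-1; split => //.
- by rewrite divr_gt0.
- by rewrite invr_gt0.
- by rewrite invf_le1.
move=> y t z Oy yx /andP[t0 tr] zt.
have tz : `|z| <= t.
  by rewrite (le_trans zt)// ler_piMl ?invf_le1// ltW.
have By : ball x r y by rewrite -ball_normE /ball_ /= distrC; lra.
have te : `|t *: e| <= t by rewrite normrZ gtr0_norm//; nra.
have By' : ball x r (y + t *: e + z).
  rewrite -ball_normE /ball_ /= distrC (addrAC _ z) (addrAC y).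
  rewrite (le_lt_trans (ler_normD _ _))//.
  by rewrite (le_lt_trans (lerD (ler_normD _ _) (lexx _)))//; lra.
apply/(rP _ By').2; have := (rP _ By).1 Oy.
set P := y - dotp y e *: e.
have -> : y + t *: e + z - dotp (y + t *: e + z) e *: e = P + (z - dotp z e *: e).
  rewrite !dotpDl dotpZl ee mulr1 /P; apply/rowP => j; rewrite !mxE; ring.
rewrite !dotpDl dotpZl ee mulr1 => H1.
have H2 := gL (P + (z - dotp z e *: e)) P.
have H3 : `|dotp z e| <= d%:R * `|z|.
  rewrite (le_trans (dotp_le_norm _ _))// ler_wpM2l// ler_piMr//.
have H4 : `|P + (z - dotp z e *: e) - P| <= (1 + d%:R) * `|z|.
  rewrite addrC addKr (le_trans (ler_normB _ _))// mulrDl mul1r lerD2l normrZ.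
  by have := normr_ge0 (dotp z e); nra.
have H5 := ler_wpM2l L0 H4.
have H6 : K * `|z| <= t by rewrite mulrC -ler_pdivlMr// mulrC.
have H7 := ler_norm (gamma (P + (z - dotp z e *: e)) - gamma P).
have H8 := ler_norm (- dotp z e); rewrite normrN in H8.
have := normr_ge0 z; rewrite /K in H6; lra.
Qed.

Lemma finite_ball_cover (K : set V) (s : V -> R) : compact K ->
  (forall x, K x -> 0 < s x) ->
  exists L : seq V, (forall c, c \in L -> K c) /\
    forall x, K x -> exists2 c, c \in L & `|x - c| < s c.
Proof.
rewrite compact_cover => cK s0.
have [|x Kx|D DK KD] := cK V K (fun c => [set x | `|x - c| < s c]).
- move=> c Kc; apply/openP_norm => x /= xc; exists (s c - `|x - c|); first lra.
  move=> y xy; rewrite -[y - c](subrKA x) (le_lt_trans (ler_normD _ _))//.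
  by rewrite distrC; lra.
- by exists x => //=; rewrite subrr normr0 s0.
exists (finmap.enum_fset D); split => [c /DK /set_mem//|x /KD[c cD cx]].
by exists c.
Qed.

End inward_cone.

(** * Partitions of unity *)

Section partition_of_unity.
Variables (R : realType) (d : nat).
Local Notation V := 'rV[R]_d.
Variable theta : nat -> V -> R.
Hypothesis theta_C11 : forall k, C11 (theta k).
Hypothesis theta_itv : forall k x, 0 <= theta k x <= 1.

(* A partition of unity on the set where some [theta k] equals 1. *)
Definition pou k x : R := theta k x * \prod_(j < k) (1 - theta j x).

Lemma pou_C11 k : C11 (pou k).
Proof.
apply: C11M; first exact: theta_C11.
apply: C11_prod => j; apply: C11D; first exact: C11_cst.
exact/C11N/theta_C11.
Qed.

Lemma pou_ge0 k x : 0 <= pou k x.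
Proof.
apply: mulr_ge0; first by case/andP: (theta_itv k x).
by apply: prodr_ge0 => j _; have := theta_itv j x; lra.
Qed.

(** The sum telescopes; its defect from 1 is a product that vanishes as soon as one [theta j] equals
    1. *)
Lemma sum_pou n x : \sum_(k < n) pou k x = 1 - \prod_(j < n) (1 - theta j x).
Proof.
elim: n => [|n IH]; first by rewrite !big_ord0 subrr.
by rewrite !big_ord_recr /= IH /pou; ring.
Qed.

Lemma sum_pou_le1 n x : \sum_(k < n) pou k x <= 1.
Proof.
rewrite sum_pou lerBlDr lerDl; apply: prodr_ge0 => j _.
by have := theta_itv j x; lra.
Qed.

Lemma sum_pou1 n x k : (k < n)%N -> theta k x = 1 -> \sum_(k < n) pou k x = 1.
Proof.
by move=> kn k1; rewrite sum_pou (bigD1 (Ordinal kn))//= k1 subrr mul0r subr0.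
Qed.

End partition_of_unity.

Lemma ae_le_Rintegral d0 (T : measurableType d0) (R : realType)
    (m : {measure set T -> \bar R}) (D : set T) (f g : T -> R) :
  measurable D -> m.-integrable D (fun x => (f x)%:E) ->
  m.-integrable D (fun x => (g x)%:E) ->
  {ae m, forall x, D x -> f x <= g x} ->
  \int[m]_(x in D) f x <= \int[m]_(x in D) g x.
Proof.
move=> mD fi gi fg; rewrite -subr_ge0 -RintegralB//.
have hi := itgB mD gi fi; have mh := measurable_int m hi.
rewrite /Rintegral (@ae_eq_integral _ _ _ m D (fun x => (`|g x - f x|)%:E))//.
- by apply: Rintegral_ge0.
- exact: (measurable_int m (integrable_norm hi)).
by apply: filterS fg => x fgx Dx; rewrite ger0_norm// subr_ge0 fgx.
Qed.

(** * Weak duality for fields with vanishing normal trace *)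

Section weak_duality.
Variables (R : realType) (d : nat) (Omega : set 'rV[R]_d).
Local Notation V := 'rV[R]_d.
Local Notation mu := (lebesgue_rV R d).
Hypothesis oO : open Omega.
Let mO : measurable Omega := open_measurable_rV oO.
Hypothesis bO : bounded_set Omega.
Implicit Types (f g u : V -> R) (c C e eps r t : R) (v x y w z : V).
Local Notation int f := (\int[mu]_(x in Omega) f x).
Local Notation norm := (L2norm Omega).
Local Notation L2 := (L2 Omega).

Lemma bounded_setP : exists M, forall x, Omega x -> `|x| <= M.
Proof.
move: bO => [M [Mr H]]; exists (M + 1) => x Ox.
by have := H (M + 1); rewrite /= => /(_ _ x); apply => //; rewrite ltrDl.
Qed.

Lemma lebesgue_bounded : (mu Omega < +oo)%E.
Proof. by have [M MO] := bounded_setP; exact: lebesgue_rV_bounded MO. Qed.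

Let Ooo := lebesgue_bounded.

Lemma wdiv_L2 (q : V -> V) : Hdiv Omega q -> L2 (wdiv Omega q).
Proof.
move=> [_ [w wd]]; rewrite /wdiv.
by have [] := @xgetPex _ (fun=> 0) [set w | is_weak_div Omega q w] (ex_intro _ w wd).
Qed.

(** The kernel, as a function of y, is C^1 on the whole space, hence a legitimate test function for
    the vanishing normal trace even when its support crosses the boundary. Its derivatives in x and
    in y are opposite, so Green's formula is the claim, for every x. *)
Lemma div_mollify (q : V -> V) e v x : HN Omega q ->
  \sum_i pderiv i (mollify Omega e v (fun y => q y 0 i)) x =
  mollify Omega e v (wdiv Omega q) x.
Proof.
move=> [hq nt]; have wL := wdiv_L2 hq; have qL := hq.1.
have qi i := L2_itg mO Ooo (qL i).
have [C mC] := mollifier_C11 d e.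
have phiw := C11w_refl (x - v) mC.
have phiC := C11I phiw.
have gi i y := C11w_deriv_bound i y phiw.
have mg i : measurable_fun Omega (fun y => pderiv i (@mollifier R d e) (x - y - v)).
  apply: (eq_measurable_fun (fun y => - pderiv i (fun y => mollifier e (x - v - y)) y)).
    by move=> y _; rewrite (C11w_pderiv i y phiw) opprK addrAC.
  by apply: measurable_funN; exact: C11_pderiv_measurable.
have := nt _ (C11_Ck1 phiC).
have I1 i : mu.-integrable Omega
    (fun y => (q y 0 i * pderiv i (@mollifier R d e) (x - y - v))%:E).
  apply: (@itgM_bounded _ _ _ mu _ mO _ _ C) => // y _.
  by have := gi i y; rewrite normrN addrAC.
have I2 : mu.-integrable Omega (fun y => (wdiv Omega q y * mollifier e (x - y - v))%:E).
  by apply: itg_mollify => //; exact: L2_itg.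
rewrite (_ : Rintegral _ _ _ = int (fun y => wdiv Omega q y * mollifier e (x - y - v) -
   \sum_i q y 0 i * pderiv i (@mollifier R d e) (x - y - v))); last first.
  apply: eq_Rintegral => y _; rewrite addrC (addrAC x); congr (_ + _).
  rewrite /dotp -sumrN; apply: eq_bigr => i _.
  by rewrite mxE (C11w_pderiv i y phiw) mulrN (addrAC x).
rewrite RintegralB//; last by apply: itg_sum.
rewrite Rintegral_sum// => /eqP; rewrite subr_eq0 => /eqP wE.
rewrite /mollify wE; apply: eq_bigr => i _.
exact: pderiv_mollify.
Qed.

(* Jensen's inequality in the vector-valued form needed to keep |Phi| <= 1. *)
Lemma dotp_mollify_le (q : V -> V) e v x (a : V) : 0 < e -> L2vec Omega q ->
  unit_ball_ae Omega q ->
  \sum_i a 0 i * mollify Omega e v (fun y => q y 0 i) x <= enorm a.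
Proof.
move=> e0 qL q1; have qi i := L2_itg mO Ooo (qL i).
pose k y := mollifier e (x - y - v).
have ki : mu.-integrable Omega (fun y => (k y)%:E).
  by apply: integrableS (itgT_mollifier v x e0).
have qki i : mu.-integrable Omega (fun y => (q y 0 i * k y)%:E) by exact: itg_mollify.
have aqki i : mu.-integrable Omega (fun y => (a 0 i * (q y 0 i * k y))%:E) by exact: itgZ.
have I1 : mu.-integrable Omega (fun y => (\sum_i a 0 i * (q y 0 i * k y))%:E).
  by apply: itg_sum.
rewrite (_ : \sum_i _ = int (fun y => \sum_i a 0 i * (q y 0 i * k y))); last first.
  rewrite Rintegral_sum//.
  by apply: eq_bigr => i _; rewrite RintegralZl//; exact: qki.
apply: (@le_trans _ _ (int (fun y => enorm a * k y))).
  apply: ae_le_Rintegral => //; first exact: itgZ.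
  apply: filterS q1 => y qy Oy.
  have k0 : 0 <= k y by exact: mollifier_ge0.
  rewrite (_ : \sum_i _ = dotp a (q y) * k y); last first.
    by rewrite mulr_suml; apply: eq_bigr => i _; rewrite mulrA.
  rewrite ler_wpM2r// (le_trans (dotp_cauchy_schwarz _ _))//.
  by have := qy Oy; have := enorm_ge0 a; nra.
rewrite RintegralZl//.
have := Rintegral_mollifier_le1 mO v x e0; rewrite -/k.
by have := enorm_ge0 a; rewrite /k; nra.
Qed.

End weak_duality.

(** * Admissible test fields built from q *)

Section weak_duality_theorem.
Variables (R : realType) (d : nat) (Omega : set 'rV[R]_d).
Local Notation V := 'rV[R]_d.
Local Notation mu := (lebesgue_rV R d).
Hypothesis oO : open Omega.
Let mO : measurable Omega := open_measurable_rV oO.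
Hypothesis bO : bounded_set Omega.
Let Ooo : (mu Omega < +oo)%E := lebesgue_bounded oO bO.
Implicit Types (f g u : V -> R) (c C e eps r t : R) (v x y w z : V).
Local Notation int f := (\int[mu]_(x in Omega) f x).
Local Notation norm := (L2norm Omega).
Local Notation L2 := (L2 Omega).

Lemma pderiv_locally_cst f x i (a : R) : Omega x ->
  (forall y, Omega y -> f y = a) -> pderiv i f x = 0.
Proof.
move=> Ox fa; rewrite -(@pderiv_cst R d a i x); apply: near_eq_derive.
by apply: filterS (open_nbhs_nbhs (conj oO Ox)) => y; exact: fa.
Qed.

Lemma enormN x : enorm (- x) = enorm x.
Proof. by congr Num.sqrt; apply: eq_bigr => i _; rewrite !mxE mulrNN. Qed.

Lemma finite_lower_bound (I : eqType) (s : seq I) (h : I -> R) :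
  (forall i, i \in s -> 0 < h i) -> exists2 m : R, 0 < m & forall i, i \in s -> m <= h i.
Proof.
elim: s => [_|i s IH hs]; first by exists 1.
have [j js|m m0 mP] := IH; first by apply: hs; rewrite inE js orbT.
exists (Num.min m (h i)); first by rewrite lt_min m0 hs// inE eqxx.
move=> j; rewrite inE => /predU1P[->|/mP mj]; first by rewrite ge_min lexx orbT.
by rewrite ge_min mj.
Qed.

(* Near each boundary point, q is shifted into Omega along the chart direction
   before it is mollified, which makes the support compact in Omega. *)
Definition mollified_field N (chi : nat -> V -> R) (e_ : nat -> R) (v_ : nat -> V)
    (q : V -> V) (x : V) : V :=
  \row_i \sum_(k < N) chi k x * mollify Omega (e_ k) (v_ k) (fun y => q y 0 i) x.

Lemma mollified_field_C11 N (chi : nat -> V -> R) (e_ : nat -> R) (v_ : nat -> V)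
    (q : V -> V) i : (forall k, C11 (chi k)) -> L2vec Omega q ->
  C11 (fun x => mollified_field N chi e_ v_ q x 0 i).
Proof.
move=> chiC qL; rewrite (_ : (fun x => _) = fun x => \sum_(k < N)
   chi k x * mollify Omega (e_ k) (v_ k) (fun y => q y 0 i) x).
  by apply: C11_sum => k; apply: C11M => //; apply: C11_mollify => //; exact: L2_itg.
by apply/funext => x; rewrite mxE.
Qed.

Lemma cdiv_mollified_field N (chi : nat -> V -> R) (e_ : nat -> R) (v_ : nat -> V)
    (q : V -> V) x : (forall k, C11 (chi k)) -> HN Omega q ->
  cdiv (mollified_field N chi e_ v_ q) x =
  \sum_(k < N) (\sum_i pderiv i (chi k) x * mollify Omega (e_ k) (v_ k) (fun y => q y 0 i) x
    + chi k x * mollify Omega (e_ k) (v_ k) (wdiv Omega q) x).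
Proof.
move=> chiC qN; have qL := qN.1.1.
have qi i := L2_itg mO Ooo (qL i).
transitivity (\sum_i \sum_(k < N)
    (pderiv i (chi k) x * mollify Omega (e_ k) (v_ k) (fun y => q y 0 i) x +
     chi k x * pderiv i (mollify Omega (e_ k) (v_ k) (fun y => q y 0 i)) x)).
  apply: eq_bigr => i _.
  rewrite (_ : (fun y => _) = fun x => \sum_(k < N)
     chi k x * mollify Omega (e_ k) (v_ k) (fun y => q y 0 i) x); last first.
    by apply/funext => y; rewrite mxE.
  rewrite pderiv_C11_sum; last by move=> k; apply: C11M => //; exact: C11_mollify.
  by apply: eq_bigr => k _; rewrite pderiv_C11M//; exact: C11_mollify.
rewrite exchange_big /=; apply: eq_bigr => k _; rewrite big_split /=; congr (_ + _).
by rewrite -mulr_sumr div_mollify.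
Qed.

(** The value a is paired with itself: |a|^2 is a combination, with weights - [chi] of sum at most
    1, of pairings of - a with mollifications of q, each at most |a|. Hence |a|^2 <= |a|. *)
Lemma enorm_mollified_field N (chi : nat -> V -> R) (e_ : nat -> R) (v_ : nat -> V)
    (q : V -> V) x : (forall k, (k < N)%N -> 0 < e_ k) ->
  (forall k x, 0 <= - chi k x) -> \sum_(k < N) - chi k x <= 1 ->
  L2vec Omega q -> unit_ball_ae Omega q ->
  enorm (mollified_field N chi e_ v_ q x) <= 1.
Proof.
move=> e0 chi0 chi1 qL q1; set a := mollified_field _ _ _ _ _ _.
have aE i : a 0 i = \sum_(k < N) chi k x *
  mollify Omega (e_ k) (v_ k) (fun y => q y 0 i) x by rewrite mxE.
have : dotp a a <= enorm a.
  apply: (@le_trans _ _ (\sum_(k < N) - chi k x *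
      \sum_i (- a) 0 i * mollify Omega (e_ k) (v_ k) (fun y => q y 0 i) x)).
    rewrite le_eqVlt; apply/orP; left; apply/eqP.
    under [in RHS]eq_bigr do rewrite mulr_sumr.
    rewrite exchange_big /=; apply: eq_bigr => i _.
    transitivity (a 0 i * \sum_(k < N) chi k x *
        mollify Omega (e_ k) (v_ k) (fun y => q y 0 i) x); first by rewrite -aE.
    rewrite mulr_sumr; apply: eq_bigr => k _.
    have -> : (- a) 0 i = - a 0 i by rewrite [LHS]mxE.
    ring.
  apply: (@le_trans _ _ (\sum_(k < N) - chi k x * enorm a)).
    apply: ler_sum => k _; rewrite ler_wpM2l//.
    rewrite -(enormN a); apply: dotp_mollify_le => //; exact: e0.
  rewrite -mulr_suml; have := enorm_ge0 a; nra.
rewrite -enorm_sqr; have := enorm_ge0 a => a0.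
by move=> H; rewrite leNgt; apply/negP => a1; nra.
Qed.

(** eta is a uniform margin around the points where the field is nonzero, which places the closure
    of this set in Omega as well. Such a point x sees a point y of Omega with |x - y - v| < e, for
    otherwise its mollified values vanish. *)
Lemma compact_supp_mollified_field N (chi : nat -> V -> R) (e_ : nat -> R)
    (v_ : nat -> V) (q : V -> V) (eta : R) : 0 < eta ->
  (forall k x y z, (k < N)%N -> chi k x != 0 -> Omega y -> `|x - y - v_ k| < e_ k ->
     `|x - z| < eta -> Omega z) ->
  (forall k, (k < N)%N -> 0 < e_ k) ->
  compact_supp_in Omega (mollified_field N chi e_ v_ q).
Proof.
move=> eta0 H e0.
have S : supp (mollified_field N chi e_ v_ q) `<=` Omega.
  move=> z /(_ _ (nbhsx_ballx z _ eta0))[x [/= Phix]].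
  rewrite -ball_normE /ball_ /= distrC => xz.
  have [i Phii] : exists i, mollified_field N chi e_ v_ q x 0 i != 0.
    apply: contrapT => /forallNP Phi0; apply: Phix; apply/rowP => i; rewrite [RHS]mxE.
    by apply/eqP/negPn/negP; exact: Phi0.
  have [k] : exists k : 'I_N,
      chi k x * mollify Omega (e_ k) (v_ k) (fun y => q y 0 i) x != 0.
    apply: contrapT => /forallNP chi0; move: Phii; rewrite mxE big1 ?eqxx// => k _.
    by apply/eqP/negPn/negP; exact: chi0.
  rewrite mulf_eq0 negb_or => /andP[chik Mk].
  have [[y [Oy yx]]|ny] := pselect (exists y, Omega y /\ `|x - y - v_ k| < e_ k).
    exact: (H k x y z).
  move: Mk; rewrite /mollify (_ : Rintegral _ _ _ = 0) ?eqxx//.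
  transitivity (int (fun=> 0)); last by rewrite Rintegral_cst// mul0r.
  apply: eq_Rintegral => y /set_mem Oy.
  rewrite mollifier_out ?mulr0 ?e0// leNgt; apply/negP => yx; apply: ny.
  by exists y.
split => //; apply: bounded_closed_compact; last exact: closed_closure.
move: bO => [M [Mr HM]]; exists M; split => // c Mc z /S Oz.
exact: (HM c Mc).
Qed.

(* The fields [mollified_field] are admissible in the definition of TV, and
   their divergences converge weakly in L2 to - div q. *)
Theorem weak_duality (q : V -> V) u : lipschitz_boundary Omega -> HN Omega q ->
  unit_ball_ae Omega q -> L2 u ->
  ((- int (fun x => u x * wdiv Omega q x))%:E <= TV Omega u)%E.
Proof.
move=> lO qN q1 uL; have qL := qN.1.1; have wL := wdiv_L2 qN.1.
have cK : compact (closure Omega).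
  apply: bounded_closed_compact; last exact: closed_closure.
  have [M MO] := bounded_setP bO; exists M; split; first exact: num_real.
  move=> c Mc z; have cM : closed [set z : V | `|z| <= M].
    rewrite (_ : [set z : V | _] = closed_ball_ Num.norm (0 : V) M).
      exact: closed_closed_ball_.
    by apply/seteqP; split => y /=; rewrite /closed_ball_ /= sub0r normrN.
  move=> cz; apply: (le_trans _ (ltW Mc)).
  have : closure [set z : V | `|z| <= M] z by apply: closure_subset cz => y; exact: MO.
  by move/closure_id: cM => <-.
have /choice[F FP] : forall x, exists p : V * R * R, closure Omega x ->
    [/\ 0 < p.1.2, 0 < p.2, p.2 <= 1, `|p.1.1| <= 1 & inward_cone Omega x p.1.1 p.1.2 p.2].
  move=> x; have [cx|cx] := pselect (closure Omega x); last by exists (0, 0, 0).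
  by have [w [r [k H]]] := lipschitz_inward_cone oO lO cx; exists (w, r, k).
(* A plateau of size s is supported within 2 s = r / 2 of its centre; the other half of the radius r
   of the cone condition is left for shift and mollification. *)
pose s x : R := (F x).1.2 / 4.
have s0 x : closure Omega x -> 0 < s x.
  by move=> /FP[r0 _ _ _ _]; rewrite /s divr_gt0.
have [L [LK KL]] := finite_ball_cover cK s0.
pose N := size L; pose c k := nth 0 L k.
have cP k : (k < N)%N -> closure Omega (c k) by move=> kN; apply: LK; exact: mem_nth.
(* With t <= r / 16 and e <= t / 2, the point y at which q is sampled lies within 2 s + e + t < r of
   the centre. *)
have [t0 t00 t0P] : exists2 t0 : R, 0 < t0 & forall x, x \in L -> t0 <= (F x).1.2 / 16.
  by apply: finite_lower_bound => x /LK cx; have [a _ _ _ _] := FP _ cx; rewrite divr_gt0.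
pose t n : R := t0 / n.+1%:R.
have tpos n : 0 < t n by rewrite divr_gt0.
have tle n : t n <= t0 by rewrite ler_pdivrMr// ler_peMr ?ler1n// ltW.
pose theta k := plateau (c k) (s (c k)).
have thC k : C11 (theta k) by exact: plateau_C11.
have th01 k x : 0 <= theta k x <= 1 by exact: plateau_itv.
(* The sign is that of the claim: the fields approximate - q, so that their divergences tend to -
   div q. *)
pose chi k x := - pou theta k x.
have chiC k : C11 (chi k) by apply: C11N; exact: pou_C11.
have chi0 k x : 0 <= - chi k x by rewrite opprK; exact: pou_ge0.
(* Half of the error k t tolerated by the cone goes to the mollification, the other half to the
   margin eta around the support. *)
pose e_ n k : R := (F (c k)).2 * t n / 2.
pose v_ n k : V := t n *: (F (c k)).1.1.
have e0 n k : (k < N)%N -> 0 < e_ n k.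
  by move=> /cP /FP[_ k0 _ _ _]; rewrite /e_ divr_gt0// mulr_gt0.
pose Phi n := mollified_field N chi (e_ n) (v_ n) q.
have PhiP n : [/\ forall i, Ck 1 (fun x => Phi n x 0 i), compact_supp_in Omega (Phi n)
    & forall x, enorm (Phi n x) <= 1].
  split.
  - by move=> i; apply: C11_Ck1; exact: mollified_field_C11.
  - have [eta eta0 etaP] : exists2 m : R, 0 < m & forall k, k \in iota 0 N -> m <= e_ n k.
      by apply: finite_lower_bound => k; rewrite mem_iota => /andP[_ kN]; exact: e0.
    apply: (@compact_supp_mollified_field N chi (e_ n) (v_ n) q eta) => //; last exact: e0.
    move=> k x y z kN chik Oy xyv xz.
    have [r0 k0 k1 w1 IC] := FP _ (cP _ kN).
    have tc : t n <= (F (c k)).1.2 / 16.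
      by rewrite (le_trans (tle n))// t0P// mem_nth.
    have ek : eta <= e_ n k by apply: etaP; rewrite mem_iota.
    have xc : `|x - c k| < 2 * s (c k).
      rewrite ltNge; apply/negP => xc; move: chik.
      rewrite /chi /pou /theta plateau0 ?mul0r ?oppr0 ?eqxx//.
      by apply: s0; exact: cP.
    have et : e_ n k <= t n / 2.
      by rewrite /e_ ler_wpM2r// ler_piMl// ltW.
    have vt : `|v_ n k| <= t n.
      by rewrite normrZ gtr0_norm// ler_piMr// ltW.
    have -> : z = y + t n *: (F (c k)).1.1 + (z - y - v_ n k).
      by apply/rowP => j; rewrite /v_ !mxE; ring.
    apply: IC => //.
    + rewrite (_ : y - c k = (x - c k) - (x - y - v_ n k) - v_ n k); last first.
        by apply/rowP => j; rewrite !mxE; ring.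
      rewrite (le_lt_trans (ler_normB _ _))//.
      rewrite (le_lt_trans (lerD (ler_normB _ _) (lexx _)))//.
      rewrite /s in xc; lra.
    + by rewrite tpos /=; lra.
    + rewrite (_ : z - y - v_ n k = (x - y - v_ n k) - (x - z)); last first.
        by apply/rowP => j; rewrite !mxE; ring.
      rewrite (le_trans (ler_normB _ _))//.
      have : e_ n k + e_ n k = (F (c k)).2 * t n by rewrite /e_; field.
      lra.
  - move=> x; apply: enorm_mollified_field => //; first exact: e0.
    by under eq_bigr do rewrite opprK; exact: sum_pou_le1.
have TVn n : ((int (fun x => u x * cdiv (Phi n) x))%:E <= TV Omega u)%E.
  by apply: ereal_sup_ubound; exists (Phi n).
have ev k eps : (k < N)%N -> 0 < eps ->
    exists M, forall n, (M <= n)%N -> `|v_ n k| + e_ n k <= eps.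
  move=> kN eps0; have [r0 k0 k1 w1 _] := FP _ (cP _ kN).
  have h0 : 0 < eps / (2 * t0) by rewrite divr_gt0// mulr_gt0.
  have [M _ MP] := near_infty_natSinv_lt (PosNum h0).
  exists M => n /MP /=; rewrite ltr_pdivlMr ?mulr_gt0// => H.
  have vt : `|v_ n k| <= t n by rewrite normrZ gtr0_norm// ler_piMr// ltW.
  have et : e_ n k <= t n / 2 by rewrite /e_ ler_wpM2r// ler_piMl// ltW.
  have tE : n.+1%:R^-1 * (2 * t0) = 2 * t n by rewrite /t; ring.
  rewrite tE in H; move: H vt et (tpos n).
  move: (t n) (e_ n k) `|v_ n k| => a b c' H1 H2 H3 H4; lra.
have cv : (fun n => int (fun x => u x * cdiv (Phi n) x)) @ \oo -->
    - int (fun x => u x * wdiv Omega q x).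
  have bchi k : exists C, (forall x, `|chi k x| <= C) /\
      forall i x, `|pderiv i (chi k) x| <= C.
    have [C CP] := chiC k; exists C; split; first by case: CP.
    by move=> i x; exact: (C11w_deriv_bound i x CP).
  have uchiL k : L2 (fun x => u x * chi k x).
    have [C [C1 _]] := bchi k.
    by apply: (@L2M_bounded _ _ _ mO _ _ C) => //; exact: C11_measurable.
  have udchiL k i : L2 (fun x => u x * pderiv i (chi k) x).
    have [C [_ C1]] := bchi k.
    by apply: (@L2M_bounded _ _ _ mO _ _ C) => //; exact: C11_pderiv_measurable.
  have qi i := L2_itg mO Ooo (qL i).
  pose A n (k : 'I_N) : R := \sum_i int (fun x => (u x * pderiv i (chi k) x) *
      mollify Omega (e_ n k) (v_ n k) (fun y => q y 0 i) x) +
    int (fun x => (u x * chi k x) * mollify Omega (e_ n k) (v_ n k) (wdiv Omega q) x).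
  have I1 n (k : 'I_N) i : mu.-integrable Omega (fun x => ((u x * pderiv i (chi k) x) *
      mollify Omega (e_ n k) (v_ n k) (fun y => q y 0 i) x)%:E).
    by apply: L2_mul_itg => //; exact: L2_mollify.
  have I2 n (k : 'I_N) : mu.-integrable Omega (fun x => ((u x * chi k x) *
      mollify Omega (e_ n k) (v_ n k) (wdiv Omega q) x)%:E).
    by apply: L2_mul_itg => //; apply: L2_mollify => //; exact: L2_itg.
  have I3 n (k : 'I_N) : mu.-integrable Omega (fun x => (\sum_i (u x * pderiv i (chi k) x) *
      mollify Omega (e_ n k) (v_ n k) (fun y => q y 0 i) x)%:E).
    by apply: itg_sum.
  have AE n : int (fun x => u x * cdiv (Phi n) x) = \sum_(k < N) A n k.
    transitivity (int (fun x => \sum_(k < N) (\sum_i (u x * pderiv i (chi k) x) *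
      mollify Omega (e_ n k) (v_ n k) (fun y => q y 0 i) x +
      (u x * chi k x) * mollify Omega (e_ n k) (v_ n k) (wdiv Omega q) x))).
      apply: eq_Rintegral => x _; rewrite cdiv_mollified_field// mulr_sumr.
      apply: eq_bigr => k _; rewrite mulrDr mulrA; congr (_ + _).
      by rewrite mulr_sumr; apply: eq_bigr => i _; rewrite mulrA.
    rewrite Rintegral_sum//; last by move=> k _; apply: itgD => //; exact: I3.
    apply: eq_bigr => k _; rewrite RintegralD//; [|exact: I3|exact: I2].
    by rewrite Rintegral_sum.
  rewrite (_ : (fun n => _) = (fun n => \sum_(k < N) A n k)); last exact/funext.
  rewrite (_ : - _ = \sum_(k < N)
    (\sum_i int (fun x => (u x * pderiv i (chi k) x) * q x 0 i) +
     int (fun x => (u x * chi k x) * wdiv Omega q x))).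
    apply: cvg_big => [|k _]; first exact: add_continuous.
    apply: cvgD.
      apply: cvg_big => [|i _]; first exact: add_continuous.
      apply: Rintegral_mollify_cvg => //; [by move=> n; exact: e0|by move=> eps; exact: ev].
    apply: Rintegral_mollify_cvg => //; [by move=> n; exact: e0|by move=> eps; exact: ev].
  have J1 (k : 'I_N) i : mu.-integrable Omega
      (fun x => ((u x * pderiv i (chi k) x) * q x 0 i)%:E) by exact: L2_mul_itg.
  have J2 (k : 'I_N) : mu.-integrable Omega
      (fun x => ((u x * chi k x) * wdiv Omega q x)%:E) by exact: L2_mul_itg.
  have J3 (k : 'I_N) : mu.-integrable Omega
      (fun x => (\sum_i (u x * pderiv i (chi k) x) * q x 0 i)%:E).
    by apply: itg_sum.
  have J (k : 'I_N) : mu.-integrable Omega (fun x => (\sum_i (u x * pderiv i (chi k) x) * q x 0 i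
      + (u x * chi k x) * wdiv Omega q x)%:E).
    by apply: itgD => //; exact: J3.
  transitivity (int (fun x => \sum_(k < N) (\sum_i (u x * pderiv i (chi k) x) * q x 0 i
      + (u x * chi k x) * wdiv Omega q x))); last first.
    rewrite Rintegral_sum//; apply: eq_bigr => k _.
    rewrite RintegralD//; [|exact: J3|exact: J2].
    by rewrite Rintegral_sum.
  rewrite -RintegralN//; last exact: L2_mul_itg.
  (* Every point of Omega is within s of some centre, and the plateau around that centre equals 1
     there. *)
  have sum1 y : Omega y -> \sum_(k < N) chi k y = -1.
    move=> /subset_closure /KL[x /[dup] xL /(nthP 0)[k kN kx] xs].
    rewrite sumrN; congr (- _); apply: (@sum_pou1 _ _ theta N y k) => //.
    rewrite /theta /c kx plateau1//; last exact: ltW.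
    by apply: s0; exact: LK.
  apply: eq_Rintegral => x /set_mem Ox.
  rewrite big_split /= exchange_big /= -mulr_suml -mulr_sumr sum1//.
  (* In the limit every weight multiplies the same q, so only the derivative of the sum of the
     weights remains, and this sum is constant on the open set Omega. *)
  rewrite big1 ?add0r ?mulrN1 ?mulNr// => i _.
  rewrite -mulr_suml -mulr_sumr -pderiv_C11_sum//.
  by rewrite (@pderiv_locally_cst _ x i (-1))// mulr0 mul0r.
case: (TV Omega u) TVn => [r| |] TVn; last first.
- by have := TVn 0%N; rewrite leeNy_eq.
- by rewrite leey.
rewrite lee_fin; apply: (cvgr_to_le cv).
by apply: nearW => n; rewrite -lee_fin.
Qed.

End weak_duality_theorem.

(** * Simplices *)

Section simplices.
Variables (R : realType) (d : nat).
Local Notation V := 'rV[R]_d.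
Local Notation mu := (lebesgue_rV R d).
Implicit Types (x y : V) (P : 'I_d.+1 -> V).

Definition affine_fun (a : 'I_d -> R) (b : R) x : R := b + \sum_i a i * x 0 i.

Lemma affine_funD a b x y : affine_fun a b (x + y) = affine_fun a b x + \sum_i a i * y 0 i.
Proof.
rewrite /affine_fun -addrA -big_split; congr (_ + _).
by apply: eq_bigr => i _; rewrite mxE mulrDr.
Qed.

Lemma affine_fun_lipschitz a b : exists2 C, 0 <= C &
  forall x y, `|affine_fun a b x - affine_fun a b y| <= C * `|x - y|.
Proof.
exists (\sum_i `|a i|); first by apply: sumr_ge0.
move=> x y; have -> : affine_fun a b x - affine_fun a b y = \sum_i a i * (x - y) 0 i.
  rewrite /affine_fun opprD addrACA subrr add0r -sumrB.
  by apply: eq_bigr => i _; rewrite !mxE mulrBr.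
rewrite (le_trans (ler_norm_sum _ _ _))// mulr_suml; apply: ler_sum => i _.
by rewrite normrM ler_wpM2l// le_coord_norm.
Qed.

Lemma affine_fun_continuous a b : continuous (affine_fun a b).
Proof. by have [C _] := affine_fun_lipschitz a b; exact: lipschitz_continuous_rV. Qed.

Lemma affine_fun_segment a b x y t :
  affine_fun a b (x + t *: (y - x)) = (1 - t) * affine_fun a b x + t * affine_fun a b y.
Proof.
rewrite affine_funD.
have -> : \sum_i a i * (t *: (y - x)) 0 i = t * (affine_fun a b y - affine_fun a b x).
  rewrite /affine_fun opprD addrACA subrr add0r -sumrB mulr_sumr.
  by apply: eq_bigr => i _; rewrite !mxE; ring.
ring.
Qed.

(** A multi-index of total degree at most 1 is zero or a single 1, so each monomial is a constant or
    a coordinate. *)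
Lemma poly_le1_affine (f : V -> R) : poly_le 1 f -> exists a b, f = affine_fun a b.
Proof.
move=> [c fE].
have mono (m : {ffun 'I_d -> 'I_2}) : (\sum_i m i <= 1)%N ->
    exists a b, forall x : V, \prod_i x 0 i ^+ m i = affine_fun a b x.
  move=> m1; have [[i mi]|m0] := pselect (exists i, m i != 0%N :> nat).
    exists (fun j => (j == i)%:R), 0 => x.
    rewrite /affine_fun add0r (bigD1 i)//= [RHS](bigD1 i)//= eqxx mul1r.
    have mi1 : m i = 1%N :> nat by case: (m i) mi => -[|[|]].
    rewrite mi1 expr1 big1 => [|j ji]; last first.
      move: m1; rewrite (bigD1 i)//= mi1 (bigD1 j)//= add1n ltnS leqn0 addn_eq0.
      by case/andP => /eqP -> _; rewrite expr0.
    by rewrite big1 ?addr0 ?mulr1// => j /negbTE ->; rewrite mul0r.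
  exists (fun=> 0), 1 => x; rewrite /affine_fun [\sum_i _]big1 ?addr0 => [|i _]; last by rewrite mul0r.
  rewrite big1// => i _; have -> : m i = 0%N :> nat; last by rewrite expr0.
  by apply/eqP/negPn/negP => mi; apply: m0; exists i.
have sumP (r : seq {ffun 'I_d -> 'I_2}) : exists a b, forall x : V,
    \sum_(m <- r | (\sum_i m i <= 1)%N) c m * \prod_i x 0 i ^+ m i = affine_fun a b x.
  elim: r => [|m r [a [b IH]]].
    exists (fun=> 0), 0 => x; rewrite big_nil /affine_fun add0r big1// => i _.
    by rewrite mul0r.
  have [m1|m1] := boolP (\sum_i m i <= 1)%N; last first.
    by exists a, b => x; rewrite big_cons (negbTE m1).
  have [a' [b' mE]] := mono m m1.
  exists (fun i => c m * a' i + a i), (c m * b' + b) => x.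
  rewrite big_cons m1 mE IH /affine_fun.
  rewrite mulrDr mulr_sumr addrACA -big_split /=; congr (_ + _).
  by apply: eq_bigr => i _; ring.
have [a [b E]] := sumP (index_enum _).
by exists a, b; apply/funext => x; rewrite fE E.
Qed.

(** Affine independence says that the square matrix with rows (1, P_i) is invertible; the
    coordinates are the entries of (1, x) times its inverse, hence affine in x. *)
Lemma barycentric P : aff_indep P -> exists a b,
  (forall x, \sum_i affine_fun (a i) (b i) x = 1) /\
  (forall x, x = \sum_i affine_fun (a i) (b i) x *: P i).
Proof.
move=> Pi.
pose M : 'M[R]_(d.+1, 1 + d) := \matrix_(i, j) (row_mx (const_mx 1 : 'rV_1) (P i)) 0 j.
have M0 i : M i (lshift d (0 : 'I_1)) = 1 by rewrite mxE row_mxEl mxE.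
have MS i j : M i (rshift 1 j) = P i 0 j by rewrite mxE row_mxEr.
have fM : row_free M.
  apply: inj_row_free => v vM.
  have E j : \sum_i v 0 i * M i j = 0 by have := congr1 (fun A : 'rV[R]_(1 + d) => A 0 j) vM; rewrite !mxE.
  apply/rowP => i; rewrite mxE; apply: (Pi (fun i => v 0 i)).
    by have := E (lshift d (0 : 'I_1)); under eq_bigr do rewrite M0 mulr1.
  apply/rowP => j; rewrite summxE mxE -[RHS](E (rshift 1 j)).
  by apply: eq_bigr => k _; rewrite mxE MS.
have uM : M \in unitmx by rewrite -row_free_unit.
pose L x := row_mx (const_mx 1 : 'rV_1) x *m invmx M.
have LM x : L x *m M = row_mx (const_mx 1 : 'rV_1) x by rewrite mulmxKV.
pose a i j := invmx M (rshift 1 j) i; pose b i := invmx M (lshift d (0 : 'I_1)) i.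
have LE x i : L x 0 i = affine_fun (a i) (b i) x.
  rewrite /L mxE big_split_ord /= /affine_fun; congr (_ + _).
    by rewrite big_ord1 row_mxEl mxE mul1r.
  by apply: eq_bigr => j _; rewrite row_mxEr mulrC.
exists a, b; split => x.
  have := congr1 (fun A : 'rV[R]_(1 + d) => A 0 (lshift d (0 : 'I_1))) (LM x).
  rewrite mxE row_mxEl mxE => <-; apply: eq_bigr => i _.
  by rewrite M0 mulr1 LE.
apply/rowP => j; have := congr1 (fun A : 'rV[R]_(1 + d) => A 0 (rshift 1 j)) (LM x).
rewrite mxE row_mxEr => <-; rewrite summxE; apply: eq_bigr => i _.
by rewrite MS LE mxE.
Qed.

Section barycentric_coordinates.
Variables (P : 'I_d.+1 -> V) (a : 'I_d.+1 -> 'I_d -> R) (b : 'I_d.+1 -> R).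
Hypothesis Pi : aff_indep P.
Local Notation lam i := (affine_fun (a i) (b i)).
Hypothesis lam1 : forall x, \sum_i lam i x = 1.
Hypothesis lamx : forall x, x = \sum_i lam i x *: P i.

Lemma barycentric_unique (m : 'I_d.+1 -> R) x : \sum_i m i = 1 ->
  x = \sum_i m i *: P i -> forall i, lam i x = m i.
Proof.
move=> m1 mx i; apply/eqP; rewrite -subr_eq0; apply/eqP.
apply: (Pi (mu := fun i => lam i x - m i)).
  by rewrite sumrB lam1 m1 subrr.
under eq_bigr do rewrite scalerBl.
by rewrite sumrB -lamx -mx subrr.
Qed.

Lemma barycentric_vertex i j : lam i (P j) = (i == j)%:R.
Proof.
apply: (barycentric_unique (m := fun i => (i == j)%:R)).
  by rewrite (bigD1 j)//= eqxx big1 ?addr0// => k /negbTE ->.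
rewrite (bigD1 j)//= eqxx scale1r big1 ?addr0// => k /negbTE ->.
by rewrite scale0r.
Qed.

Lemma hullE (I : {set 'I_d.+1}) :
  hull P I = [set x | forall i, 0 <= lam i x /\ (i \notin I -> lam i x = 0)].
Proof.
apply/seteqP; split => [x [m [m0 m1 mx]] i|x /= Hx].
  rewrite (barycentric_unique (m := fun i => if i \in I then m i else 0)).
  - by split; [case: ifP|move=> /negbTE ->].
  - by rewrite -big_mkcond.
  - rewrite mx big_mkcond; apply: eq_bigr => k _.
    by case: ifP => //; rewrite scale0r.
have lI i : i \notin I -> lam i x = 0 by have [_] := Hx i.
exists (fun i => lam i x); split.
- by move=> i; have [] := Hx i.
- rewrite -(lam1 x) [RHS](bigID (mem I))/= [X in _ + X]big1 ?addr0//.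
- rewrite {1}(lamx x) (bigID (mem I))/= [X in _ + X]big1 ?addr0// => i iI.
  by rewrite lI// scale0r.
Qed.

Lemma simplexE : hull P [set: 'I_d.+1]%SET = [set x | forall i, 0 <= lam i x].
Proof.
rewrite hullE; apply/seteqP; split => x /= H i; first by have [] := H i.
by split => //; rewrite inE.
Qed.

Lemma simplex_closed : closed (hull P [set: 'I_d.+1]%SET).
Proof.
rewrite simplexE (_ : [set x | _] = \bigcap_(i in setT) (lam i @^-1` [set z | 0 <= z])).
  apply: closed_bigI => i _; apply: closed_comp; last exact: closed_ge.
  by move=> x _; exact: affine_fun_continuous.
by apply/seteqP; split => x H i; [move=> _|]; exact: H.
Qed.

Lemma simplex_interior x : (forall i, 0 < lam i x) -> (hull P [set: 'I_d.+1]%SET)° x.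
Proof.
pose U := [set y | forall i, 0 < lam i y].
suff oU : open U.
  move=> x0; move: (x) (x0 : U x); rewrite -/(U `<=` _) -open_subsetE// => y Uy.
  by rewrite simplexE /= => i; exact: ltW.
apply/openP_norm => y Uy.
have /choice[r rP] : forall i, exists r : R, 0 < r /\
    forall z, `|y - z| < r -> `|lam i y - lam i z| <= lam i y / 2.
  move=> i; have := (continuous_at_rVP (lam i) y).1 (@affine_fun_continuous _ _ y).
  by move=> /(_ (lam i y / 2))[|r r0 rP]; [rewrite divr_gt0|exists r].
have [m m0 mP] := @finite_lower_bound R _ (enum 'I_d.+1) r (fun i _ => (rP i).1).
exists m => // z yz i.
have := (rP i).2 z (lt_le_trans yz (mP i (mem_enum _ i))).
by have := Uy i; rewrite ler_norml; lra.
Qed.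

(** On a face without the vertex P_i the i-th coordinate vanishes, but it becomes positive on any
    small move from x towards P_i. *)
Lemma face_interior (I : {set 'I_d.+1}) x : (hull P I)° x -> I = [set: 'I_d.+1]%SET.
Proof.
move=> xI; apply/setP => i; rewrite finset.in_setT; apply/negPn/negP => iI.
have [r r0 rI] : exists2 r : R, 0 < r & forall y, `|x - y| < r -> hull P I y.
  move: xI => /nbhs_ballP[r /= r0 rI]; exists r => // y xy.
  by apply: rI; rewrite -ball_normE.
have Hx y : `|x - y| < r -> lam i y = 0.
  by move=> /rI; rewrite hullE => /(_ i)[_]; exact.
have n0 : 0 < 2 * (`|P i - x| + 1) by rewrite mulr_gt0// ltr_wpDl.
pose t := r / (2 * (`|P i - x| + 1)).
have t0 : 0 < t by rewrite divr_gt0.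
have := Hx (x + t *: (P i - x)).
rewrite affine_fun_segment barycentric_vertex eqxx mulr1.
rewrite (Hx x) ?subrr ?normr0// mulr0 add0r opprD addrA subrr add0r normrN normrZ.
rewrite gtr0_norm// => H; have := t0; rewrite H ?ltxx//.
rewrite /t mulrAC ltr_pdivrMr//; have := normr_ge0 (P i - x); nra.
Qed.

(** A point of the simplex with all coordinates positive is interior, so the boundary lies in the
    zero sets of the coordinates. These are proper affine subspaces: for d > 0 there are at least
    two vertices, and each coordinate takes both values 0 and 1 at vertices. *)
Lemma simplex_boundary_null : (0 < d)%N ->
  exists N, [/\ measurable N, mu N = 0%E & hull P [set: 'I_d.+1]%SET `\` (hull P [set: 'I_d.+1]%SET)° `<=` N].
Proof.
move=> d0; pose Z i := [set x : V | lam i x = 0].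
have mZ i : measurable (Z i).
  rewrite (_ : Z i = lam i @^-1` [set 0]) //; rewrite -[X in measurable X]setTI.
  have ml : measurable_fun setT (lam i) by apply: continuous_measurable_rV; exact: affine_fun_continuous.
  by apply: ml => //; exact: measurable_set1.
have Z0 i : mu (Z i) = 0%E.
  apply: affine_null; apply: contrapT => /forallNP a0.
  have a0' j : a i j = 0 by apply/eqP/negPn/negP; exact: a0.
  have lc x : lam i x = b i by rewrite /affine_fun big1 ?addr0// => j _; rewrite a0' mul0r.
  have [k ki] : exists k : 'I_d.+1, i != k.
    have [->|i0] := eqVneq i ord0; last by exists ord0.
    by exists (lift ord0 (Ordinal d0)); rewrite neq_lift.
  have := barycentric_vertex i k; rewrite (negbTE ki) lc => bi0.
  have := barycentric_vertex i i; rewrite eqxx lc bi0 => /eqP.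
  by rewrite eq_sym oner_eq0.
have [mN N0] : measurable (\big[setU/set0]_(i < d.+1) Z i) /\
    mu (\big[setU/set0]_(i < d.+1) Z i) = 0%E.
  elim/big_ind : _ => [|A B [mA A0] [mB B0]|//]; first by split.
  by split; [exact: measurableU|exact: null_set_setU].
exists (\big[setU/set0]_(i < d.+1) Z i); split => // x [xK xI].
rewrite -bigcup_mkord_ord; apply: contrapT => xZ; apply: xI.
apply: simplex_interior => i; rewrite lt_def.
move: xK; rewrite simplexE => -> /=; rewrite andbT.
by apply/negP => /eqP xi; apply: xZ; exists i; [exact: ltn_ord|rewrite inord_val].
Qed.

End barycentric_coordinates.

Lemma simplexP (K : set V) : (0 < d)%N -> simplex K ->
  closed K /\ exists N, [/\ measurable N, mu N = 0%E & K `\` K° `<=` N].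
Proof.
move=> d0 [P Pi ->]; have [a [b [lam1 lamx]]] := barycentric Pi.
by split; [exact: simplex_closed lam1 lamx|exact: simplex_boundary_null lam1 lamx d0].
Qed.

Lemma face_eq (F K : set V) x : face F K -> F° x -> F = K.
Proof.
move=> [P [I [Pi -> ->]]] FI; have [a [b [lam1 lamx]]] := barycentric Pi.
by rewrite (face_interior Pi lam1 lamx FI).
Qed.

End simplices.

Import HBNNSimple.

(* f need not be measurable: its integral is the lower one. *)
Lemma ge0_integral_eq_off_null d0 (T : measurableType d0) (R : realType)
    (m : {measure set T -> \bar R}) (D N : set T) (f g : T -> \bar R) :
  measurable D -> measurable N -> m N = 0%E -> measurable_fun D g ->
  (forall x, D x -> (0 <= f x)%E) -> (forall x, D x -> (0 <= g x)%E) ->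
  (forall x, D x -> ~ N x -> f x = g x) ->
  (\int[m]_(x in D) f x = \int[m]_(x in D) g x)%E.
Proof.
move=> mD mN N0 mg f0 g0 fg.
have mgD : measurable_fun setT (g \_ D) by apply/(measurable_restrictT _ mD).
have gD0 x : (0 <= (g \_ D) x)%E.
  by rewrite patchE; case: ifPn => // /set_mem; exact: g0.
have fD0 x : (0 <= (f \_ D) x)%E.
  by rewrite patchE; case: ifPn => // /set_mem; exact: f0.
have fgD x : ~ N x -> (f \_ D) x = (g \_ D) x.
  by rewrite !patchE; case: ifPn => // /set_mem Dx /fg; exact.
have aeN (P : T -> Prop) : (forall x, ~ N x -> P x) -> {ae m, forall x, P x}.
  by move=> H; exists N; split => // x /= /contra_notP; apply; exact: H.
apply/eqP; rewrite eq_le; apply/andP; split.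
  rewrite ge0_integralE//; apply/ge_ereal_sup => _ /= [h hf <-].
  (* A simple function below f is measurable and lies below g off N, so its integral can be compared
     with that of g almost everywhere. *)
  rewrite -integralT_nnsfun (integral_mkcond D g).
  apply: ae_ge0_le_integral => //.
  - by move=> x _; rewrite lee_fin.
  - exact/measurable_EFinP.
  - by apply: aeN => x nNx _; rewrite -fgD.
rewrite (integral_mkcond D g).
(* Cutting g off on N leaves its integral unchanged and puts it, and every simple function below it,
   under f at every point. *)
rewrite (_ : \int[m]_x (g \_ D) x = \int[m]_x (g \_ (D `\` N)) x)%E; last first.
  apply: ge0_ae_eq_integral => //.
  - by apply/(measurable_restrictT _ (measurableD mD mN)); exact: measurable_funS mg.
  - by move=> x _; rewrite patchE; case: ifPn => // /set_mem[Dx _]; exact: g0.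
  apply: aeN => x nNx _; rewrite !patchE; congr (if _ then _ else _).
  by rewrite in_setD (memNset nNx) andbT.
rewrite (integral_mkcond D f) !ge0_integralTE//; last first.
  by move=> x; rewrite patchE; case: ifPn => // /set_mem[Dx _]; exact: g0.
apply: le_ereal_sup => _ /= [h hg <-]; exists h => // x.
rewrite (le_trans (hg x))// !patchE; case: ifPn => [/set_mem[Dx nNx]|_].
  by rewrite mem_set// fg.
by case: ifPn => // /set_mem; exact: f0.
Qed.

(* Cover the interval by closed sets on each of which f is L-Lipschitz: follow
   the first set up to its last point, then continue with the others. *)
Lemma lipschitz_closed_cover (R : realType) (f : R -> R) (L : R) (s : seq (set R)) (a b : R) :
  0 <= L -> a <= b ->
  (forall t, a <= t <= b -> {for t, continuous f}) ->
  (forall C, C \in s -> closed C) ->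
  (forall C, C \in s -> forall x y, C x -> C y -> `|f x - f y| <= L * `|x - y|) ->
  (forall t, a <= t <= b -> exists2 C, C \in s & C t) ->
  `|f b - f a| <= L * (b - a).
Proof.
move=> L0; have [n] := ubnP (size s); elim: n s a => // n IH s a /ltnSE sn ab cf cs Ls cov.
have [C Cs Ca] := cov a ltac:(by rewrite lexx ab).
pose A := C `&` `[a, b]%classic.
have Aa : A a by split => //=; rewrite in_itv /= lexx ab.
have supA : has_sup A.
  by split; [exists a|exists b => z [_ /=]; rewrite in_itv /= => /andP[]].
have cA : closed A by apply: closedI; [exact: cs|exact: interval_closed].
pose c := sup A.
have [Cc] : A c by apply: cA; apply: closure_sup => //; [exists a|case: supA].
rewrite /= in_itv /= => /andP[ac cb].
have H1 : `|f c - f a| <= L * (c - a).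
  by rewrite (le_trans (Ls C Cs _ _ Cc Ca))// ger0_norm ?subr_ge0.
suff H2 : `|f b - f c| <= L * (b - c).
  have -> : f b - f a = (f b - f c) + (f c - f a) by ring.
  by rewrite (le_trans (ler_normD _ _))//; lra.
have [bc|cltb] := leP b c.
  have -> : b = c by apply/eqP; rewrite eq_le bc cb.
  by rewrite !subrr normr0 mulr0.
apply/ler_addgt0Pr => e e0.
have cfc : {for c, continuous f} by apply: cf; rewrite ac cb.
have [r r0 rP] : exists2 r : R, 0 < r & forall y, `|c - y| < r -> `|f c - f y| <= e.
  move/cvgrPdist_le : cfc => /(_ _ e0) /nbhs_ballP[r /= r0 rP].
  by exists r => // y cy; apply: rP; rewrite /ball_ /=.
(* The remaining sets may miss c but cover everything strictly to its right, so the induction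
   restarts slightly later; continuity at c bridges the gap at the cost of e. *)
pose c' := Num.min b (c + r / 2).
have cc' : c < c' by rewrite lt_min cltb ltrDl divr_gt0.
have c'b : c' <= b by rewrite ge_min lexx.
have c'r : c' <= c + r / 2 by rewrite ge_min lexx orbT.
have nC t : c' <= t <= b -> ~ C t.
  move=> /andP[c't tb] Ct; have : t <= c; last lra.
  apply: ub_le_sup; first by case: supA.
  by split => //=; rewrite in_itv /= tb andbT; lra.
have IHc : `|f b - f c'| <= L * (b - c').
  apply: (IH (rem C s)) => //.
  - by rewrite size_rem// -ltnS prednK// -has_predT; apply/hasP; exists C.
  - by move=> t /andP[t1 t2]; apply: cf; rewrite t2 andbT; lra.
  - by move=> D /mem_rem; exact: cs.
  - by move=> D /mem_rem; exact: Ls.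
  - move=> t tb; have [|D Ds Dt] := cov t.
      by move: tb => /andP[? ?]; apply/andP; split => //; lra.
    exists D => //; have [DC|DC] := eqVneq D C; first by case: (nC t tb); rewrite -DC.
    by move: Ds; rewrite (perm_mem (perm_to_rem Cs)) inE (negbTE DC).
have H3 : `|f c - f c'| <= e.
  by apply: rP; rewrite distrC ger0_norm; lra.
have -> : f b - f c = (f b - f c') - (f c - f c') by ring.
rewrite (le_trans (ler_normB _ _))// lerD// (le_trans IHc)// ler_wpM2l//; lra.
Qed.

(** * Total variation of piecewise affine functions *)

Section directional.
Variables (R : realType) (d : nat).
Local Notation V := 'rV[R]_d.

Lemma line_continuous (f : V -> R) (x w : V) (s : R) :
  {for x + s *: w, continuous f} -> {for s, continuous (fun t : R => f (x + t *: w))}.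
Proof.
move=> /continuous_at_rVP cf; apply/cvgrPdist_le => e /cf[r r0 rP].
have w0 : 0 < `|w| + 1 by rewrite ltr_wpDl.
apply/nbhs_ballP; exists (r / (`|w| + 1)) => /=; first by rewrite divr_gt0.
move=> t; rewrite /ball_ /= => st; apply: rP.
rewrite opprD addrACA subrr add0r -scalerBl normrZ.
move: st; rewrite ltr_pdivlMr//; apply: le_lt_trans; rewrite ler_wpM2l//; lra.
Qed.

Lemma directional_mvt (f : V -> R) (x w : V) (M : R) (h : R) :
  (forall y, derivable f y w) -> (forall y, `|'D_w f y| <= M) ->
  `|f (x + h *: w) - f x| <= M * `|h|.
Proof.
move=> df fM.
have dg s : is_derive s (1 : R) (fun s => f (x + s *: w)) ('D_w f (x + s *: w)).
  have E : (fun h0 : R => h0^-1 *: (f (x + (h0 *: (1 : R) + s) *: w) - f (x + s *: w))) =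
      (fun h0 => h0^-1 *: ((f \o shift (x + s *: w)) (h0 *: w) - f (x + s *: w))).
    apply/funext => k /=; congr (_ *: (f _ - _)).
    by rewrite /shift /= scalerDl [k *: 1]mulr1 addrCA addrA addrC addrA.
  have D : derivable (fun s : R => f (x + s *: w)) s (1 : R).
    by rewrite /derivable E; exact: df.
  by apply: DeriveDef => //; rewrite /derive E.
have cg : continuous (fun s : R => f (x + s *: w)).
  by move=> s; apply/differentiable_continuous/derivable1_diffP; have [] := dg s.
have key a b : a <= b -> `|f (x + b *: w) - f (x + a *: w)| <= M * `|b - a|.
  move=> ab; have [|c _ ->] := @MVT_segment R (fun s : R => f (x + s *: w))
    (fun s : R => 'D_w f (x + s *: w)) a b ab (fun s _ => dg s).
    exact: continuous_subspaceT.
  by rewrite normrM ler_wpM2r.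
have [h0|h0] := leP 0 h.
  by have := key 0 h h0; rewrite scale0r addr0 subr0.
by have := key h 0 (ltW h0); rewrite scale0r addr0 sub0r normrN distrC.
Qed.

End directional.

(** * Integration by parts for functions Lipschitz along segments *)

Section integration_by_parts.
Variables (R : realType) (d : nat) (Omega : set 'rV[R]_d).
Local Notation V := 'rV[R]_d.
Local Notation mu := (lebesgue_rV R d).
Hypothesis oO : open Omega.
Let mO : measurable Omega := open_measurable_rV oO.
Hypothesis bO : bounded_set Omega.
Let Ooo : (mu Omega < +oo)%E := lebesgue_bounded oO bO.
Local Notation int f := (\int[mu]_(x in Omega) f x).

Lemma compact_bounded_fun (f : V -> R) (S : set V) : continuous f -> compact S ->
  (forall x, ~ S x -> f x = 0) -> exists2 C : R, 0 <= C & forall x, `|f x| <= C.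
Proof.
move=> cf cS f0; have := continuous_compact (continuous_subspaceT cf) cS.
move=> /(@compact_bounded R R^o)[M [_ HM]]; exists (`|M| + 1); first by rewrite addr_ge0.
have M1 : M < `|M| + 1 by rewrite (le_lt_trans (ler_norm _))// ltrDl.
move=> x; have [Sx|nS] := pselect (S x); last by rewrite f0// normr0 addr_ge0.
by apply: (HM _ M1); exists x.
Qed.

Lemma compact_margin (S : set V) : compact S -> S `<=` Omega ->
  exists2 r : R, 0 < r & forall x y, S x -> `|x - y| < r -> Omega y.
Proof.
move=> cS SO; have /choice[s sP] : forall x, exists r : R, S x -> 0 < r /\
    forall y, `|x - y| < r -> Omega y.
  move=> x; have [Sx|] := pselect (S x); last by exists 1.
  by have [r r0 rP] := (openP_norm Omega).1 oO x (SO x Sx); exists r.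
have s20 x : S x -> 0 < s x / 2 by move=> /sP[]; lra.
have [L [LS SL]] := finite_ball_cover cS s20.
have [r r0 rP] := @finite_lower_bound R V L (fun x => s x / 2) (fun c cL => s20 c (LS c cL)).
exists r => // x y Sx xy; have [c cL xc] := SL x Sx.
apply: (sP c (LS c cL)).2; rewrite distrC.
have -> : y - c = (x - c) - (x - y) by apply/rowP => j; rewrite !mxE; ring.
by rewrite (le_lt_trans (ler_normB _ _))//; have := rP c cL; lra.
Qed.

Lemma Rintegral_supp (f : V -> R) : (forall x, ~ Omega x -> f x = 0) ->
  \int[mu]_x f x = int f.
Proof.
move=> f0; rewrite [RHS]Rintegral_mkcond; apply: eq_Rintegral => x _.
by rewrite patchE; case: ifPn => // /negP xO; rewrite f0// => Ox; apply: xO; exact: mem_set.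
Qed.

(* Difference quotients are moved from psi to v by translation invariance, and
   both sides pass to the limit by dominated convergence. *)
Lemma integration_by_parts (v G psi : V -> R) (i : 'I_d) (L C : R) :
  0 <= L -> measurable_fun Omega v -> measurable_fun Omega G ->
  (forall x, Omega x -> `|G x| <= L) ->
  (forall x, Omega x -> `|v x| <= C) ->
  (forall x w, (forall t : R, 0 <= t <= 1 -> Omega (x + t *: w)) ->
     `|v (x + w) - v x| <= L * `|w|) ->
  {ae mu, forall x, Omega x -> exists2 r : R, 0 < r &
     forall s : R, `|s| < r -> v (x + s *: delta_mx 0 i) - v x = s * G x} ->
  Ck 1 psi -> compact_supp_in Omega psi ->
  int (fun x => v x * pderiv i psi x) = - int (fun x => G x * psi x).
Proof.
move=> L0 mv mG GL vC vL vG [cpsi /(_ i)[dpsi [cdpsi _]]] [cS SO].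
pose e : V := delta_mx 0 i.
have e1 : `|e| <= 1 := norm_delta_mx R i.
have psi0 x : ~ supp psi x -> psi x = 0.
  by move=> nS; apply: contrapT => p0; apply: nS; exact: subset_closure.
have psiO x : ~ Omega x -> psi x = 0 by move=> nO; apply: psi0 => /SO.
have dpsi0 x : ~ supp psi x -> pderiv i psi x = 0.
  move=> nS; apply: (@pderiv_locally_cst _ _ (~` supp psi) _ psi x i 0) => //.
  by apply: closed_openC; exact: closed_closure.
have [P P0 psiP] := compact_bounded_fun cpsi cS psi0.
have [Q Q0 dpsiQ] := compact_bounded_fun cdpsi cS dpsi0.
have [r r0 rP] := compact_margin cS SO.
(* Translation invariance holds on the whole space, so v is extended by zero; the jump across the
   boundary is harmless because psi vanishes near it. *)
pose v0 := v \_ Omega.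
have mv0 : measurable_fun setT v0 by apply/(measurable_restrictT _ mO).
have v0E x : Omega x -> v0 x = v x by move=> Ox; rewrite /v0 patchE mem_set.
have v0O x : ~ Omega x -> v0 x = 0 by move=> Ox; rewrite /v0 patchE memNset.
have v0C x : `|v0 x| <= `|C|.
  have [Ox|nO] := pselect (Omega x); last by rewrite v0O// normr0.
  by rewrite v0E// (le_trans (vC _ Ox))// ler_norm.
have mtrans w := @measurable_translation R d w.
have mpsi : measurable_fun setT psi by exact: continuous_measurable_rV.
have mdpsi : measurable_fun setT (pderiv i psi) by exact: continuous_measurable_rV.
(* The denominator n + 2 makes s n < r already for n = 0, so that the support of psi, moved by s n,
   always stays in Omega. *)
pose s n : R := r / n.+2%:R.
have s0 n : 0 < s n by rewrite divr_gt0.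
have sr n : s n < r by rewrite ltr_pdivrMr// ltr_pMr// ltr1n.
have s_small eps : 0 < eps -> exists M, forall n, (M <= n)%N -> s n < eps.
  move=> eps0; have h0 : 0 < eps / r by rewrite divr_gt0.
  have [M _ MP] := near_infty_natSinv_lt (PosNum h0).
  exists M => n nM; have /= := MP n.+1 (leq_trans nM (leqnSn n)).
  by rewrite ltr_pdivlMr// mulrC.
pose A n x := v0 x * ((psi (x + s n *: e) - psi x) / s n).
pose B n x := ((v0 (x - s n *: e) - v0 x) / s n) * psi x.
have AB n : int (A n) = int (B n).
  have bnd (f g : V -> R) : measurable_fun setT f -> measurable_fun setT g ->
      (forall x, `|f x| <= `|C|) -> (forall x, `|g x| <= P) ->
      mu.-integrable Omega (fun x => (f x * g x)%:E).
    move=> mf mg fC gP; apply: (@itg_bounded _ _ _ mu _ mO _ (`|C| * P)) => //.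
      by apply: measurable_funTS; exact: measurable_funM.
    by move=> x _; rewrite normrM ler_pM.
  have m1 : measurable_fun setT (fun x => v0 x * psi (x + s n *: e)).
    apply: measurable_funM => //.
    by apply: (measurableT_comp mpsi); exact: mtrans.
  have m2 : measurable_fun setT (fun x : V => v0 (x - s n *: e)).
    by apply: (measurableT_comp mv0); exact: mtrans.
  have i1 : mu.-integrable Omega (fun x => (v0 x * psi (x + s n *: e))%:E).
    by apply: bnd => //; apply: (measurableT_comp mpsi); exact: mtrans.
  have i2 : mu.-integrable Omega (fun x => (v0 x * psi x)%:E) by exact: bnd.
  have i3 : mu.-integrable Omega (fun x => (v0 (x - s n *: e) * psi x)%:E) by exact: bnd.
  transitivity ((s n)^-1 * (int (fun x => v0 x * psi (x + s n *: e)) - int (fun x => v0 x * psi x))).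
    rewrite -RintegralB// -RintegralZl//; last exact: itgB.
    by apply: eq_Rintegral => x _; rewrite /A; ring.
  transitivity ((s n)^-1 * (int (fun x => v0 (x - s n *: e) * psi x) - int (fun x => v0 x * psi x))); last first.
    rewrite -RintegralB// -RintegralZl//; last exact: itgB.
    by apply: eq_Rintegral => x _; rewrite /B; ring.
  congr (_ * (_ - _)).
  rewrite -!Rintegral_supp; last 2 first.
  - by move=> x nO; rewrite psiO// mulr0.
  - by move=> x nO; rewrite v0O// mul0r.
  rewrite -(Rintegral_translation (- (s n *: e)) m1).
  by apply: eq_Rintegral => x _; rewrite subrK.
have cA : (fun n => int (A n)) @ \oo --> int (fun x => v x * pderiv i psi x).
  apply: (@Rintegral_dominated_cvg _ _ _ mu _ mO _ _ (fun=> `|C| * Q)).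
  - move=> n; apply: measurable_funTS; apply: measurable_funM => //.
    apply: measurable_funM => //; apply: measurable_funB => //.
    by apply: (measurableT_comp mpsi); exact: mtrans.
  - by apply: measurable_funM => //; exact: measurable_funTS.
  - apply: aeW => x Ox; rewrite -v0E//; apply: cvgMr.
    move/cvg_ex : (dpsi x) => /= [l]; rewrite /pderiv /derive => Hl.
    rewrite (cvg_lim _ Hl)//; apply/cvgrPdist_le => eps eps0.
    move/cvgrPdist_le : Hl => /(_ eps eps0) /nbhs_ballP[r1 /= r10 r1P].
    have [M MP] := s_small _ r10; exists M => // n /= /MP sn.
    have sb : ball (0 : R) r1 (s n) by rewrite /ball /= sub0r normrN gtr0_norm.
    by have := r1P _ sb (lt0r_neq0 (s0 n)); rewrite [x + _]addrC [_ / _]mulrC.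
  - by apply: (@itg_bounded _ _ _ mu _ mO _ (`|C| * Q)) => // x _; rewrite ger0_norm// mulr_ge0.
  - move=> n x _; rewrite normrM ler_pM// normrM normfV (gtr0_norm (s0 n)) ler_pdivrMr//.
    by rewrite -{2}(gtr0_norm (s0 n)); exact: directional_mvt.
have cB : (fun n => int (B n)) @ \oo --> int (fun x => - G x * psi x).
  apply: (@Rintegral_dominated_cvg _ _ _ mu _ mO _ _ (fun=> L * P)).
  - move=> n; apply: measurable_funTS; apply: measurable_funM => //.
    apply: measurable_funM => //; apply: measurable_funB => //.
    by apply: (measurableT_comp mv0); exact: mtrans.
  - apply: measurable_funM; last exact: measurable_funTS.
    exact: measurableT_comp.
  - have [N [mN N0 NP]] := vG; exists N; split => // x /= Hx; apply: NP => /= HG; apply: Hx.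
    move=> Ox; have [r1 r10 r1P] := HG Ox.
    have [r2 r20 r2P] := (openP_norm Omega).1 oO x Ox.
    have m0 : 0 < Num.min r1 r2 by rewrite lt_min r10.
    have [M MP] := s_small _ m0.
    apply: cvg_near_cst; exists M => // n /= Mn.
    have := MP n Mn; rewrite lt_min => /andP[sr1 sr2].
    rewrite /B v0E; last first.
      apply: r2P; rewrite opprB addrC subrK normrZ gtr0_norm//.
      by rewrite (le_lt_trans _ sr2)// ler_piMr// ltW.
    rewrite v0E// -scaleNr r1P ?normrN ?gtr0_norm//.
    by congr (_ * _); field; rewrite gt_eqF.
  - by apply: (@itg_bounded _ _ _ mu _ mO _ (L * P)) => // x _; rewrite ger0_norm// mulr_ge0.
  - move=> n x _; rewrite normrM; have [Sx|nS] := pselect (supp psi x); last first.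
      by rewrite psi0// normr0 mulr0 mulr_ge0.
    rewrite ler_pM// normrM normfV (gtr0_norm (s0 n)) ler_pdivrMr//.
    (* The whole segment from x to its translate lies in Omega, as the Lipschitz bound on v
       demands. *)
    have HO t : 0 <= t <= 1 -> Omega (x + t *: (- (s n *: e))).
      move=> /andP[t0 t1]; apply: (rP x) => //.
      rewrite opprD addrA subrr add0r normrN normrZ normrN normrZ (gtr0_norm (s0 n)) ger0_norm//.
      have sn0 : 0 <= s n := ltW (s0 n).
      apply: le_lt_trans (sr n); apply: (@le_trans _ _ (s n * `|e|)); last exact: ler_piMr.
      by apply: ler_piMl => //; exact: mulr_ge0.
    rewrite !v0E; [|exact: SO|by rewrite -[- _]scale1r; apply: HO; rewrite ler01 lexx].
    rewrite (le_trans (vL _ _ HO))// ler_wpM2l// normrN normrZ gtr0_norm//.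
    by rewrite ler_piMr// ltW.
rewrite (_ : - _ = int (fun x => - G x * psi x)); last first.
  rewrite -RintegralN//; last first.
    apply: (@itg_bounded _ _ _ mu _ mO _ (L * P)) => //.
      by apply: measurable_funM => //; exact: measurable_funTS.
    by move=> x Ox; rewrite normrM ler_pM// GL.
  by apply: eq_Rintegral => x _; rewrite mulNr.
apply: (cvg_unique _ cA) => //.
by rewrite (_ : (fun n => int (A n)) = (fun n => int (B n)))//; exact/funext.
Qed.

End integration_by_parts.

(** * Continuous piecewise affine functions *)

Section piecewise_affine.
Variables (R : realType) (d : nat) (Omega : set 'rV[R]_d) (Th : set (set 'rV[R]_d)).
Local Notation V := 'rV[R]_d.
Local Notation mu := (lebesgue_rV R d).
Hypothesis oO : open Omega.
Let mO : measurable Omega := open_measurable_rV oO.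
Hypothesis bO : bounded_set Omega.
Let Ooo : (mu Omega < +oo)%E := lebesgue_bounded oO bO.
Local Notation int f := (\int[mu]_(x in Omega) f x).

Lemma derivative_of_germ (f : V -> R) x (a : R) i :
  (exists2 r : R, 0 < r & forall s : R, `|s| < r -> f (x + s *: delta_mx 0 i) - f x = s * a) ->
  pderiv i f x = a.
Proof.
move=> [r r0 rP]; apply: cvg_lim => //; apply/cvgrPdist_le => eps eps0.
apply/nbhs_ballP; exists r => // s; rewrite /ball /= sub0r normrN => sr s0.
by rewrite [s *: _ + x]addrC rP// [_ *: _](mulKf s0) subrr normr0 ltW.
Qed.

Lemma finite_upper_bound (I : eqType) (s : seq I) (h : I -> R) :
  exists2 M : R, 0 <= M & forall i, i \in s -> h i <= M.
Proof.
exists (\sum_(i <- s) `|h i|); first exact: sumr_ge0.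
move=> i si; rewrite (le_trans (ler_norm _))// (big_rem i si)/= lerDl.
exact: sumr_ge0.
Qed.

Hypothesis d0 : (0 < d)%N.
Hypothesis finTh : finite_set Th.
Hypothesis simTh : forall K, Th K -> simplex K.
Hypothesis covTh : \bigcup_(K in Th) K = closure Omega.

Let U := \bigcup_(K in Th) K°.

Let oU : open U.
Proof. by apply: bigcup_open => K _; exact: open_interior. Qed.

Let mU : measurable U := open_measurable_rV oU.

Lemma elements_boundary_null : exists N, [/\ measurable N, mu N = 0%E & Omega `\` U `<=` N].
Proof.
have [s sE] := (finite_seqP Th).1 finTh.
have /choice[F FP] : forall K, exists N, Th K ->
    [/\ measurable N, mu N = 0%E & K `\` K° `<=` N].
  move=> K; have [TK|] := pselect (Th K); last by exists set0.
  by have [_ [N NP]] := simplexP d0 (simTh TK); exists N.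
have [mN N0] : measurable (\big[setU/set0]_(K <- s | K \in s) F K) /\
    mu (\big[setU/set0]_(K <- s | K \in s) F K) = 0%E.
  elim/big_ind : _ => [|A B [mA A0] [mB B0]|K Ks]; first by split.
    by split; [exact: measurableU|exact: null_set_setU].
  by have [|? ? _] := FP K; first by rewrite sE.
exists (\big[setU/set0]_(K <- s | K \in s) F K); split => // x [Ox Ux].
have [K TK Kx] : (\bigcup_(K in Th) K) x by rewrite covTh; exact: subset_closure.
have Ks : K \in s by move: TK; rewrite sE.
rewrite (big_rem K Ks) /= Ks; left; have [_ _] := FP K TK; apply; split => // Kx'.
by apply: Ux; exists K.
Qed.

Variable v : V -> R.
Hypothesis vS : S1 Omega Th v.

Let cl_cont : {in Omega, continuous v}.
Proof.
rewrite -continuous_open_subspace//.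
exact: (continuous_subspaceW (@subset_closure _ Omega) vS.1).
Qed.

(** A measurable version of the partial derivative: on the element boundaries, where the derivative
    may fail to exist, it is set to 0. *)
Let G i : V -> R := pderiv i v \_ U.

Lemma S1_slopes : exists (a : set V -> 'I_d -> R) (b : set V -> R),
  forall K x, Th K -> K x -> v x = affine_fun (a K) (b K) x.
Proof.
have /choice[f fP] : forall K, exists ab : ('I_d -> R) * R,
    forall x, Th K -> K x -> v x = affine_fun ab.1 ab.2 x.
  move=> K; have [TK|] := pselect (Th K); last by exists (fun=> 0, 0).
  have [f /poly_le1_affine[a [b ->]] vf] := vS.2 K TK.
  by exists (a, b) => x _; exact: vf.
by exists (fun K => (f K).1), (fun K => (f K).2) => K x TK Kx; exact: fP.
Qed.

Lemma S1_measurable : measurable_fun Omega v.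
Proof.
by apply: open_continuous_measurable_rV => // x Ox; apply: cl_cont; exact: mem_set.
Qed.

Lemma S1_bounded : exists C, forall x, Omega x -> `|v x| <= C.
Proof.
have [a [b vE]] := S1_slopes; have [s sE] := (finite_seqP Th).1 finTh.
have [M MO] := bounded_setP bO.
have [C _ CP] := finite_upper_bound s (fun K => `|b K| + \sum_i `|a K i| * M).
exists C => x Ox.
have [K TK Kx] : (\bigcup_(K in Th) K) x by rewrite covTh; exact: subset_closure.
apply: le_trans (CP K _); last by move: TK; rewrite sE.
rewrite (vE K)// /affine_fun (le_trans (ler_normD _ _))// lerD2l.
rewrite (le_trans (ler_norm_sum _ _ _))//; apply: ler_sum => i _.
by rewrite normrM ler_wpM2l// (le_trans (le_coord_norm _ _))// MO.
Qed.

Lemma S1_L2 : L2 Omega v.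
Proof. by have [C CP] := S1_bounded; exact: L2_bounded S1_measurable CP. Qed.

Let germ K x i (a : set V -> 'I_d -> R) (b : set V -> R) :
  (forall K x, Th K -> K x -> v x = affine_fun (a K) (b K) x) ->
  Th K -> K° x -> exists2 r : R, 0 < r &
    forall s : R, `|s| < r -> v (x + s *: delta_mx 0 i) - v x = s * a K i.
Proof.
move=> vE TK Kx; have [r r0 rP] := (openP_norm K°).1 (@open_interior _ K) x Kx.
exists r => // s sr; rewrite !(vE K) //; last 2 first.
- exact: interior_subset.
- apply: interior_subset; apply: rP.
  rewrite opprD addrA subrr add0r normrN.
  by rewrite (le_lt_trans (norm_scale_delta _ _)).
rewrite affine_funD addrAC subrr add0r (bigD1 i)//= !mxE !eqxx mulr1 mulrC.
rewrite big1 ?addr0// => j /negbTE ji.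
by rewrite !mxE ji mulr0 mulr0.
Qed.

Lemma S1_gradient i : measurable_fun Omega (G i) /\
  {ae mu, forall x, Omega x -> exists2 r : R, 0 < r &
     forall s : R, `|s| < r -> v (x + s *: delta_mx 0 i) - v x = s * G i x}.
Proof.
have [a [b vE]] := S1_slopes.
have dE K x : Th K -> K° x -> pderiv i v x = a K i.
  by move=> TK Kx; apply: derivative_of_germ; exact: germ vE TK Kx.
split.
  apply: measurable_funTS; apply/(measurable_restrictT _ mU).
  apply: open_continuous_measurable_rV => // x [K TK Kx].
  apply/continuous_at_rVP => e e0.
  have [r r0 rP] := (openP_norm K°).1 (@open_interior _ K) x Kx.
  by exists r => // y xy; rewrite !(dE K)//; [rewrite subrr normr0 ltW|exact: rP].
have [N [mN N0 NP]] := elements_boundary_null.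
exists N; split => // x /= Hx; apply: NP; apply: contrapT => H; apply: Hx => Ox.
have [K TK Kx] : U x by apply: contrapT => nU; exact: H.
have -> : G i x = a K i.
  by rewrite /G patchE mem_set ?(dE K)//; exists K.
exact: germ vE TK Kx.
Qed.

(** The elements cut a segment in Omega into finitely many closed sets, on each of which v is
    affine; continuity of v joins the pieces. *)
Lemma S1_lipschitz : exists2 L : R, 0 <= L & (forall i x, `|G i x| <= L) /\
  forall x w, (forall t : R, 0 <= t <= 1 -> Omega (x + t *: w)) ->
    `|v (x + w) - v x| <= L * `|w|.
Proof.
have [a [b vE]] := S1_slopes; have [s sE] := (finite_seqP Th).1 finTh.
have [L L0 LP] := finite_upper_bound s (fun K => \sum_i `|a K i|).
have sP K : Th K -> K \in s by rewrite sE.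
have sT K : K \in s -> Th K by rewrite sE.
exists L => //; split => [i x|x w xw].
  rewrite /G patchE; case: ifPn => [/set_mem[K TK Kx]|_]; last by rewrite normr0.
  rewrite (derivative_of_germ (germ i vE TK Kx)).
  by apply: le_trans (LP K (sP _ TK)); rewrite (bigD1 i)//= lerDl; exact: sumr_ge0.
pose f (t : R) := v (x + t *: w).
have -> : v (x + w) - v x = f 1 - f 0 by rewrite /f scale1r scale0r addr0.
rewrite -[leRHS]mulr1 -[X in _ * X](subr0 1).
pose C (K : set V) := [set t : R | K (x + t *: w)].
apply: (@lipschitz_closed_cover _ _ _ (map C s)) => //.
- by rewrite mulr_ge0.
- by move=> t /xw Ot; apply: line_continuous; apply: cl_cont; exact: mem_set.
- move=> _ /mapP[K /sT TK ->]; have [cK _] := simplexP d0 (simTh TK).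
  apply: closed_comp cK => t _ B /nbhs_ballP[r /= r0 rB].
  have w0 : 0 < `|w| + 1 by rewrite ltr_wpDl.
  apply/nbhs_ballP; exists (r / (`|w| + 1)) => /=; first by rewrite divr_gt0.
  move=> t'; rewrite /ball /= => tt; apply: rB; rewrite -ball_normE /ball_ /=.
  rewrite opprD addrACA subrr add0r -scalerBl normrZ.
  by move: tt; rewrite ltr_pdivlMr//; apply: le_lt_trans; rewrite ler_wpM2l//; lra.
- move=> _ /mapP[K /sT TK ->] t t' Kt Kt'; rewrite /f !(vE K)//.
  have -> : x + t *: w = (x + t' *: w) + (t - t') *: w.
    by apply/rowP => j; rewrite !mxE; ring.
  rewrite affine_funD addrAC subrr add0r (le_trans (ler_norm_sum _ _ _))//.
  rewrite -mulrA [`|w| * _]mulrC; apply: (@le_trans _ _ ((\sum_i `|a K i|) * (`|t - t'| * `|w|))).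
    2: by rewrite ler_wpM2r ?mulr_ge0// LP// sP.
  rewrite mulr_suml; apply: ler_sum => i _.
  by rewrite mxE !normrM ler_wpM2l// ler_wpM2l// le_coord_norm.
- move=> t /xw Ot.
  have [K TK Kx] : (\bigcup_(K in Th) K) (x + t *: w) by rewrite covTh; exact: subset_closure.
  by exists (C K) => //; apply: map_f; exact: sP.
Qed.

(** Continuity across the elements leaves no jump part, so integration by parts coordinate by
    coordinate turns each test of v into an integral of - [g] against a field of norm at most 1. *)
Theorem S1_TV : (TV Omega v <= (int (fun x => enorm (grad v x)))%:E)%E.
Proof.
have [L L0 [GL vL]] := S1_lipschitz; have [C vC] := S1_bounded.
have mG i : measurable_fun Omega (G i) by have [] := S1_gradient i.
pose g x : V := \row_i G i x.
have gE x : enorm (g x) = Num.sqrt (\sum_i G i x * G i x).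
  by congr Num.sqrt; apply: eq_bigr => i _; rewrite !mxE.
have mg : measurable_fun Omega (fun x => enorm (g x)).
  rewrite (_ : (fun x => _) = (fun x => Num.sqrt (\sum_i G i x * G i x))); last exact/funext.
  apply: (@measurableT_comp _ _ _ _ _ _ (@Num.sqrt R)).
    by apply: continuous_measurable_fun; exact: sqrt_continuous.
  by apply: measurable_sum => i; exact: measurable_funM.
have gi : mu.-integrable Omega (fun x => (enorm (g x))%:E).
  apply: (@itg_bounded _ _ _ mu _ mO _ (Num.sqrt (\sum_(i < d) L * L))) => // x _.
  rewrite ger0_norm ?enorm_ge0// gE ler_sqrt; last by apply: sumr_ge0 => i _; exact: mulr_ge0.
  apply: ler_sum => i _; rewrite (le_trans (ler_norm _))// normrM ler_pM//.
(* The two integrands agree off the element boundaries, but only that of [g] is known to be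
   measurable. *)
have -> : int (fun x => enorm (grad v x)) = int (fun x => enorm (g x)).
  have [N [mN N0 NP]] := elements_boundary_null.
  congr fine; apply: (@ge0_integral_eq_off_null _ _ _ mu Omega N) => //.
  - exact/measurable_EFinP.
  - by move=> x _; rewrite lee_fin enorm_ge0.
  - by move=> x _; rewrite lee_fin enorm_ge0.
  - move=> x Ox nN; have Ux : U x by apply: contrapT => nU; apply: nN; exact: NP.
    congr (enorm _)%:E; apply/rowP => i.
    by rewrite !mxE /G patchE mem_set.
apply/ge_ereal_sup => _ /= [phi [phiC [cS SO] phi1] <-].
have phiS i : compact_supp_in Omega (fun x => phi x 0 i).
  have sub : supp (fun x => phi x 0 i) `<=` supp phi.
    by apply: closure_subset => x /= Hx p0; apply: Hx; rewrite p0 mxE.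
  split; last exact: subset_trans SO.
  by apply: (subclosed_compact _ cS sub); exact: closed_closure.
have phile i x : `|phi x 0 i| <= 1.
  rewrite (le_trans (le_coord_norm _ _))// (le_trans (norm_le_enorm _))//.
have mphi i : measurable_fun Omega (fun x => phi x 0 i).
  by have [c _] := phiC i; exact: continuous_measurable_rV.
have Gphi i : mu.-integrable Omega (fun x => (G i x * phi x 0 i)%:E).
  apply: (@itg_bounded _ _ _ mu _ mO _ (L * 1)) => //; first exact: measurable_funM.
  by move=> x _; rewrite normrM ler_pM.
have vphi i : mu.-integrable Omega (fun x => (v x * pderiv i (fun y => phi y 0 i) x)%:E).
  have [cp /(_ i)[_ [cdp _]]] := phiC i.
  have [Q Q0 dQ] : exists2 Q : R, 0 <= Q & forall x, `|pderiv i (fun y => phi y 0 i) x| <= Q.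
    apply: (compact_bounded_fun cdp (phiS i).1) => x nS.
    apply: (@pderiv_locally_cst _ _ (~` supp (fun y => phi y 0 i)) _ _ x i 0) => //.
      by apply: closed_openC; exact: closed_closure.
    move=> y nSy; apply: contrapT => p0; apply: nSy; exact: subset_closure.
  apply: (@itgM_bounded _ _ _ mu _ mO _ _ Q) => //; last exact: continuous_measurable_rV.
  exact: L2_itg S1_L2.
rewrite lee_fin.
have -> : int (fun x => v x * cdiv phi x) = int (fun x => dotp (- g x) (phi x)).
  transitivity (\sum_i int (fun x => v x * pderiv i (fun y => phi y 0 i) x)).
    rewrite -Rintegral_sum//; apply: eq_Rintegral => x _.
    by rewrite mulr_sumr.
  rewrite (eq_bigr (fun i => int (fun x => - (G i x * phi x 0 i)))); last first.
    move=> i _; rewrite RintegralN//.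
    have [_ aeG] := S1_gradient i.
    by apply: integration_by_parts L0 S1_measurable (mG i) _ vC vL aeG (phiC i) (phiS i) => // x _.
  rewrite -Rintegral_sum//; last by move=> i _; exact: itgN.
  apply: eq_Rintegral => x _; apply: eq_bigr => i _.
  by rewrite !mxE mulNr.
apply: le_Rintegral => //.
  apply: (@eq_itg _ _ _ mu _ mO (fun x => \sum_i - (G i x * phi x 0 i))).
    by move=> x _; apply: eq_bigr => i _; rewrite !mxE mulNr.
  by apply: itg_sum => // i _; exact: itgN.
by move=> x Ox; rewrite (le_trans (dotp_cauchy_schwarz _ _))// enormN ler_piMr// enorm_ge0.
Qed.

Lemma S1_BV : BV Omega v.
Proof. by split; [exact: L2_itg S1_L2|exact: le_lt_trans S1_TV (ltry _)]. Qed.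

End piecewise_affine.

(* If x - t w is close to a point of Omega, the cone at that point contains x. *)
Lemma interior_closure_lipschitz (R : realType) (d : nat) (Omega : set 'rV[R]_d) :
  open Omega -> lipschitz_boundary Omega -> (closure Omega)° `<=` Omega.
Proof.
move=> oO lO x /[dup] /interior_subset cx ix.
have [w [r [k [r0 k0 k1 w1 IC]]]] := lipschitz_inward_cone oO lO cx.
have [p p0 pP] := (openP_norm _).1 (@open_interior _ (closure Omega)) x ix.
(* t < p keeps x - t w in the closure of Omega, and t < r / 2 leaves room for a point y of Omega
   near it, which is within 2 t of x. *)
pose t := Num.min r p / 3.
have m0 : 0 < Num.min r p by rewrite lt_min r0.
have t0 : 0 < t by rewrite divr_gt0.
have [tr tp] : t < r / 2 /\ t < p.
  have [mr mp] : Num.min r p <= r /\ Num.min r p <= p by rewrite !ge_min !lexx orbT.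
  by rewrite /t; split; lra.
have tw : `|t *: w| <= t by rewrite normrZ gtr0_norm// ler_piMr// ltW.
have : closure Omega (x - t *: w).
  apply: interior_subset; apply: pP; rewrite opprD addrA subrr add0r opprK.
  exact: le_lt_trans tp.
have kt : 0 < k * t by rewrite mulr_gt0.
move=> /(_ (ball (x - t *: w) (k * t)))[|y [Oy]]; first exact: nbhsx_ballx.
rewrite -ball_normE /ball_ /= => yt.
have -> : x = y + t *: w + (x - t *: w - y) by apply/rowP => j; rewrite !mxE; ring.
apply: IC => //; last exact: ltW.
  have -> : y - x = - (x - t *: w - y) - t *: w by apply/rowP => j; rewrite !mxE; ring.
  rewrite (le_lt_trans (ler_normB _ _))// normrN.
  have : k * t <= t by rewrite ler_piMl// ltW.
  lra.
by rewrite t0 /=; lra.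
Qed.

(** * Elementwise means *)

Section element_means.
Variables (R : realType) (d : nat) (Omega : set 'rV[R]_d) (Th : set (set 'rV[R]_d)).
Local Notation V := 'rV[R]_d.
Local Notation mu := (lebesgue_rV R d).
Hypothesis oO : open Omega.
Let mO : measurable Omega := open_measurable_rV oO.
Hypothesis bO : bounded_set Omega.
Let Ooo : (mu Omega < +oo)%E := lebesgue_bounded oO bO.
Local Notation int f := (\int[mu]_(x in Omega) f x).
Hypothesis lO : lipschitz_boundary Omega.
Hypothesis rTh : regular_triangulation Omega Th.

(** The elements cover only the closure of Omega; a Lipschitz domain being the interior of its
    closure, their interiors are contained in Omega itself. *)
Let K_sub K : Th K -> K° `<=` Omega.
Proof.
move=> TK; apply: subset_trans (interior_closure_lipschitz oO lO).
by apply: interiorS; have [_ _ <- _] := rTh => x Kx; exists K.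
Qed.

Let mK (K : set V) : measurable K°.
Proof. by apply: open_measurable_rV; exact: open_interior. Qed.

(** Distinct elements meet in a common face, and a face with an interior point is the whole simplex;
    it would equal both K and L. *)
Lemma interior_elements_disjoint K L x : Th K -> Th L -> K° x -> L° x -> K = L.
Proof.
have [_ _ _ Tface] := rTh; move=> TK TL Kx Lx; apply: contrapT => KL.
have [fK fL] := Tface K L TK TL KL.
have KLx : (K `&` L)° x by rewrite interiorI.
by apply: KL; rewrite -{1}(face_eq fK KLx) (face_eq fL KLx).
Qed.

Variable g : V -> R.
Hypothesis gL : L2 Omega g.
Let gh := elt_mean Th g.
Let s : seq (set V) := finmap.enum_fset (fset_set Th).
Let c (K : set V) := (fine (mu K°))^-1 * \int[mu]_(y in K°) g y.

Let sP K : (K \in s) = (K \in Th).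
Proof. by have [fT _ _ _] := rTh; rewrite /s in_fset_set. Qed.

Let ghE x : gh x = \sum_(K <- s) \1_(K°) x * c K.
Proof. by have [fT _ _ _] := rTh; rewrite /gh /elt_mean fsbig_finite. Qed.

Let gh_in K x : Th K -> K° x -> gh x = c K.
Proof.
move=> TK Kx; have Ks : K \in s by rewrite sP mem_set.
rewrite ghE (bigD1_seq K)//= ?finmap.fset_uniq// indicE mem_set// mul1r.
rewrite big_seq_cond big1 ?addr0// => L /andP[]; rewrite sP => /set_mem TL LK.
rewrite indicE memNset ?mul0r// => Lx; move/eqP: LK; apply.
exact: interior_elements_disjoint Lx Kx.
Qed.

Lemma elt_mean_L2 : L2 Omega gh.
Proof.
apply: (@eq_L2 _ _ _ mO (fun x => \sum_(K <- s) \1_(K°) x * c K)) => [x _|].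
  by rewrite ghE.
apply: (L2_sum mO Ooo) => K _; apply: (@L2_bounded _ _ _ mO Ooo _ `|c K|).
  by apply: measurable_funM; [exact: (measurable_indic (mK K))|exact: measurable_cst].
move=> x _; rewrite indicE; case: (_ \in _); rewrite ?mul1r// mul0r normr0.
exact: normr_ge0.
Qed.

Let int_gh f : L2 Omega f ->
  int (fun x => gh x * f x) = \sum_(K <- s) c K * \int[mu]_(x in K°) f x.
Proof.
move=> fL; have fi := L2_itg mO Ooo fL.
have fK (K : set V) : mu.-integrable Omega (fun x => (\1_(K°) x * f x)%:E).
  apply: (@itgM_boundedl _ _ _ mu _ mO f (\1_(K°)) 1 fi); first exact: (measurable_indic (mK K)).
  by move=> x _; rewrite indicE; case: (_ \in _); rewrite ?normr1 ?normr0.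
transitivity (int (fun x => \sum_(K <- s) c K * (\1_(K°) x * f x))).
  apply: eq_Rintegral => x _; rewrite ghE mulr_suml.
  by apply: eq_bigr => K _; ring.
rewrite Rintegral_sum//; last by move=> K _; exact: itgZ.
rewrite !big_seq; apply: eq_bigr => K; rewrite sP => /set_mem TK.
rewrite (RintegralZl (c K) mO (fK K)); congr (_ * _).
rewrite -{2}(setIidr (K_sub TK)) Rintegral_mkcondr; apply: eq_Rintegral => x _.
by rewrite patchE indicE; case: (_ \in _); rewrite ?mul1r ?mul0r.
Qed.

Let int_K K : Th K -> \int[mu]_(x in K°) g x = fine (mu K°) * c K.
Proof.
(* For an element of measure 0 the mean is 0 by the convention on inverses, in agreement with the
   integral over a null set. *)
move=> TK; rewrite /c; have [m0|m0] := eqVneq (fine (mu K°)) 0; last by rewrite mulVKf.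
rewrite m0 mul0r /Rintegral null_set_integral//.
  by apply/measurable_EFinP; apply: measurable_funS gL.1 => //; exact: K_sub.
have Koo : mu K° \is a fin_num.
  by rewrite ge0_fin_numE// (le_lt_trans _ Ooo)// le_measure ?inE//; exact: K_sub.
by have := fineK Koo; rewrite m0; exact: esym.
Qed.

(* The elementwise mean is the orthogonal projection of g. *)
Lemma L2norm_elt_mean : L2norm Omega gh <= L2norm Omega g.
Proof.
have ghL := elt_mean_L2.
(* Orthogonality of g - gh to gh; with Cauchy-Schwarz it gives |gh|^2 <= |gh||g|. *)
have E : L2norm Omega gh ^+ 2 = int (fun x => gh x * g x).
  rewrite L2norm_sqr (int_gh gL).
  transitivity (int (fun x => gh x * gh x)); first by apply: eq_Rintegral => x _.
  rewrite (int_gh ghL) !big_seq; apply: eq_bigr => K; rewrite sP => /set_mem TK.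
  congr (_ * _); rewrite int_K//.
  transitivity (\int[mu]_(x in K°) c K).
    by apply: eq_Rintegral => x /set_mem Kx; exact: gh_in.
  by rewrite Rintegral_cst// mulrC.
have := L2_cauchy_schwarz mO ghL gL; rewrite -E.
have := L2norm_ge0 Omega gh; have := L2norm_ge0 Omega g.
move: (L2norm _ _) (L2norm _ _) => a b b0 a0; rewrite ger0_norm ?sqr_ge0//.
rewrite expr2; have [->//|a1] := eqVneq a 0.
by rewrite ler_pM2l// lt_def a1.
Qed.

End element_means.

(** * The Rudin-Osher-Fatemi energies *)

Section rof_energy.
Variables (R : realType) (d : nat) (Omega : set 'rV[R]_d).
Local Notation V := 'rV[R]_d.
Local Notation mu := (lebesgue_rV R d).
Hypothesis oO : open Omega.
Let mO : measurable Omega := open_measurable_rV oO.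
Hypothesis bO : bounded_set Omega.
Let Ooo : (mu Omega < +oo)%E := lebesgue_bounded oO bO.
Local Notation int f := (\int[mu]_(x in Omega) f x).
Local Notation norm := (L2norm Omega).
Local Notation L2 := (L2 Omega).

Lemma L2_mul_cdiv_itg (u : V -> R) (phi : V -> V) : L2 u ->
  (forall i, Ck 1 (fun x => phi x 0 i)) -> compact_supp_in Omega phi ->
  mu.-integrable Omega (fun x => (u x * cdiv phi x)%:E).
Proof.
move=> uL phiC [cS SO].
apply: (@eq_itg _ _ _ mu _ mO (fun x => \sum_i u x * pderiv i (fun y => phi y 0 i) x)).
  by move=> x _; rewrite mulr_sumr.
apply: itg_sum => // i _; have [_ /(_ i)[_ [cdp _]]] := phiC i.
have [Q Q0 dQ] : exists2 Q : R, 0 <= Q & forall x, `|pderiv i (fun y => phi y 0 i) x| <= Q.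
  apply: (compact_bounded_fun cdp cS) => x nS.
  apply: (@pderiv_locally_cst _ _ (~` supp phi) _ _ x i 0) => //.
    by apply: closed_openC; exact: closed_closure.
  move=> y nSy; have -> : phi y = 0; last by rewrite mxE.
  by apply: contrapT => p0; apply: nSy; exact: subset_closure.
apply: (@itgM_bounded _ _ _ mu _ mO _ _ Q) => //; last exact: continuous_measurable_rV.
exact: L2_itg uL.
Qed.

Lemma TV_ge0 (u : V -> R) : (0 <= TV Omega u)%E.
Proof.
apply: ereal_sup_ubound; exists (fun=> 0); last first.
  congr EFin; transitivity (int (fun=> 0)); last by rewrite Rintegral_cst// mul0r.
  apply: eq_Rintegral => x _; rewrite /cdiv big1 ?mulr0// => i _.
  rewrite (_ : (fun y => _) = fun=> (0 : R)); first exact: pderiv_cst.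
  by apply/funext => y; rewrite mxE.
split.
- move=> i; rewrite (_ : (fun y => _) = fun=> (0 : R)); first exact/C11_Ck1/C11_cst.
  by apply/funext => y; rewrite mxE.
- rewrite /compact_supp_in /supp (_ : [set x | _] = set0); last by apply/seteqP; split => x //=.
  by rewrite closure0; split; first exact: compact0.
- by move=> x; rewrite /enorm /dotp big1 ?sqrtr0// => i _; rewrite mxE mul0r.
Qed.

(** A supremum of functionals that are linear on L2. *)
Lemma TV_convex (u v : V -> R) (s : R) : L2 u -> L2 v -> 0 <= s <= 1 ->
  (TV Omega (fun x => (u x + s * (v x - u x))%R) <=
   (1 - s)%R%:E * TV Omega u + s%:E * TV Omega v)%E.
Proof.
move=> uL vL /andP[s0 s1].
apply/ge_ereal_sup => _ /= [phi [phiC phiS phi1] <-].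
have iu := L2_mul_cdiv_itg uL phiC phiS; have iv := L2_mul_cdiv_itg vL phiC phiS.
have -> : int (fun x => (u x + s * (v x - u x)) * cdiv phi x) =
    (1 - s) * int (fun x => u x * cdiv phi x) + s * int (fun x => v x * cdiv phi x).
  rewrite -!RintegralZl// -RintegralD//; [|exact: itgZ|exact: itgZ].
  by apply: eq_Rintegral => x _; ring.
rewrite EFinD !EFinM; apply: leeD; apply: lee_wpmul2l; rewrite ?lee_fin ?subr_ge0//;
  by apply: ereal_sup_ubound; exists phi.
Qed.

(** Minimality of u against u + s (v - u) and the exact expansion of the quadratic term give (1 - s)
    alpha/2 |u - v|^2 <= E(v) - E(u) for 0 < s < 1, where E is the energy; the claim is the limit s
    -> 0. *)
Lemma rof_strong_convexity (alpha : R) (g u v : V -> R) : 0 <= alpha -> L2 g ->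
  is_minimizer [set w | BV Omega w /\ L2 w] (E_rof Omega alpha g) u ->
  BV Omega v -> L2 v ->
  alpha / 2 * norm (u \- v) ^+ 2 <=
    fine (TV Omega v) + alpha / 2 * norm (v \- g) ^+ 2
    - (fine (TV Omega u) + alpha / 2 * norm (u \- g) ^+ 2).
Proof.
move=> a0 gL [[[ui uTV] uL] umin] [vi vTV] vL.
have fu : TV Omega u \is a fin_num by rewrite ge0_fin_numE// TV_ge0.
have fv : TV Omega v \is a fin_num by rewrite ge0_fin_numE// TV_ge0.
set tu := fine (TV Omega u); set tv := fine (TV Omega v).
have tuE : TV Omega u = tu%:E by rewrite fineK.
have tvE : TV Omega v = tv%:E by rewrite fineK.
have ugL : L2 (u \- g) := L2B mO uL gL.
have vgL : L2 (v \- g) := L2B mO vL gL.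
have vuL : L2 (v \- u) := L2B mO vL uL.
have uvE : norm (u \- v) = norm (v \- u).
  by rewrite -(L2normN _ (v \- u)); apply: eq_L2norm => x _ /=; rewrite opprB.
set I := int (fun x => (u \- g) x * (v \- u) x).
have H1 (s : R) : norm (fun x => (u \- g) x + s * (v \- u) x) ^+ 2 =
    norm (u \- g) ^+ 2 + 2 * s * I + s ^+ 2 * norm (v \- u) ^+ 2.
  by rewrite L2norm_sqr Rintegral_sqrDZ.
have H2 : norm (v \- g) ^+ 2 = norm (u \- g) ^+ 2 + 2 * I + norm (v \- u) ^+ 2.
  have := H1 1; rewrite mulr1 expr1n mul1r => <-; congr (_ ^+ 2).
  by apply: eq_L2norm => x _ /=; ring.
rewrite uvE; set a := norm (u \- g) in H1 H2 *; set b := norm (v \- g) in H2 *.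
set D := norm (v \- u) in H1 H2 *.
have key (s : R) : 0 < s < 1 ->
    (1 - s) * (alpha / 2 * D ^+ 2) <= tv + alpha / 2 * b ^+ 2 - (tu + alpha / 2 * a ^+ 2).
  move=> /andP[s0 s1].
  pose w x := u x + s * (v x - u x).
  have wL : L2 w by apply: (L2D mO) => //; exact: (L2Z mO).
  have s01 : 0 <= s <= 1 by lra.
  have wTV : (TV Omega w <= ((1 - s) * tu + s * tv)%:E)%E.
    by have := TV_convex uL vL s01; rewrite tuE tvE.
  have wBV : BV Omega w by split; [exact: L2_itg wL|exact: le_lt_trans wTV (ltry _)].
  have := umin w (conj wBV wL); rewrite /E_rof tuE => Hw.
  have {}Hw : tu + alpha / 2 * a ^+ 2 <=
      (1 - s) * tu + s * tv + alpha / 2 * (a ^+ 2 + 2 * s * I + s ^+ 2 * D ^+ 2).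
    rewrite -lee_fin -H1 !(EFinD _ (_ * _)) (le_trans Hw)//.
    rewrite (_ : norm (w \- g) = norm (fun x => (u \- g) x + s * (v \- u) x)) ?leeD2r//.
    by apply: eq_L2norm => x _; rewrite /w /=; ring.
  have : s * ((1 - s) * (alpha / 2 * D ^+ 2)) <= s * (tv + alpha / 2 * b ^+ 2 - (tu + alpha / 2 * a ^+ 2)).
    rewrite H2; lra.
  by rewrite ler_pM2l.
have D0 : 0 <= alpha / 2 * D ^+ 2 by rewrite mulr_ge0 ?sqr_ge0// divr_ge0.
move: key D0; move: (alpha / 2 * D ^+ 2) (tv + _ - _) => A B key A0.
rewrite leNgt; apply/negP => BA.
have A1 : 0 < A by have := key (1 / 2) ltac:(lra); lra.
(* In place of the limit: if B < A, this s gives (1 - s) A = (A + B) / 2 > B. *)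
have := key ((A - B) / (2 * A)).
have AB : 0 < (A - B) / (2 * A) by rewrite divr_gt0 ?subr_gt0// mulr_gt0.
have B0 := key (1 / 2) ltac:(lra).
have E : (A - B) / (2 * A) * A = (A - B) / 2 by field; rewrite gt_eqF.
have AB1 : (A - B) / (2 * A) < 1 by rewrite ltr_pdivrMr ?mulr_gt0//; lra.
rewrite AB AB1 => /(_ isT); rewrite mulrBl mul1r E; lra.
Qed.

(* If the divergence is large, the dual energy is negative. *)
Lemma rof_dual_le (alpha : R) (g gh u : V -> R) (q : V -> V) : 0 < alpha ->
  lipschitz_boundary Omega -> L2 g -> L2 gh -> L2 u -> (TV Omega u < +oo)%E ->
  HN Omega q -> unit_ball_ae Omega q ->
  - (2 * alpha)^-1 * norm (fun x => wdiv Omega q x + alpha * gh x) ^+ 2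
    + alpha / 2 * norm gh ^+ 2 <=
  fine (TV Omega u) + alpha / 2 * norm (u \- g) ^+ 2
    + 2 * alpha * norm gh * norm (g \- gh).
Proof.
move=> a0 lO gL ghL uL uTV qN q1; set w := wdiv Omega q.
have wL : L2 w by exact: wdiv_L2 qN.1.
have fu : TV Omega u \is a fin_num by rewrite ge0_fin_numE// TV_ge0.
have WD := weak_duality oO bO lO qN q1 uL.
rewrite -(fineK fu) lee_fin -/w in WD.
have tu0 : 0 <= fine (TV Omega u) by rewrite fine_ge0// TV_ge0.
have ugL : L2 (u \- g) := L2B mO uL gL.
have ghgL : L2 (g \- gh) := L2B mO gL ghL.
have -> : norm (fun x => w x + alpha * gh x) ^+ 2 =
    norm w ^+ 2 + 2 * alpha * int (fun x => w x * gh x) + alpha ^+ 2 * norm gh ^+ 2.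
  by rewrite L2norm_sqr Rintegral_sqrDZ.
have J1 := L2_cauchy_schwarz mO wL ghL; rewrite ler_norml in J1.
have := L2norm_ge0 Omega w; have := L2norm_ge0 Omega gh; have := L2norm_ge0 Omega (g \- gh).
(* Fenchel-Young for the fidelity term, as the square of the norm of u - g - w / alpha. *)
have : 0 <= norm (u \- g) ^+ 2 + 2 * - alpha^-1 * int (fun x => (u \- g) x * w x)
    + (- alpha^-1) ^+ 2 * norm w ^+ 2.
  by rewrite -Rintegral_sqrDZ//; apply: Rintegral_ge0 => x _; exact: sqr_ge0.
have -> : int (fun x => (u \- g) x * w x) = int (fun x => u x * w x) - int (fun x => g x * w x).
  rewrite -RintegralB//; [|exact: L2_mul_itg|exact: L2_mul_itg].
  by apply: eq_Rintegral => x _ /=; ring.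
have := L2_cauchy_schwarz mO ghgL wL.
have -> : int (fun x => (g \- gh) x * w x) = int (fun x => g x * w x) - int (fun x => w x * gh x).
  rewrite -RintegralB//; [|exact: L2_mul_itg|exact: L2_mul_itg].
  by apply: eq_Rintegral => x _ /=; ring.
move: WD J1 tu0; move: (int (fun x => w x * gh x)) (int (fun x => u x * w x)) (int (fun x => g x * w x)).
move: (norm w) (norm gh) (norm (g \- gh)) (norm (u \- g)) (fine _) => W H N A t J P Q.
move=> HP /andP[J1 J2] t0 HQ HA N0 H0 W0.
rewrite ler_norml in HQ; move/andP : HQ => [HQ1 HQ2].
have -> : - (2 * alpha)^-1 * (W ^+ 2 + 2 * alpha * J + alpha ^+ 2 * H ^+ 2) +
    alpha / 2 * H ^+ 2 = - (W ^+ 2 / (2 * alpha)) - J by field; rewrite gt_eqF.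
(* In the first case the error N W of replacing g by gh is at most 2 alpha H N; in the second, J >=
   - W H leaves a nonpositive dual energy. *)
have [WH|WH] := leP W (2 * alpha * H).
  have HA' : 0 <= alpha / 2 * A ^+ 2 - (P - Q) + W ^+ 2 / (2 * alpha).
    have : 0 <= alpha / 2 * (A ^+ 2 + 2 * - alpha^-1 * (P - Q) + (- alpha^-1) ^+ 2 * W ^+ 2).
      by rewrite mulr_ge0// divr_ge0// ltW.
    by congr (0 <= _); field; rewrite gt_eqF.
  have := ler_wpM2l N0 WH; lra.
have a20 : 0 <= alpha / 2 * A ^+ 2 by rewrite mulr_ge0 ?sqr_ge0// divr_ge0// ltW.
have HN0 : 0 <= 2 * alpha * H * N by rewrite !mulr_ge0// ltW.
suff : W * H <= W ^+ 2 / (2 * alpha) by lra.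
rewrite ler_pdivlMr ?mulr_gt0// expr2 -mulrA ler_wpM2l//; lra.
Qed.

(** The expansion of the square leaves the term |g - gh|^2; bounding one of its factors by |g| +
    |gh| keeps the error linear in |g - gh|. *)
Lemma L2norm_data_le (v g gh : V -> R) : L2 v -> L2 g -> L2 gh ->
  norm (v \- g) ^+ 2 <= norm (v \- gh) ^+ 2
    + norm (g \- gh) * (2 * norm (v \- gh) + norm g + norm gh).
Proof.
move=> vL gL ghL; have vghL : L2 (v \- gh) := L2B mO vL ghL.
have gghL : L2 (g \- gh) := L2B mO gL ghL.
have -> : norm (v \- g) = norm (fun x => (v \- gh) x + (- 1) * (g \- gh) x).
  by apply: eq_L2norm => x _ /=; ring.
have -> : norm (fun x => (v \- gh) x + (- 1) * (g \- gh) x) ^+ 2 =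
    norm (v \- gh) ^+ 2 + 2 * (- 1) * int (fun x => (v \- gh) x * (g \- gh) x)
    + (- 1) ^+ 2 * norm (g \- gh) ^+ 2 by rewrite L2norm_sqr Rintegral_sqrDZ.
have := L2_cauchy_schwarz mO vghL gghL; rewrite ler_norml => /andP[+ _].
have := L2norm_triangle mO gL (L2N mO ghL); rewrite L2normN -/(g \- gh).
have := L2norm_ge0 Omega (g \- gh).
move: (norm (v \- gh)) (norm (g \- gh)) (norm g) (norm gh) (Rintegral _ _ _) => a N x y I N0 HN HI.
have := ler_wpM2l N0 HN; nra.
Qed.

Lemma S1_0 Th : S1 Omega Th (fun=> 0).
Proof.
split; first by apply: continuous_subspaceT => x; exact: cst_continuous.
move=> K _; exists (fun=> 0) => //; exists (fun=> 0) => x.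
by rewrite big1// => m _; rewrite mul0r.
Qed.

Lemma Eh_rof0 (alpha : R) (gh : V -> R) :
  Eh_rof Omega alpha gh (fun=> 0) = alpha / 2 * norm gh ^+ 2.
Proof.
rewrite /Eh_rof (_ : Rintegral _ _ _ = 0) ?add0r.
  congr (_ * _ ^+ 2); rewrite -[RHS]L2normN; apply: eq_L2norm => x _ /=.
  by rewrite sub0r.
transitivity (int (fun=> 0)); last by rewrite Rintegral_cst// mul0r.
apply: eq_Rintegral => x _; rewrite /enorm /dotp big1 ?sqrtr0// => i _.
by rewrite mxE pderiv_cst mul0r.
Qed.

End rof_energy.

Theorem proposition5p3 (R : realType) (d : nat) (hd : d = 2%N \/ d = 3%N)
    (Omega : set 'rV[R]_d) (hOmega : polyhedral_lipschitz_domain Omega)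
    (alpha : R) (halpha : 0 < alpha) :
  exists c : R -> R, (forall m : R, 0 < c m) /\
  forall (T : R -> set (set 'rV[R]_d)),
  (forall h : R, 0 < h -> regular_triangulation Omega (T h)) ->
  forall g : 'rV[R]_d -> R, L2 Omega g ->
  forall u : 'rV[R]_d -> R,
  is_minimizer [set v | BV Omega v /\ L2 Omega v] (E_rof Omega alpha g) u ->
  forall h : R, 0 < h ->
  let Th := T h in
  let gh := elt_mean Th g in
  let Xh := S1 Omega Th in
  forall Yh : set ('rV[R]_d -> 'rV[R]_d),
  Yh = S1vec_HN Omega Th \/ Yh = L1vec_HN Omega Th ->
  forall uh : 'rV[R]_d -> R,
  is_minimizer Xh (fun v => (Eh_rof Omega alpha gh v)%:E) uh ->
  forall ph : 'rV[R]_d -> 'rV[R]_d,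
  is_maximizer Yh (Dh_rof Omega alpha gh) ph ->
  forall (vh : 'rV[R]_d -> R) (qh : 'rV[R]_d -> 'rV[R]_d),
  Xh vh -> Yh qh -> unit_ball_ae Omega qh ->
  ((alpha / 2 * L2norm Omega (u \- uh) ^+ 2)%:E <=
   eta_rof_sq Omega alpha gh vh qh
   + (c (L2norm Omega g) * L2norm Omega (g \- gh))%:E)%E.
Proof.
have d0 : (0 < d)%N by case: hd => ->.
have [[_ oO _ bO] [_ lO]] := hOmega.
have mO := open_measurable_rV oO; have Ooo := lebesgue_bounded oO bO.
(* The primal side contributes alpha/2 times 4 |g| and the dual side 2 alpha |gh| <= 2 alpha |g|.
   The absolute value and the summand 1 make c positive on all of R. *)
exists (fun m => 4 * alpha * `|m| + 1); split.
  by move=> m; rewrite ltr_wpDl// mulr_ge0// mulr_ge0// ltW.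
move=> T rT g gL u umin h h0 Th gh Xh Yh hYh uh [uhS uhmin] ph _ vh qh vhS qhY q1.
have rTh := rT h h0; have [finTh simTh covTh _] := rTh.
have qN : HN Omega qh by case: hYh qhY => -> [].
have ghL : L2 Omega gh := elt_mean_L2 oO bO rTh g.
have ghg : L2norm Omega gh <= L2norm Omega g := L2norm_elt_mean oO bO lO rTh gL.
have uhL : L2 Omega uh := S1_L2 oO bO finTh covTh uhS.
have uhBV : BV Omega uh := S1_BV oO bO d0 finTh simTh covTh uhS.
have uhTV := S1_TV oO bO d0 finTh simTh covTh uhS.
have [[[_ uTV] uL] _] := umin.
have H1 := rof_strong_convexity oO bO (ltW halpha) gL umin uhBV uhL.
have H2 := rof_dual_le oO bO halpha lO gL ghL uL uTV qN q1.
have H3 := L2norm_data_le oO uhL gL ghL.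
have H4 : Eh_rof Omega alpha gh uh <= Eh_rof Omega alpha gh vh.
  by rewrite -lee_fin; exact: uhmin.
have H5 : Eh_rof Omega alpha gh uh <= alpha / 2 * L2norm Omega gh ^+ 2.
  by rewrite -Eh_rof0// -lee_fin; apply: uhmin; exact: S1_0.
have fuh : TV Omega uh \is a fin_num by rewrite ge0_fin_numE ?uhBV.2// TV_ge0.
have H6 : fine (TV Omega uh) <= \int[lebesgue_rV R d]_(x in Omega) enorm (grad uh x).
  by rewrite -lee_fin fineK.
rewrite /eta_rof_sq; have -> : Dh_rof Omega alpha gh qh = (- (2 * alpha)^-1 *
    L2norm Omega (fun x => wdiv Omega qh x + alpha * gh x) ^+ 2 +
    alpha / 2 * L2norm Omega gh ^+ 2)%:E by rewrite /Dh_rof /I_K10 asboolT// sube0.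
rewrite -EFinB -EFinD lee_fin (ger0_norm (L2norm_ge0 _ _)).
have G0 : 0 <= \int[lebesgue_rV R d]_(x in Omega) enorm (grad uh x).
  by apply: Rintegral_ge0 => x _; exact: enorm_ge0.
have a20 : 0 < alpha / 2 by rewrite divr_gt0.
(* The nonnegative gradient term is dropped from the energy of uh, which is at most that of the zero
   function. *)
have H7 : L2norm Omega (uh \- gh) <= L2norm Omega gh.
  rewrite -(@ler_pXn2r _ 2)// ?nnegrE ?L2norm_ge0//.
  by rewrite -(ler_pM2l a20); move: H5; rewrite /Eh_rof; lra.
have N0 := L2norm_ge0 Omega (g \- gh).
have B : L2norm Omega (g \- gh) * (2 * L2norm Omega (uh \- gh) + L2norm Omega g + L2norm Omega gh)
    <= L2norm Omega (g \- gh) * (4 * L2norm Omega g) by rewrite ler_wpM2l//; lra.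
have H2' := ler_wpM2l (ltW halpha) (ler_wpM2l N0 ghg).
have H3' := ler_wpM2l (ltW a20) (le_trans H3 (lerD (lexx _) B)).
move: H1 H2 H2' H3' H4 H6; rewrite {1}/Eh_rof.
move: (Eh_rof _ _ _ _) (\int[_]_(x in Omega) enorm (grad uh x)) (fine _) (fine _) => E I t1 t2.
move: N0; clear; move: (- _ * _ ^+ 2 + _) (L2norm _ (u \- uh) ^+ 2) (L2norm _ (u \- g) ^+ 2)
  (L2norm _ (uh \- g) ^+ 2) (L2norm _ (uh \- gh) ^+ 2) => Dq n1 n2 n3 n4.
move: (L2norm _ (g \- gh)) (L2norm _ gh) (L2norm _ g) => N k m N0.
by lra.
Qed.
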